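(* There exists a $C^\infty$, nonnegative, radial function $g:\mathbb{C}\to[0,\infty)$ such that: (1) $g k_a\in L^2(\mu)$ for every $a\in\mathbb{C}$; (2) the heat transform $g^{(t)}$ belongs to $L^\infty(\mathbb{C})$ for every $t>0$; (3) the Toeplitz form $\mathfrak{t}_g$ is bounded on $F^2(\mathbb{C})\times F^2(\mathbb{C})$, hence the induced operator $T_g:F^2(\mathbb{C})\to F^2(\mathbb{C})$ is bounded; (4) the operator $U_g:\mathcal{D}(M_g)\subset L^2(\mu)\to F^2(\mathbb{C})$ is unbounded.
   Context: $dA$ is planar Lebesgue measure, $d\mu(z)=\pi^{-1}e^{-|z|^2}\,dA(z)$, and $F^2(\mathbb{C})$ is the Bargmann space of entire $f$ with $\|f\|_{F^2}^2=\int_{\mathbb{C}}|f|^2\,d\mu<\infty$. $P:L^2(\mu)\to F^2(\mathbb{C})$ is the orthogonal projection. The normalized coherent states are $k_a(z)=e^{z\overline a-|a|^2/2}$, $a\in\mathbb{C}$. Heat transform: $g^{(t)}(x)=\frac{1}{4\pi t}\int_{\mathbb{C}}g(y)e^{-|x-y|^2/(4t)}\,dA(y)$ for $t>0$. Toeplitz form: $\mathcal{D}(\mathfrak{t}_g)=\{f\in F^2(\mathbb{C}): |g|^{1/2}f\in L^2(\mu)\}$ and $\mathfrak{t}_g(f,h)=\int_{\mathbb{C}}g f\overline h\,d\mu$ for $f,h\in\mathcal{D}(\mathfrak{t}_g)$. The form $\mathfrak{t}_g$ is called bounded on $F^2\times F^2$ if $\mathcal{D}(\mathfrak{t}_g)$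 is dense in $F^2(\mathbb{C})$ and there is $C>0$ with $|\mathfrak{t}_g(f,h)|\le C\|f\|_{F^2}\|h\|_{F^2}$ on $\mathcal{D}(\mathfrak{t}_g)\times\mathcal{D}(\mathfrak{t}_g)$; it then extends to a bounded sesquilinear form on $F^2\times F^2$, and $T_g$ is the unique bounded operator on $F^2(\mathbb{C})$ with $\langle T_gf,h\rangle=\mathfrak{t}_g(f,h)$ for all $f,h\in F^2(\mathbb{C})$ (extended form). Natural-domain operator: $\mathcal{D}(M_g)=\{f\in L^2(\mu): gf\in L^2(\mu)\}$ and $U_gf=P(gf)$ for $f\in\mathcal{D}(M_g)$. $U_g$ is bounded if there is $C>0$ with $\|U_gf\|_{F^2}\le C\|f\|_{L^2(\mu)}$ for all $f\in\mathcal{D}(M_g)$, and unbounded otherwise. *)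

(* Defs.v *)
From HB Require Import structures.
From mathcomp Require Import all_boot all_order all_algebra complex.
From mathcomp Require Import all_classical all_reals all_analysis.
From mathcomp Require Import measurable_realfun.

Set Implicit Arguments.
Unset Strict Implicit.
Unset Printing Implicit Defensive.

Import Order.TTheory GRing.Theory Num.Theory.
Import numFieldNormedType.Exports.
Import Normc.

Local Open Scope classical_set_scope.
Local Open Scope complex_scope.
Local Open Scope ring_scope.

(* MathComp-Analysis has no measurable structure on R[i]: integrals over the
   complex plane are taken over R * R with its product Borel sigma-algebra,
   and functions on R[i] are pulled back along (x, y) |-> x + i y. *)
Definition cplx (R : realType) (p : R * R) : R[i] := p.1 +i* p.2.

Definition cexp (R : realType) (z : R[i]) : R[i] :=
  (expR (complex.Re z))%:C * (cos (complex.Im z) +i* sin (complex.Im z)).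

Notation plane R := (measurableTypeR R * measurableTypeR R)%type.

Notation dA R := (@lebesgue_measure R \x @lebesgue_measure R)%E.

Definition gauss_weight (R : realType) (p : plane R) : R :=
  pi^-1 * expR (- normc (cplx p) ^+ 2).

Definition gauss_measure (R : realType) (A : set (plane R)) : \bar R :=
  (\int[dA R]_(p in A) (gauss_weight p)%:E)%E.

Section gauss_measure_isMeasure.
Variable R : realType.

Lemma gauss_weight_ge0 (p : plane R) : 0 <= gauss_weight p.
Proof. by rewrite mulr_ge0 ?expR_ge0// invr_ge0 pi_ge0. Qed.

Lemma measurable_gauss_weight : measurable_fun setT (@gauss_weight R).
Proof.
have -> : @gauss_weight R =
    fun p : plane R => pi^-1 * expR (- (p.1 ^+ 2 + p.2 ^+ 2)).
  apply/funext => p.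
  by rewrite /gauss_weight /normc /cplx/= sqr_sqrtr// addr_ge0 ?sqr_ge0.
apply: measurable_funM => //; apply: measurableT_comp => //.
apply: measurableT_comp => //; apply: measurable_funD.
- by apply: measurable_funX; exact: measurable_fst.
- by apply: measurable_funX; exact: measurable_snd.
Qed.

Let mu0 : @gauss_measure R set0 = 0%E.
Proof. by rewrite /gauss_measure integral_set0. Qed.

Let mu_ge0 (A : set (plane R)) : (0 <= gauss_measure A)%E.
Proof. by apply: integral_ge0 => p _; rewrite lee_fin gauss_weight_ge0. Qed.

Let mu_sigma_additive : semi_sigma_additive (@gauss_measure R).
Proof.
move=> A mA tA mUA; rewrite /gauss_measure ge0_integral_bigcup//=.
- apply: is_cvg_ereal_nneg_natsum_cond => n _ _.
  by apply: integral_ge0 => p _; rewrite lee_fin gauss_weight_ge0.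
- by apply/measurable_EFinP/measurable_funTS; exact: measurable_gauss_weight.
- by move=> p _; rewrite lee_fin gauss_weight_ge0.
Qed.

HB.instance Definition _ := isMeasure.Build _ _ _
  (@gauss_measure R) mu0 mu_ge0 mu_sigma_additive.

End gauss_measure_isMeasure.

Notation dmu R := (@gauss_measure R).

Definition mu_integral (R : realType) (F : R[i] -> R[i]) : R[i] :=
  (\int[dmu R]_p complex.Re (F (cplx p))) +i*
  (\int[dmu R]_p complex.Im (F (cplx p))).

(* The space of square-integrable Borel functions (not quotiented by almost
   everywhere equality). *)
Definition L2mu (R : realType) : set (R[i] -> R[i]) := [set f : R[i] -> R[i] |
  [/\ measurable_fun [set: plane R] (fun p => complex.Re (f (cplx p))),
      measurable_fun [set: plane R] (fun p => complex.Im (f (cplx p))) &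
      (\int[dmu R]_p (normc (f (cplx p)) ^+ 2)%:E < +oo)%E]].

Definition inner (R : realType) (f h : R[i] -> R[i]) : R[i] :=
  mu_integral (fun z => f z * (h z)^*).

Definition norm2 (R : realType) (f : R[i] -> R[i]) : R :=
  Num.sqrt (\int[dmu R]_p (normc (f (cplx p)) ^+ 2)).

Definition entire (R : realType) (f : R[i] -> R[i]) : Prop :=
  forall z : R[i]^o, derivable (f : R[i]^o -> R[i]^o) z 1.

Definition bargmann (R : realType) : set (R[i] -> R[i]) :=
  [set f | entire f /\ L2mu f].

Definition coherent (R : realType) (a z : R[i]) : R[i] :=
  cexp (z * a^* - (normc a ^+ 2 / 2)%:C).

Fixpoint Ck (R : realType) (n : nat) (f : R^o * R^o -> R^o) : Prop :=
  continuous f /\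
  if n is m.+1 then
    forall v : R^o * R^o, v = (1, 0) \/ v = (0, 1) ->
      (forall p, derivable f p v) /\ Ck m ('D_v f)
  else True.

Definition smooth (R : realType) (g : R[i] -> R) : Prop :=
  forall n, Ck n (fun p : R^o * R^o => g (cplx p) : R^o).

Definition radial (R : realType) (g : R[i] -> R) : Prop :=
  forall z w, normc z = normc w -> g z = g w.

(* The integral is taken in the extended reals, so that a divergent integral of
   a nonnegative g gives +oo. *)
Definition heat (R : realType) (g : R[i] -> R) (t : R) (x : R[i]) : \bar R :=
  ((4 * pi * t)^-1%:E * \int[dA R]_y
     (g (cplx y) * expR (- (normc (x - cplx y) ^+ 2 / (4 * t))))%:E)%E.

Definition in_Linfty (R : realType) (u : R[i] -> \bar R) : Prop :=
  measurable_fun [set: plane R] (u \o @cplx R) /\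
  ('N[dA R]_+oo [u \o @cplx R] < +oo)%E.

Definition toeplitz_dom (R : realType) (g : R[i] -> R) : set (R[i] -> R[i]) :=
  [set f | bargmann f /\ L2mu (fun z => (Num.sqrt `|g z|)%:C * f z)].

Definition toeplitz_form (R : realType) (g : R[i] -> R)
    (f h : R[i] -> R[i]) : R[i] :=
  mu_integral (fun z => (g z)%:C * f z * (h z)^*).

Definition dense_in_bargmann (R : realType) (D : set (R[i] -> R[i])) : Prop :=
  forall f, bargmann f -> forall e : R, 0 < e ->
    exists2 h, D h & norm2 (fun z => f z - h z) < e.

Definition bounded_form_on (R : realType) (D : set (R[i] -> R[i]))
    (t : (R[i] -> R[i]) -> (R[i] -> R[i]) -> R[i]) : Prop :=
  exists2 C : R, 0 < C & forall f h, D f -> D h ->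
    normc (t f h) <= C * norm2 f * norm2 h.

Definition toeplitz_form_bounded (R : realType) (g : R[i] -> R) : Prop :=
  dense_in_bargmann (toeplitz_dom g) /\
  bounded_form_on (toeplitz_dom g) (toeplitz_form g).

Definition sesquilinear_on_bargmann (R : realType)
    (t : (R[i] -> R[i]) -> (R[i] -> R[i]) -> R[i]) : Prop :=
  forall (a : R[i]) f1 f2 h, bargmann f1 -> bargmann f2 -> bargmann h ->
    t (fun z => a * f1 z + f2 z) h = a * t f1 h + t f2 h /\
    t h (fun z => a * f1 z + f2 z) = a^* * t h f1 + t h f2.

Definition extended_toeplitz_form (R : realType) (g : R[i] -> R)
    (t : (R[i] -> R[i]) -> (R[i] -> R[i]) -> R[i]) : Prop :=
  [/\ sesquilinear_on_bargmann t, bounded_form_on (@bargmann R) t &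
      forall f h, toeplitz_dom g f -> toeplitz_dom g h ->
        t f h = toeplitz_form g f h].

(* Only the values of T on bargmann are meaningful. *)
Definition bounded_operator (R : realType)
    (T : (R[i] -> R[i]) -> (R[i] -> R[i])) : Prop :=
  [/\ forall f, bargmann f -> bargmann (T f),
      forall (a : R[i]) f h, bargmann f -> bargmann h ->
        T (fun z => a * f z + h z) = (fun z => a * T f z + T h z) &
      exists2 C : R, 0 < C &
        forall f, bargmann f -> norm2 (T f) <= C * norm2 f].

Definition represents_toeplitz (R : realType) (g : R[i] -> R)
    (T : (R[i] -> R[i]) -> (R[i] -> R[i])) : Prop :=
  exists2 t, extended_toeplitz_form g t &
    forall f h, bargmann f -> bargmann h -> inner (T f) h = t f h.

Definition is_toeplitz_operator (R : realType) (g : R[i] -> R)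
    (T : (R[i] -> R[i]) -> (R[i] -> R[i])) : Prop :=
  [/\ bounded_operator T, represents_toeplitz g T &
      forall T', bounded_operator T' -> represents_toeplitz g T' ->
        forall f, bargmann f -> T' f = T f].

(* Orthogonal projection of L^2(mu) onto the Bargmann space; the default 0 is
   only reached when no projection exists. *)
Definition bargmann_proj (R : realType) (f : R[i] -> R[i]) : R[i] -> R[i] :=
  xget (fun=> 0) [set h | bargmann h /\
    forall k, bargmann k -> inner (fun z => f z - h z) k = 0].

Definition mult_dom (R : realType) (g : R[i] -> R) : set (R[i] -> R[i]) :=
  [set f | L2mu f /\ L2mu (fun z => (g z)%:C * f z)].

Definition U_op (R : realType) (g : R[i] -> R) (f : R[i] -> R[i]) :=
  bargmann_proj (fun z => (g z)%:C * f z).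

Definition U_bounded (R : realType) (g : R[i] -> R) : Prop :=
  exists2 C : R, 0 < C &
    forall f, mult_dom g f -> norm2 (U_op g f) <= C * norm2 f.

(* Main.v *)
From HB Require Import structures.
Require Import Defs.
From mathcomp Require Import all_boot all_order all_algebra complex.
From mathcomp Require Import all_classical all_reals all_analysis.
From mathcomp Require Import measurable_realfun ess_sup_inf lra ring.
Set Implicit Arguments.
Unset Strict Implicit.
Unset Printing Implicit Defensive.
Import Order.TTheory GRing.Theory Num.Theory.
Import numFieldNormedType.Exports.
Import Normc.
Local Open Scope classical_set_scope.
Local Open Scope complex_scope.
Local Open Scope ring_scope.

(** The symbol is [g z = profile (|z| ^ 2)], where [profile] is the derivative of
    [primitive s = s / 2 + arg (2 + s ^ 2 * (1 - exp (- i * s)))]. It is an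
    elementary expression with a denominator bounded away from zero, hence
    smooth, and it is nonnegative. At each multiple of [2 * pi] it has a peak of
    height about [s ^ 2 / 2] and width about [s ^ -2], so [g] consists of high and
    thin annuli. The mass of each peak is bounded, since [primitive s - s / 2] is
    a bounded function.

    Boundedness. Integrating along lines with [profile_interval_le], one sees that
    [g] has bounded mass on unit squares ([square_symbol_le]); hence all its
    Gaussian averages are bounded uniformly in the centre
    ([symbol_gauss_average_le]). This bounds the heat transforms, and it also
    bounds the Toeplitz form. Indeed the projection onto the Bargmann space is
    the integral operator with kernel [exp (w * z^* )], and a Schur test with
    Gaussian weights ([schur_test]) bounds [phi * P * psi] on [L^2] as soon as the
    Gaussian averages of [phi ^ 2] and [psi ^ 2] are bounded. With [psi = 1] and
    [phi = sqrt g] this says that [f |-> sqrt g * f] is bounded on the Bargmann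
    space, so that the form [<sqrt g * f, sqrt g * h>] is everywhere defined and
    bounded, and the operator is [T_g f = P (sqrt g * sqrt g * f)].

    The projection is controlled through the formula [reproducing]. Its proof
    translates the point to the origin and uses the rotation invariance of the
    Gaussian measure, which reduces it to the mean value property of entire
    functions on circles. As entire functions are only assumed to be complex
    differentiable, that property rests on Goursat's theorem ([goursat]),
    applied in logarithmic coordinates.

    Unboundedness. If [U_g] were bounded then, taking [f = g * k_a], one would get
    [|g * k_a| ^ 2 = <U_g (g * k_a), k_a> <= C * |g * k_a| * |k_a|], so the norms of
    [g * k_a] would be bounded. But [|g * k_a| ^ 2] is a Gaussian average of [g ^ 2]
    around [a], and the peaks, of height about [|a| ^ 4] and radial width about
    [|a| ^ -5], make it unbounded ([symbol_sqr_average_ge]). *)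

(** * Modulus and exponential of complex numbers *)

Section complex_norm.
Variable R : realType.
Implicit Types (x y z : R[i]).

Lemma normc_ge0 z : 0 <= normc z.
Proof. by case: z => a b; exact: sqrtr_ge0. Qed.

Lemma sqr_normc_def z : normc z ^+ 2 = complex.Re z ^+ 2 + complex.Im z ^+ 2.
Proof. by case: z => a b /=; rewrite sqr_sqrtr// addr_ge0// sqr_ge0. Qed.

Lemma normcC z : normc z^* = normc z.
Proof. by case: z => a b /=; rewrite sqrrN. Qed.

Lemma normc_opp z : normc (- z) = normc z.
Proof. exact: normcN. Qed.

Lemma normcR (a : R) : normc a%:C = `|a|.
Proof. by rewrite /normc /= expr0n addr0 sqrtr_sqr. Qed.

Lemma normc_triangle x y : normc (x + y) <= normc x + normc y.
Proof. exact: le_normcD. Qed.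

Lemma normc_eq0 z : (normc z == 0) = (z == 0).
Proof.
by apply/eqP/eqP => [/eq0_normc//|->]; exact: normc0.
Qed.

Lemma normc_gt0 z : (0 < normc z) = (z != 0).
Proof. by rewrite lt_neqAle eq_sym normc_eq0 normc_ge0 andbT. Qed.

Lemma ler_Re_normc z : `|complex.Re z| <= normc z.
Proof.
rewrite -(ler_pXn2r (n := 2)) ?nnegrE ?normc_ge0// sqr_normc_def real_normK ?num_real//.
by rewrite lerDl sqr_ge0.
Qed.

Lemma ler_Im_normc z : `|complex.Im z| <= normc z.
Proof.
rewrite -(ler_pXn2r (n := 2)) ?nnegrE ?normc_ge0// sqr_normc_def real_normK ?num_real//.
by rewrite lerDr sqr_ge0.
Qed.

Lemma normc_le_ReIm z : normc z <= `|complex.Re z| + `|complex.Im z|.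
Proof.
rewrite -(ler_pXn2r (n := 2)) ?nnegrE ?normc_ge0 ?addr_ge0// sqr_normc_def.
rewrite sqrrD !real_normK ?num_real// -addrA lerD2l lerDr.
by rewrite mulrn_wge0// mulr_ge0.
Qed.

Lemma ReD x y : complex.Re (x + y) = complex.Re x + complex.Re y.
Proof. by case: x; case: y. Qed.
Lemma ImD x y : complex.Im (x + y) = complex.Im x + complex.Im y.
Proof. by case: x; case: y. Qed.
Lemma ReN x : complex.Re (- x) = - complex.Re x. Proof. by case: x. Qed.
Lemma ImN x : complex.Im (- x) = - complex.Im x. Proof. by case: x. Qed.
Lemma ReM x y : complex.Re (x * y) =
  complex.Re x * complex.Re y - complex.Im x * complex.Im y.
Proof. by case: x; case: y. Qed.
Lemma ImM x y : complex.Im (x * y) =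
  complex.Re x * complex.Im y + complex.Im x * complex.Re y.
Proof. by case: x; case: y. Qed.
Lemma ReC x : complex.Re x^* = complex.Re x. Proof. by case: x. Qed.
Lemma ImC x : complex.Im x^* = - complex.Im x. Proof. by case: x. Qed.
Lemma complex_ext x y :
  complex.Re x = complex.Re y -> complex.Im x = complex.Im y -> x = y.
Proof. by case: x => a b; case: y => c d /= -> ->. Qed.

Definition ReImE := (ReD, ImD, ReN, ImN, ReM, ImM, ReC, ImC).

Lemma mulc_conj z : z * z^* = (normc z ^+ 2)%:C.
Proof.
by apply: complex_ext; rewrite !ReImE/= ?sqr_normc_def; ring.
Qed.

End complex_norm.

Section complex_exponential.
Variable R : realType.
Implicit Types (x y z u : R[i]).

Lemma cexpD x y : cexp (x + y) = cexp x * cexp y.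
Proof.
rewrite /cexp; case: x => a b; case: y => c d /=.
by apply: complex_ext; rewrite !ReImE/= expRD cosD sinD; ring.
Qed.

Lemma cexp0 : cexp (0 : R[i]) = 1.
Proof. by rewrite /cexp /= expR0 cos0 sin0 mul1r. Qed.

Lemma normc_cexp z : normc (cexp z) = expR (complex.Re z).
Proof.
rewrite /cexp normcM normcR ger0_norm ?expR_ge0//.
by rewrite /normc cos2Dsin2 sqrtr1 mulr1.
Qed.

Lemma cexpC z : (cexp z)^* = cexp z^*.
Proof.
by case: z => a b; rewrite /cexp/= cosN sinN; apply: complex_ext; rewrite !ReImE/=; ring.
Qed.

Lemma expR_ge1_nneg (t : R) : 0 <= t -> 1 <= expR t.
Proof. by rewrite -[X in X <= expR _]expR0 ler_expR. Qed.

Lemma expR_sub1_le (t : R) : `|expR t - 1| <= `|t| * expR `|t|.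
Proof.
have h1 := expR_ge1Dx t; have h2 := expR_ge1Dx (- t).
have e0 := expR_gt0 t.
have hE : expR t * expR (- t) = 1 by rewrite -expRD subrr expR0.
have h3 : expR t - 1 <= t * expR t.
  by have := ler_wpM2l (ltW e0) h2; rewrite hE => ?; lra.
have [t0|t0] := leP 0 t.
  by rewrite !ger0_norm ?subr_ge0 ?expR_ge1_nneg//; lra.
have e1 : 1 <= expR (- t) by apply: expR_ge1_nneg; lra.
have : expR t <= 1 by rewrite -[leRHS]expR0 ler_expR; lra.
move=> h4; rewrite !ler0_norm; try lra.
nra.
Qed.

Lemma expR_sub1x_le (t : R) : `|expR t - 1 - t| <= t ^+ 2 * expR `|t|.
Proof.
have h1 := expR_ge1Dx t; have h2 := expR_ge1Dx (- t).
have e0 := expR_gt0 t.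
have hE : expR t * expR (- t) = 1 by rewrite -expRD subrr expR0.
have h3 : expR t - 1 <= t * expR t.
  by have := ler_wpM2l (ltW e0) h2; rewrite hE => ?; lra.
rewrite ger0_norm; last lra.
have h5 : expR t - 1 - t <= t * (expR t - 1) by lra.
apply: (le_trans h5); rewrite expr2 -mulrA.
have h := expR_sub1_le t.
have [t0|t0] := leP 0 t.
  rewrite (ger0_norm t0) in h *; apply: ler_wpM2l => //.
rewrite (ltr0_norm t0) in h *; apply: (ler_wnM2l (ltW t0)).
by move: h; rewrite ler_norml mulNr opprK => /andP[].
Qed.

Lemma one_sub_cos_le (t : R) : 1 - cos t <= t ^+ 2 / 2.
Proof.
suff H (s : R) : 0 <= s -> 1 - cos s <= s ^+ 2 / 2.
  have [t0|t0] := leP 0 t; first exact: H.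
  by have := H (- t); rewrite cosN sqrrN; move=> /(_ ltac:(lra)).
rewrite le_eqVlt => /predU1P[<-|s0]; first by rewrite cos0; lra.
have [||c] := @MVT _ (fun v : R => v ^+ 2 / 2 + cos v) (fun v : R => v - sin v) 0 s s0.
- by move=> x _; apply: is_derive_eq; rewrite /GRing.scale/=; field.
- apply: continuous_subspaceT => x.
  by apply: differentiable_continuous; apply/derivable1_diffP; exact: ex_derive.
rewrite in_itv/= => /andP[c0 cs].
rewrite cos0 expr0n/= mul0r add0r subr0 => E.
suff h : 0 <= c - sin c by have : 0 <= (c - sin c) * s by [exact: mulr_ge0 (ltW s0)]; lra.
have [|d] := @MVT _ (fun v : R => v - sin v) (fun v : R => 1 - cos v) 0 c c0.
  by apply: continuous_subspaceT => x; apply: differentiable_continuous; apply/derivable1_diffP; exact: ex_derive.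
rewrite in_itv/= => /andP[d0 dc]; rewrite sin0 !subr0 => ->.
by have := cos_le1 d => ?; nra.
Qed.
End complex_exponential.

(** * Complex differentiability *)

Section complex_exponential_bounds.
Variable R : realType.

Lemma sub_sin_le (t : R) : `|t - sin t| <= t ^+ 2.
Proof.
suff H (s : R) : 0 <= s -> `|s - sin s| <= s ^+ 2.
  have [t0|t0] := leP 0 t; first exact: H.
  by have := H (- t) ltac:(lra); rewrite sinN sqrrN opprK -normrN opprD opprK.
rewrite le_eqVlt => /predU1P[<-|s0]; first by rewrite sin0 subrr normr0 expr0n.
have [|d] := @MVT _ (fun v : R => v - sin v) (fun v : R => 1 - cos v) 0 s s0.
  by apply: continuous_subspaceT => x; apply: differentiable_continuous;
    apply/derivable1_diffP; exact: ex_derive.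
rewrite in_itv/= => /andP[d0 dc]; rewrite sin0 !subr0 => ->.
have h1 := cos_le1 d; have h2 := cos_geN1 d; have h3 := one_sub_cos_le d.
rewrite ger0_norm; last by nra.
have h : 1 - cos d <= d.
  by have [?|?] := leP 2 d; [lra|nra].
nra.
Qed.

Lemma norm_sin_le (t : R) : `|sin t| <= `|t|.
Proof.
suff H (s : R) : 0 <= s -> `|sin s| <= s.
  have [t0|t0] := leP 0 t; first by rewrite (ger0_norm t0); exact: H.
  by have := H (- t) ltac:(lra); rewrite sinN normrN (ltr0_norm t0).
rewrite le_eqVlt => /predU1P[<-|s0]; first by rewrite sin0 normr0.
have [|d] := @MVT _ (@sin R) (@cos R) 0 s s0.
  by apply: continuous_subspaceT => x; apply: differentiable_continuous;
    apply/derivable1_diffP; exact: ex_derive.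
rewrite in_itv/= => /andP[d0 dc]; rewrite sin0 !subr0 => ->.
have h1 := cos_le1 d; have h2 := cos_geN1 d.
by rewrite normrM (gtr0_norm s0); apply: ler_piMl; [exact: ltW|rewrite ler_norml h1 h2].
Qed.

Lemma cexp_sub1x_le (u : R[i]) :
  normc (cexp u - 1 - u) <= 4 * normc u ^+ 2 * expR (normc u).
Proof.
case: u => x y; set N := normc (x +i* y).
have xN : `|x| <= N by exact: (ler_Re_normc (x +i* y)).
have yN : `|y| <= N by exact: (ler_Im_normc (x +i* y)).
have N0 : 0 <= N by exact: normc_ge0.
have eN : 1 <= expR N by exact: expR_ge1_nneg.
have exN : expR `|x| <= expR N by rewrite ler_expR.
have ex : expR x <= expR N by rewrite ler_expR (le_trans (ler_norm x)).
have ex0 := expR_gt0 x.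
apply: le_trans (normc_le_ReIm _) _.
rewrite !ReImE/= mul0r subr0 oppr0 addr0 mul0r addr0.
have -> : expR x * cos y - 1 - x = (expR x - 1 - x) - expR x * (1 - cos y) by ring.
have -> : expR x * sin y - y = (expR x - 1) * sin y - (y - sin y) by ring.
have a1 : `|expR x - 1 - x| <= N ^+ 2 * expR N.
  apply: le_trans (expR_sub1x_le x) _; apply: ler_pM => //; rewrite ?sqr_ge0 ?expR_ge0//.
  by rewrite -real_normK ?num_real// ler_pXn2r// nnegrE.
have y2 : y ^+ 2 <= N ^+ 2.
  by rewrite -[leLHS]real_normK ?num_real// ler_pXn2r// nnegrE.
have N20 : 0 <= N ^+ 2 by exact: sqr_ge0.
have a2 : `|expR x * (1 - cos y)| <= N ^+ 2 * expR N.
  rewrite normrM (gtr0_norm ex0) mulrC.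
  have c1 := cos_le1 y.
  apply: ler_pM => //.
  rewrite ger0_norm; last lra.
  have h := one_sub_cos_le y.
  by have y20 := sqr_ge0 y; lra.
have a3 : `|(expR x - 1) * sin y| <= N ^+ 2 * expR N.
  rewrite normrM.
  apply: (@le_trans _ _ ((N * expR N) * N)); last by rewrite expr2 mulrAC.
  apply: ler_pM => //; last exact: le_trans (norm_sin_le y) yN.
  apply: le_trans (expR_sub1_le x) _.
  by apply: ler_pM => //; exact: expR_ge0.
have a4 : `|y - sin y| <= N ^+ 2 * expR N.
  apply: le_trans (sub_sin_le y) _; nra.
apply: le_trans (lerD (ler_normB _ _) (ler_normB _ _)) _.
lra.
Qed.

End complex_exponential_bounds.

Section complex_derivative.
Variable R : realType.
Implicit Types (f g : R[i] -> R[i]) (z w h d : R[i]).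

(** [d] is the complex derivative of [f] at [z], with real epsilons. *)
Definition cderiv f z d := forall e : R, 0 < e ->
  exists2 r : R, 0 < r & forall h, normc h < r ->
    normc (f (z + h) - f z - d * h) <= e * normc h.

Lemma entireP f : entire f <-> forall z, exists d, cderiv f z d.
Proof.
split=> [fE z|fE z].
- have /cvg_ex[d /= /cvgrPdist_le fd] := fE z; exists d => e e0.
  have eC0 : 0 < e%:C :> R[i] by rewrite ltcR.
  have [r /= r0 fr] := fd _ eC0.
  have rE : r = (complex.Re r)%:C.
    by apply: complex_ext => //=; apply: ger0_Im; exact: ltW.
  have rR : 0 < complex.Re r by rewrite -ltcR -rE.
  exists (complex.Re r) => // h hr.
  have [->|h0] := eqVneq h 0.
    by rewrite addr0 subrr mulr0 subrr normc0 mulr0.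
  have := fr h; rewrite /ball_/= sub0r normrN => /(_ _ h0).
  have -> : `|h| < r by rewrite rE ltcR.
  move=> /(_ isT).
  rewrite /GRing.scale/= mulr1 [h + z]addrC.
  rewrite lecR => H.
  have -> : f (z + h) - f z - d * h = - ((d - h^-1 * (f (z + h) - f z)) * h).
    by rewrite mulrBl mulrAC mulVf// mul1r opprB.
  by rewrite normc_opp normcM ler_wpM2r// normc_ge0.
- have [d fd] := fE z; apply/cvg_ex; exists d; apply/cvgrPdist_le => /= e e0.
  have eE : e = (complex.Re e)%:C.
    by apply: complex_ext => //=; apply: ger0_Im; exact: ltW.
  have eR : 0 < complex.Re e by rewrite -ltcR -eE.
  have [r r0 fr] := fd _ eR.
  exists r%:C => /=; first by rewrite ltcR.
  move=> h; rewrite /ball_/= sub0r normrN => hr h0.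
  rewrite /GRing.scale/= mulr1 [h + z]addrC eE lecR.
  have h0' : 0 < normc h by rewrite normc_gt0.
  have := fr h; rewrite -ltcR => /(_ hr).
  have -> : f (z + h) - f z - d * h = - ((d - h^-1 * (f (z + h) - f z)) * h).
    by rewrite mulrBl mulrAC mulVf// mul1r opprB.
  by rewrite normc_opp normcM ler_pM2r.
Qed.

End complex_derivative.

(** * Goursat's theorem for closed forms on rectangles *)

Section segment_integral.
Variable R : realType.
Implicit Types (f : R -> R) (a b c k M : R).

(** The integral of [f] from [a] to [b], for [a <= b]; it is [0] when [b < a]. *)
Definition itg f a b := \int[@lebesgue_measure R]_(x in `[a, b]) f x.

Lemma continuous_itg_integrable f a b : continuous f ->
  (@lebesgue_measure R).-integrable `[a, b] (EFin \o f).
Proof.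
move=> cf; apply: continuous_compact_integrable; first exact: segment_compact.
exact: continuous_subspaceT.
Qed.

Lemma itg_cat f a b c : continuous f -> a <= b -> b <= c ->
  itg f a c = itg f a b + itg f b c.
Proof.
move=> cf ab bc.
have ic := continuous_itg_integrable a c cf.
have := @Rintegral_itvB R f (BLeft a) (BRight c) b ic.
rewrite !bnd_simp => /(_ ab bc) /eqP; rewrite subr_eq => /eqP.
rewrite /itg => ->.
rewrite [RHS]addrC; congr (_ + _).
rewrite Rintegral_itv_obnd_cbnd//.
apply: integrableS (continuous_itg_integrable b c cf) => //.
by apply: subset_itvr; rewrite bnd_simp.
Qed.

Lemma itg_cst k a b : a <= b -> itg (fun=> k) a b = k * (b - a).
Proof.
move=> ab; rewrite /itg Rintegral_cst//= lebesgue_measure_itv/= lte_fin.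
case: ltP => // ba; have -> : b = a by apply/le_anti; rewrite ab ba.
by rewrite subrr /= mulr0.
Qed.

Lemma itgB f g a b : continuous f -> continuous g ->
  itg (fun x => f x - g x) a b = itg f a b - itg g a b.
Proof.
by move=> cf cg; rewrite /itg RintegralB//; exact: continuous_itg_integrable.
Qed.

Lemma itg_dist_le f a b k M : continuous f -> a <= b ->
  (forall x, a <= x <= b -> `|f x - k| <= M) ->
  `|itg f a b - k * (b - a)| <= M * (b - a).
Proof.
move=> cf ab fM; rewrite -(itg_cst k ab) -itgB//; last by move=> ?; exact: cvg_cst.
have ci : continuous (fun x => f x - k).
  by move=> x; apply: cvgB; [exact: cf|exact: cvg_cst].
have ci2 : continuous (fun x => `|f x - k|).
  by move=> x; apply: (@cvg_norm _ _ _ _ _ (fun x => f x - k)); exact: ci.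
rewrite -(itg_cst M ab); apply: le_trans (le_normr_Rintegral _ _) _ => //.
  exact: continuous_itg_integrable.
apply: le_Rintegral => //.
- exact: (continuous_itg_integrable a b ci2).
- by apply: continuous_itg_integrable => x; exact: cvg_cst.
Qed.

End segment_integral.

Section goursat.
Variable R : realType.
Variables p q : R -> R -> R.

(** Both coefficients of the form [p dx + q dy] are differentiable at every
    point and the form is closed there: [b] is both the [y]-derivative of [p]
    and the [x]-derivative of [q]. *)
Definition closed_form := forall x y, exists a b c, forall e : R, 0 < e ->
  exists2 r : R, 0 < r & forall h k, `|h| < r -> `|k| < r ->
    `|p (x + h) (y + k) - p x y - a * h - b * k| <= e * (`|h| + `|k|) /\
    `|q (x + h) (y + k) - q x y - b * h - c * k| <= e * (`|h| + `|k|).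

Hypothesis cpq : closed_form.

Let lipschitz_cvg (f : R -> R) x a r : 0 < r ->
  (forall h, `|h| < r -> `|f (x + h) - f x - a * h| <= `|h|) ->
  f t @[t --> x] --> f x.
Proof.
move=> r0 H; apply/cvgrPdist_le => e e0.
have M0 : 0 < `|a| + 1 by rewrite ltr_wpDl.
exists (Num.min r (e / (`|a| + 1))) => /=; first by rewrite lt_min r0 divr_gt0.
move=> t /=; rewrite lt_min distrC => /andP[tr te].
have := H (t - x) tr; rewrite (addrC x) subrK => h.
rewrite distrC.
have -> : f t - f x = (f t - f x - a * (t - x)) + a * (t - x) by ring.
apply: le_trans (ler_normD _ _) _; rewrite normrM.
apply: (@le_trans _ _ ((`|a| + 1) * `|t - x|)).
  by rewrite mulrDl mul1r addrC lerD2l.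
by rewrite mulrC -ler_pdivlMr// ltW.
Qed.

Lemma closed_form_continuous1 y : continuous (p ^~ y).
Proof.
move=> x; have [a [b [c H]]] := cpq x y; have [r r0 Hr] := H 1 ltr01.
apply: (@lipschitz_cvg (p ^~ y) x a r r0) => h hr.
have r0' : `|0 : R| < r by rewrite normr0.
have [h1 _] := Hr h 0 hr r0'.
by move: h1; rewrite normr0 !addr0 mulr0 subr0 mul1r.
Qed.

Lemma closed_form_continuous2 x : continuous (q x).
Proof.
move=> y; have [a [b [c H]]] := cpq x y; have [r r0 Hr] := H 1 ltr01.
apply: (@lipschitz_cvg (q x) y c r r0) => h hr.
have r0' : `|0 : R| < r by rewrite normr0.
have [_ h1] := Hr 0 h r0' hr.
by move: h1; rewrite normr0 addr0 add0r mulr0 subr0 mul1r.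
Qed.

(** The circulation of [p dx + q dy], counterclockwise, around the rectangle with
    lower left corner [(a, c)] and upper right corner [(b, d)]. *)
Definition circulation a b c d :=
  itg (p ^~ c) a b - itg (p ^~ d) a b + (itg (q b) c d - itg (q a) c d).

Local Notation J := circulation.
Let cp := closed_form_continuous1.
Let cq := closed_form_continuous2.

Lemma circulation_split1 a m b c d : a <= m -> m <= b ->
  J a b c d = J a m c d + J m b c d.
Proof. by move=> am mb; rewrite /J !(itg_cat (@cp _) am mb); ring. Qed.

Lemma circulation_split2 a b c m d : c <= m -> m <= d ->
  J a b c d = J a b c m + J a b m d.
Proof. by move=> am mb; rewrite /J !(itg_cat (@cq _) am mb); ring. Qed.

(** Near a point the form differs from a closed affine one, whose circulation
    is zero, by at most [e] times the half-perimeter of the rectangle. *)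
Lemma circulation_local x y e : 0 < e -> exists2 r : R, 0 < r &
  forall a b c d, a <= x <= b -> c <= y <= d -> b - a < r -> d - c < r ->
    `|J a b c d| <= 2 * e * (b - a + (d - c)) ^+ 2.
Proof.
move=> e0; have [al [be [ga H]]] := cpq x y; have [r r0 Hr] := H _ e0.
exists r => // a b c d /andP[ax xb] /andP[cy yd] bar dcr.
set L := b - a + (d - c).
have near s t : a <= s <= b -> c <= t <= d ->
   `|p s t - p x y - al * (s - x) - be * (t - y)| <= e * L /\
   `|q s t - q x y - be * (s - x) - ga * (t - y)| <= e * L.
  move=> /andP[as_ sb] /andP[ct td].
  have s1 : `|s - x| <= b - a by rewrite ler_norml; apply/andP; split; lra.
  have t1 : `|t - y| <= d - c by rewrite ler_norml; apply/andP; split; lra.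
  have [] := Hr (s - x) (t - y) (le_lt_trans s1 bar) (le_lt_trans t1 dcr).
  rewrite ![_ + (_ - _)]addrC !subrK => h1 h2.
  have eL : e * (`|s - x| + `|t - y|) <= e * L by rewrite ler_pM2l// lerD.
  by split; [exact: le_trans h1 eL|exact: le_trans h2 eL].
have ab : a <= b by lra.
have cd : c <= d by lra.
have h1 : `|itg (fun s => p s c - p s d) a b - be * (c - d) * (b - a)| <=
    2 * e * L * (b - a).
  apply: itg_dist_le => //.
    by move=> s; apply: cvgB; exact: cp.
  move=> s sab.
  have [A1 _] := near s c sab ltac:(by rewrite lexx cd).
  have [A2 _] := near s d sab ltac:(by rewrite lexx cd).
  have -> : p s c - p s d - be * (c - d) =
    (p s c - p x y - al * (s - x) - be * (c - y)) -
    (p s d - p x y - al * (s - x) - be * (d - y)) by ring.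
  by apply: le_trans (ler_normB _ _) _; lra.
have h2 : `|itg (fun t => q b t - q a t) c d - be * (b - a) * (d - c)| <=
    2 * e * L * (d - c).
  apply: itg_dist_le => //.
    by move=> s; apply: cvgB; exact: cq.
  move=> s sab.
  have [_ A1] := near b s ltac:(by rewrite lexx ab) sab.
  have [_ A2] := near a s ltac:(by rewrite lexx ab) sab.
  have -> : q b s - q a s - be * (b - a) =
    (q b s - q x y - be * (b - x) - ga * (s - y)) -
    (q a s - q x y - be * (a - x) - ga * (s - y)) by ring.
  by apply: le_trans (ler_normB _ _) _; lra.
rewrite !itgB// in h1 h2.
have -> : J a b c d = (itg (p^~ c) a b - itg (p^~ d) a b - be * (c - d) * (b - a))
   + (itg (q b) c d - itg (q a) c d - be * (b - a) * (d - c)) by rewrite /J; ring.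
apply: le_trans (ler_normD _ _) _; apply: le_trans (lerD h1 h2) _.
by rewrite -mulrDr -/L expr2 mulrA.
Qed.

(* One of the four quarters of a rectangle carries at least a quarter of the
   circulation. *)
Let quarter x y w h K : 0 <= w -> 0 <= h ->
  K <= `|J x (x + (w + w)) y (y + (h + h))| ->
  exists2 s : R * R, (x <= s.1 <= x + w /\ y <= s.2 <= y + h) &
    K / 4 <= `|J s.1 (s.1 + w) s.2 (s.2 + h)|.
Proof.
move=> w0 h0 HK.
have xm : x <= x + w by lra.
have mx : x + w <= x + (w + w) by lra.
have ym : y <= y + h by lra.
have my : y + h <= y + (h + h) by lra.
rewrite (circulation_split1 _ _ xm mx) !(circulation_split2 _ _ ym my) in HK.
have [h1|h1] := leP (K / 4) `|J x (x + w) y (y + h)|.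
  by exists (x, y) => //=; rewrite !lexx ym xm.
have [h2|h2] := leP (K / 4) `|J x (x + w) (y + h) (y + h + h)|.
  by exists (x, y + h) => //=; rewrite !lexx ym xm.
have [h3|h3] := leP (K / 4) `|J (x + w) (x + w + w) y (y + h)|.
  by exists (x + w, y) => //=; rewrite !lexx ym xm.
have [h4|h4] := leP (K / 4) `|J (x + w) (x + w + w) (y + h) (y + h + h)|.
  by exists (x + w, y + h) => //=; rewrite !lexx ym xm.
exfalso; move: HK; rewrite (addrA x w w) (addrA y h h).
have n4 (A B C D : R) : `|A| < K / 4 -> `|B| < K / 4 -> `|C| < K / 4 ->
    `|D| < K / 4 -> ~ K <= `|A + B + (C + D)|.
  move=> A4 B4 C4 D4 HK.
  have := le_trans HK (ler_normD _ _).
  have := ler_normD A B; have := ler_normD C D.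
  by move=> ? ? ?; lra.
exact: n4 h1 h2 h3 h4.
Qed.

(** Goursat's argument needs differentiability only: halving a rectangle
    repeatedly, the quarters that carry the largest circulation shrink to a
    point, where the circulation is negligible compared to the area. *)
Theorem goursat a b c d : a <= b -> c <= d -> circulation a b c d = 0.
Proof.
move=> ab cd; set K := `|J a b c d|.
set w := fun n : nat => (b - a) / 2 ^+ n.
set h := fun n : nat => (d - c) / 2 ^+ n.
have half (u : R) n : u / 2 ^+ n = u / 2 ^+ n.+1 + u / 2 ^+ n.+1.
  by rewrite exprS; field; rewrite expf_neq0.
have w0 n : 0 <= w n by rewrite divr_ge0 ?exprn_ge0// subr_ge0.
have h0 n : 0 <= h n by rewrite divr_ge0 ?exprn_ge0// subr_ge0.
pose P n (s : R * R) := K / 4 ^+ n <= `|J s.1 (s.1 + w n) s.2 (s.2 + h n)|.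
(* [sq n] is the lower left corner of the [n]-th rectangle, of sides [w n] and
   [h n] *)
pose nxt n (s : R * R) := xget s [set s' | P n.+1 s' /\
  (s.1 <= s'.1 /\ s'.1 + w n.+1 <= s.1 + w n) /\
  (s.2 <= s'.2 /\ s'.2 + h n.+1 <= s.2 + h n)].
pose fix sq n := if n is m.+1 then nxt m (sq m) else (a, c).
have nxtP n s : P n s -> P n.+1 (nxt n s) /\
  (s.1 <= (nxt n s).1 /\ (nxt n s).1 + w n.+1 <= s.1 + w n) /\
  (s.2 <= (nxt n s).2 /\ (nxt n s).2 + h n.+1 <= s.2 + h n).
  move=> Ps; rewrite /nxt; case: xgetP => [s' _ //|]; move=> nos; exfalso.
  have wE : w n = w n.+1 + w n.+1 := half _ _.
  have hE : h n = h n.+1 + h n.+1 := half _ _.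
  have [|s' [/andP[s1 s2] /andP[s3 s4]] s5] :=
    @quarter s.1 s.2 (w n.+1) (h n.+1) (K / 4 ^+ n) (w0 _) (h0 _).
    by rewrite -wE -hE.
  apply: (nos s'); split; last first.
    by rewrite s1 s3 wE hE !addrA !lerD2r.
  rewrite /P.
  by have -> : K / 4 ^+ n.+1 = K / 4 ^+ n / 4 by rewrite exprSr invfM mulrA.
have Psq n : P n (sq n).
  elim: n => [|n IH] /=; last by have [] := nxtP n _ IH.
  by rewrite /P /= /w /h !expr0 !divr1 ![_ + (_ - _)]addrC !subrK.
have mono n : ((sq n).1 <= (sq n.+1).1 /\ (sq n.+1).1 + w n.+1 <= (sq n).1 + w n) /\
  ((sq n).2 <= (sq n.+1).2 /\ (sq n.+1).2 + h n.+1 <= (sq n).2 + h n).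
  by have [_] := nxtP n _ (Psq n).
have common (u v : nat -> R) : (forall n, 0 <= v n) ->
    (forall n, u n <= u n.+1 /\ u n.+1 + v n.+1 <= u n + v n) ->
    exists X, forall n, u n <= X <= u n + v n.
  move=> v0 uv.
  have le1 n k : u n <= u (n + k)%N.
    elim: k => [|k IH]; first by rewrite addn0.
    by rewrite addnS; apply: le_trans IH _; have [] := uv (n + k)%N.
  have le2 n k : u (n + k)%N + v (n + k)%N <= u n + v n.
    elim: k => [|k IH]; first by rewrite addn0.
    by rewrite addnS; apply: le_trans IH; have [] := uv (n + k)%N.
  have le3 n m : u n <= u m + v m.
    have [nm|/ltnW mn] := leqP n m.
      by have := le1 n (m - n)%N; rewrite subnKC// => /le_trans; apply; rewrite lerDl.
    have := le2 m (n - m)%N; rewrite subnKC//; apply: le_trans.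
    by rewrite lerDl.
  exists (sup (range u)) => n; apply/andP; split.
    apply: ub_le_sup; last by exists n.
    by exists (u n + v n) => _ [m _ <-].
  by apply: ge_sup; [exists (u 0%N), 0%N|move=> _ [m _ <-]].
have [X HX] := common (fun n => (sq n).1) w w0 (fun n => (mono n).1).
have [Y HY] := common (fun n => (sq n).2) h h0 (fun n => (mono n).2).
set L := b - a + (d - c).
have L0 : 0 <= L by rewrite /L; lra.
have bound e : 0 < e -> K <= 2 * e * L ^+ 2.
  move=> e0; have [r r0 Hr] := circulation_local X Y e0.
  have [n Hn] : exists n, L / 2 ^+ n < r.
    exists (Num.bound (L / r)).
    rewrite ltr_pdivrMr ?exprn_gt0// mulrC -ltr_pdivrMr//.
    have := archi_boundP (divr_ge0 L0 (ltW r0)).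
    move=> h1; apply: lt_le_trans h1 _.
    by rewrite -natrX ler_nat ltnW// ltn_expl.
  have wL : w n <= L / 2 ^+ n by rewrite ler_pM2r ?invr_gt0 ?exprn_gt0// /L lerDl subr_ge0.
  have hL : h n <= L / 2 ^+ n by rewrite ler_pM2r ?invr_gt0 ?exprn_gt0// /L lerDr subr_ge0.
  have := Hr _ _ _ _ (HX n) (HY n).
  have -> : (sq n).1 + w n - (sq n).1 = w n by ring.
  have -> : (sq n).2 + h n - (sq n).2 = h n by ring.
  move=> /(_ (le_lt_trans wL Hn) (le_lt_trans hL Hn)) H1.
  have H2 := le_trans (Psq n) H1.
  have wh : w n + h n = L / 2 ^+ n by rewrite /w /h -mulrDl.
  move: H2; rewrite wh ler_pdivrMr ?exprn_gt0// => H2; apply: le_trans H2 _.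
  have -> : 4 ^+ n = 2 ^+ n ^+ 2 :> R by rewrite -exprM mulnC exprM; congr (_ ^+ _); rewrite expr2; lra.
  by rewrite exprMn exprVn -!mulrA mulVf ?mulr1// expf_neq0// expf_neq0.
apply/eqP; rewrite -normr_le0 -/K; apply/ler_addgt0Pl => e e0; rewrite addr0.
have L20 : 0 < 2 * (L ^+ 2 + 1) by have := sqr_ge0 L => ?; lra.
apply: le_trans (bound (e / (2 * (L ^+ 2 + 1))) (divr_gt0 e0 L20)) _.
rewrite -[leRHS](divfK (lt0r_neq0 L20)).
rewrite [X in _ <= X]mulrC mulrAC ler_wpM2r//; first by rewrite divr_ge0 ?ltW.
lra.
Qed.

End goursat.

(** * Entire functions and the mean value on circles *)

Section complex_derivative_rules.
Variable R : realType.
Implicit Types (f g : R[i] -> R[i]) (z w h d c : R[i]).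

Lemma cderiv_affine a c z : cderiv (fun w => a * w + c : R[i]) z a.
Proof.
move=> e e0; exists 1 => // h _.
have -> : a * (z + h) + c - (a * z + c) - a * h = 0 by ring.
by rewrite normc0 mulr_ge0 ?normc_ge0// ltW.
Qed.

Lemma cderiv_lipschitz f z d : cderiv f z d ->
  exists2 r : R, 0 < r & forall h, normc h < r ->
    normc (f (z + h) - f z) <= (normc d + 1) * normc h.
Proof.
move=> /(_ 1 ltr01)[r r0 fr]; exists r => // h hr.
have -> : f (z + h) - f z = (f (z + h) - f z - d * h) + d * h by ring.
apply: le_trans (normc_triangle _ _) _.
by rewrite normcM mulrDl addrC lerD2l fr.
Qed.

Lemma cderiv_comp f g z d c : cderiv g z d -> cderiv f (g z) c ->
  cderiv (f \o g) z (c * d).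
Proof.
move=> gz fgz e e0.
have c0 := normc_ge0 c; have d0 := normc_ge0 d.
have e1 : 0 < e / 2 / (normc d + 1) by rewrite !divr_gt0// ltr_wpDl.
have e2 : 0 < e / 2 / (normc c + 1) by rewrite !divr_gt0// ltr_wpDl.
have [r r0 fr] := fgz _ e1.
have [s s0 gs] := gz _ e2.
have [t t0 gt] := cderiv_lipschitz gz.
have D0 : 0 < normc d + 1 by rewrite ltr_wpDl.
have C0 : 0 < normc c + 1 by rewrite ltr_wpDl.
exists (Num.min (Num.min s t) (r / (normc d + 1))) => [|h].
  by rewrite !lt_min s0 t0 divr_gt0.
rewrite !lt_min -andbA => /and3P[hs ht hr] /=.
set k := g (z + h) - g z.
have kE : g (z + h) = g z + k by rewrite /k; ring.
have kh := gt _ ht; rewrite -/k in kh.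
have h0 := normc_ge0 h.
have kr : normc k < r.
  by apply: le_lt_trans kh _; rewrite mulrC -ltr_pdivlMr.
have -> : f (g (z + h)) - f (g z) - c * d * h =
  (f (g z + k) - f (g z) - c * k) + c * (k - d * h) by rewrite kE; ring.
apply: le_trans (normc_triangle _ _) _.
rewrite [e]splitr mulrDl; apply: lerD.
  apply: le_trans (fr _ kr) _.
  apply: (@le_trans _ _ (e / 2 / (normc d + 1) * ((normc d + 1) * normc h))).
    by rewrite ler_pM2l.
  by rewrite mulrA divfK// gt_eqF.
rewrite normcM; apply: (@le_trans _ _ ((normc c + 1) * (e / 2 / (normc c + 1) * normc h))).
  apply: ler_pM; rewrite ?normc_ge0//; first by rewrite lerDl.
  exact: gs.
by rewrite mulrA [X in X * _ <= _]mulrC divfK ?gt_eqF.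
Qed.

Lemma cderiv_cexp z : cderiv (@cexp R) z (cexp z).
Proof.
move=> e e0; set K := 4 * expR (complex.Re z) * expR 1.
have K0 : 0 < K by rewrite !mulr_gt0// expR_gt0.
exists (Num.min 1 (e / K)) => [|h]; first by rewrite lt_min ltr01 divr_gt0.
rewrite lt_min => /andP[h1 hK].
have h0 := normc_ge0 h.
have -> : cexp (z + h) - cexp z - cexp z * h = cexp z * (cexp h - 1 - h).
  by rewrite cexpD; ring.
rewrite normcM normc_cexp.
have ez : 0 <= expR (complex.Re z) by exact: expR_ge0.
apply: le_trans (ler_wpM2l ez (cexp_sub1x_le h)) _.
have e1 : expR (normc h) <= expR 1 by rewrite ler_expR ltW.
apply: (@le_trans _ _ (K * normc h * normc h)).
  rewrite /K -[X in _ <= X]mulrA -expr2.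
  have -> : expR (complex.Re z) * (4 * normc h ^+ 2 * expR (normc h)) =
    4 * expR (complex.Re z) * normc h ^+ 2 * expR (normc h) by ring.
  have -> : 4 * expR (complex.Re z) * expR 1 * normc h ^+ 2 =
    4 * expR (complex.Re z) * normc h ^+ 2 * expR 1 by ring.
  by rewrite ler_wpM2l// !mulr_ge0// exprn_ge0.
by apply: ler_wpM2r => //; rewrite mulrC -ler_pdivlMr// ltW.
Qed.

Lemma entire_cexp : entire (@cexp R).
Proof. by apply/entireP => z; exists (cexp z); exact: cderiv_cexp. Qed.

Lemma entire_affine a c : entire (fun w => a * w + c : R[i]).
Proof. by apply/entireP => z; exists a; exact: cderiv_affine. Qed.

Lemma entire_comp f g : entire f -> entire g -> entire (f \o g).
Proof.
move=> /entireP fE /entireP gE; apply/entireP => z.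
have [d gd] := gE z; have [c fc] := fE (g z).
by exists (c * d); exact: cderiv_comp.
Qed.

Lemma entireM f g : entire f -> entire g -> entire (fun z => f z * g z).
Proof. by move=> fE gE z; apply: (@derivableM R[i] R[i]^o f g). Qed.

Lemma entireD f g : entire f -> entire g -> entire (fun z => f z + g z).
Proof. by move=> fE gE z; apply: (@derivableD R[i] R[i]^o R[i]^o f g). Qed.

End complex_derivative_rules.

Section circle_mean.
Variable R : realType.
Implicit Types (H f : R[i] -> R[i]).

Let coord_le (a b : R) : normc (a +i* b) <= `|a| + `|b|.
Proof. exact: normc_le_ReIm. Qed.

Let entire_expansion H x y : entire H -> exists a b : R, forall e : R, 0 < e ->
  exists2 r : R, 0 < r & forall h k, `|h| < r -> `|k| < r ->
    `|complex.Re (H ((x + h) +i* (y + k))) - complex.Re (H (x +i* y))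
      - a * h - - b * k| <= e * (`|h| + `|k|) /\
    `|complex.Im (H ((x + h) +i* (y + k))) - complex.Im (H (x +i* y))
      - b * h - a * k| <= e * (`|h| + `|k|).
Proof.
move=> /entireP/(_ (x +i* y))[d Hd].
exists (complex.Re d), (complex.Im d) => e e0.
have [r r0 Hr] := Hd _ e0; exists (r / 2) => [|h k hr kr]; first exact: divr_gt0.
have hk : normc (h +i* k) < r by apply: le_lt_trans (coord_le _ _) _; lra.
have := Hr _ hk.
have -> : x +i* y + h +i* k = (x + h) +i* (y + k) by [].
set D := _ - _ * _ => HD.
have HDe : normc D <= e * (`|h| + `|k|).
  by apply: le_trans HD _; rewrite ler_pM2l// coord_le.
split.
  apply: le_trans HDe; apply: le_trans (ler_Re_normc D).
  by rewrite /D !ReImE/=; rewrite le_eqVlt; apply/orP; left; apply/eqP; congr (`|_|); ring.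
apply: le_trans HDe; apply: le_trans (ler_Im_normc D).
by rewrite /D !ReImE/=; rewrite le_eqVlt; apply/orP; left; apply/eqP; congr (`|_|); ring.
Qed.

(** By the Cauchy-Riemann equations the imaginary part of [H dz] is closed. *)
Lemma entire_closed_form_Im H : entire H ->
  closed_form (fun x y => complex.Im (H (x +i* y))) (fun x y => complex.Re (H (x +i* y))).
Proof.
move=> HE x y; have [a [b ab]] := entire_expansion x y HE.
exists b, a, (- b) => e e0; have [r r0 Hr] := ab _ e0.
by exists r => // h k hr kr; have [h1 h2] := Hr h k hr kr; split.
Qed.

Lemma cexp_im (t : R) : cexp (0 +i* t) = cos t +i* sin t.
Proof. by rewrite /cexp/= expR0 mul1r. Qed.

Lemma cexp_period (x t : R) : cexp (x +i* (t + pi *+ 2)) = cexp (x +i* t).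
Proof. by rewrite /cexp/= cosD2pi sinD2pi. Qed.

(* The contour is moved from the unit circle to the circle of radius [expR a],
   with [a] tending to minus infinity, in logarithmic coordinates. *)
Let mean_of_form f (p q : R -> R -> R) (Q : R[i] -> R) :
  closed_form p q -> (forall x, p x 0 = p x (pi *+ 2)) ->
  (forall x y, q x y = Q (f (cexp (x +i* y)))) ->
  (forall z w, `|Q z - Q w| <= normc (z - w)) -> entire f ->
  itg (q 0) 0 (pi *+ 2) = Q (f 0) * (pi *+ 2).
Proof.
move=> cpq per qE QL fE; set T := pi *+ 2.
have T0 : 0 <= T by rewrite mulrn_wge0// pi_ge0.
have shift a : a <= 0 -> itg (q 0) 0 T = itg (q a) 0 T.
  move=> a0; have := goursat cpq a0 T0; rewrite /circulation.
  have -> : p ^~ T = p ^~ 0 by apply/funext => x; rewrite per.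
  by rewrite subrr add0r => /eqP; rewrite subr_eq0 => /eqP.
apply/eqP; rewrite -subr_eq0 -normr_le0; apply/ler_addgt0Pl => e e0; rewrite addr0.
have /entireP/(_ 0)[d fd] := fE.
have [r r0 fr] := cderiv_lipschitz fd.
have e1 : 0 < e / (T + 1) by rewrite divr_gt0// ltr_wpDl.
have M0 : 0 < normc d + 1 by rewrite ltr_wpDl// normc_ge0.
set s := Num.min 1 (Num.min (r / 2) (e / (T + 1) / (normc d + 1))).
have s0 : 0 < s by rewrite /s !lt_min ltr01 (divr_gt0 e1 M0) divr_gt0.
have sr : s < r.
  rewrite /s; apply: le_lt_trans (_ : r / 2 < r); last lra.
  by rewrite !ge_min lexx orbT.
have se : s <= e / (T + 1) / (normc d + 1) by rewrite /s !ge_min lexx !orbT.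
have a0 : ln s <= 0 by rewrite -ln1 ler_ln ?posrE// /s ge_min lexx.
rewrite (shift _ a0).
apply: (@le_trans _ _ (e / (T + 1) * T)); last first.
  by rewrite -mulrA ler_piMr ?ltW// mulrC ltr_pdivrMr ?ltr_wpDl// mul1r ltrDl.
suff qd y : 0 <= y <= T -> `|q (ln s) y - Q (f 0)| <= e / (T + 1).
  have := itg_dist_le (@closed_form_continuous2 _ _ _ cpq (ln s)) T0 qd.
  by rewrite subr0.
move=> _; rewrite qE; apply: le_trans (QL _ _) _.
set w := cexp _.
have ws : normc w = s by rewrite /w normc_cexp /= lnK.
have := fr w; rewrite ws => /(_ sr); rewrite add0r => H; apply: le_trans H _.
by rewrite mulrC -ler_pdivlMr.
Qed.

Lemma circle_mean_Re f : entire f ->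
  itg (fun t => complex.Re (f (cos t +i* sin t))) 0 (pi *+ 2) =
  complex.Re (f 0) * (pi *+ 2).
Proof.
move=> fE.
have HE := entire_comp fE (@entire_cexp R).
rewrite -(mean_of_form (entire_closed_form_Im HE) (Q := @complex.Re R) (f := f))//.
- by congr itg; apply/funext => t /=; rewrite cexp_im.
- by move=> x /=; rewrite -(cexp_period x 0) add0r.
- by move=> z w; rewrite -ReN -ReD; exact: ler_Re_normc.
Qed.

End circle_mean.

(** * Planar Lebesgue measure and the Gaussian measure *)

Section measure_preserving.
Context d (T : measurableType d) (R : realType) (m : {measure set T -> \bar R}).

(** [phi] is measurable and preserves the integrals of nonnegative measurable
    functions. *)
Definition integral_invariant (phi : T -> T) := measurable_fun setT phi /\
  forall f : T -> \bar R, measurable_fun setT f -> (forall x, 0 <= f x)%E ->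
    (\int[m]_x f (phi x) = \int[m]_x f x)%E.

Lemma integral_invariant_comp phi psi :
  integral_invariant phi -> integral_invariant psi ->
  integral_invariant (phi \o psi).
Proof.
move=> [mphi iphi] [mpsi ipsi]; split; first exact: measurableT_comp.
move=> f mf f0; rewrite -(iphi f mf f0) -(ipsi (f \o phi)) => [//| |x].
  exact: measurableT_comp.
exact: f0.
Qed.

Lemma integral_invariant_signed phi f : integral_invariant phi ->
  measurable_fun setT f -> (\int[m]_x f (phi x) = \int[m]_x f x)%E.
Proof.
move=> [mphi iphi] mf; rewrite [LHS]integralE [RHS]integralE.
congr (_ - _)%E.
  rewrite -[RHS](iphi _ (measurable_funepos mf) (funepos_ge0 f)).
  by apply: eq_integral => x _; rewrite -[fun x => f (phi x)]/(f \o phi) funepos_comp.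
rewrite -[RHS](iphi _ (measurable_funeneg mf) (funeneg_ge0 f)).
by apply: eq_integral => x _; rewrite -[fun x => f (phi x)]/(f \o phi) funeneg_comp.
Qed.

End measure_preserving.

Section density.
Context d (T : measurableType d) (R : realType).
Variables (m : {sigma_finite_measure set T -> \bar R}).
Variables (nu : {finite_measure set T -> \bar R}) (w : T -> R).
Hypothesis mw : measurable_fun setT w.
Hypothesis nuE : forall A, measurable A -> nu A = (\int[m]_(x in A) (w x)%:E)%E.

(** Integration against the measure with density [w], by comparison with the
    Radon-Nikodym derivative. *)
Lemma ge0_integral_density (f : T -> \bar R) : measurable_fun setT f ->
  (forall x, 0 <= f x)%E ->
  (\int[nu]_x f x = \int[m]_x (f x * (w x)%:E))%E.
Proof.
move=> mf f0.
have numu : nu `<< m.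
  apply/null_content_dominatesP => A mA mA0; rewrite nuE//.
  apply: null_set_integral => //; apply: measurable_funTS; exact/measurable_EFinP.
rewrite -(Radon_Nikodym_SigmaFinite.change_of_variables numu)//.
apply: ae_eq_integral => //.
- apply: emeasurable_funM => //.
  exact: measurable_int (Radon_Nikodym_SigmaFinite.f_integrable numu).
- by apply: emeasurable_funM => //; exact/measurable_EFinP.
apply: (@ae_eqe_mul2l _ _ _ _ _ _ (EFin \o w)).
apply: integral_ae_eq => //.
- exact: Radon_Nikodym_SigmaFinite.f_integrable numu.
- exact/measurable_EFinP.
- move=> E _ mE; rewrite -nuE//.
  by rewrite (Radon_Nikodym_SigmaFinite.f_integral numu).
Qed.

End density.

Section line.
Variable R : realType.
Local Notation leb := (@lebesgue_measure R).

Lemma measurable_shift (a : R) :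
  measurable_fun [set: measurableTypeR R] (fun x : measurableTypeR R => x + a : measurableTypeR R).
Proof. exact: measurable_funD. Qed.

Lemma lebesgue_shift (a : R) :
  @integral_invariant _ (measurableTypeR R) R leb (fun x => x + a).
Proof.
split; first exact: measurable_shift.
move=> f mf f0.
rewrite -[LHS](@ge0_integral_pushforward _ _ _ _ _ (fun x : measurableTypeR R => x + a : measurableTypeR R) (measurable_shift a) leb setT f)//.
apply: eq_measure_integral => [|ms A mA _]; first exact: measurable_shift.
apply/esym/lebesgue_measure_unique => //= _ [[u v]] _ <-.
rewrite /pushforward.
have -> : (fun x : R => x + a) @^-1` `]u, v] = `]u - a, v - a]%classic.
  by apply/seteqP; split => x /=; rewrite !in_itv/= ltrBlDr lerBrDr.
rewrite !lebesgue_measure_itv/= !lte_fin ltrD2r.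
by case: ifP => // _; rewrite -!EFinD; congr (_%:E); ring.
Qed.

(** The integral of a Gaussian does not depend on its centre. *)
Lemma gauss_line (c : R) : 0 < c -> exists2 K : R, 0 <= K &
  forall a, (\int[leb]_x (expR (- (c * (x - a) ^+ 2)))%:E = K%:E)%E.
Proof.
move=> c0; pose s := Num.sqrt (2 * c)^-1.
have s20 : 0 < (2 * c)^-1 by rewrite invr_gt0 mulr_gt0.
have s0 : s != 0 by rewrite gt_eqF// sqrtr_gt0.
have pk : 0 < normal_peak s by exact: normal_peak_gt0.
exists (normal_peak s)^-1 => [|a]; first by rewrite invr_ge0 ltW.
have := integral_normal_pdf a s; rewrite normal_pdfE//.
under eq_integral.
  move=> x _; rewrite /= EFinM /normal_fun.
  have -> : - (x - a) ^+ 2 / (s ^+ 2 *+ 2) = - (c * (x - a) ^+ 2).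
    by rewrite sqr_sqrtr ?ltW// -mulr_natl; field; rewrite gt_eqF.
  over.
rewrite ge0_integralZl_EFin ?ltW//; first last.
- apply/measurable_EFinP; apply: measurableT_comp => //.
  apply: measurable_funN; apply: measurable_funM => //.
  by apply: measurable_funX; exact: measurable_shift.
set I := (\int[_]_x _)%E.
case: I => [r| |].
- rewrite -EFinM => -[h]; congr (_%:E).
  by apply: (mulfI (lt0r_neq0 pk)); rewrite h mulfV ?gt_eqF.
- by rewrite gt0_muley.
- by rewrite gt0_muleNy.
Qed.

End line.

Section plane_measure.
Variable R : realType.
Local Notation leb := (@lebesgue_measure R).
Implicit Types (f : plane R -> \bar R).

Lemma tonelli_dA f : measurable_fun setT f -> (forall x, 0 <= f x)%E ->
  (\int[dA R]_p f p = \int[leb]_x \int[leb]_y f (x, y))%E.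
Proof. by move=> mf f0; rewrite fubini_tonelli1. Qed.

Lemma tonelli_dA2 f : measurable_fun setT f -> (forall x, 0 <= f x)%E ->
  (\int[dA R]_p f p = \int[leb]_y \int[leb]_x f (x, y))%E.
Proof. by move=> mf f0; rewrite fubini_tonelli2. Qed.

Lemma measurable_section1 f y : measurable_fun setT f ->
  measurable_fun setT (fun x => f (x, y)).
Proof. by move=> mf; apply: measurableT_comp => //; exact: measurable_pair2. Qed.

Lemma measurable_section2 f x : measurable_fun setT f ->
  measurable_fun setT (fun y => f (x, y)).
Proof. by move=> mf; apply: measurableT_comp => //; exact: measurable_pair1. Qed.

Lemma dA_shear1 (t : R) :
  @integral_invariant _ (plane R) R (dA R) (fun p => (p.1 + t * p.2, p.2)).
Proof.
have ms : measurable_fun [set: plane R] (fun p : plane R => (p.1 + t * p.2, p.2) : plane R).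
  apply: measurable_fun_pair => //=.
  by apply: measurable_funD => //; apply: measurable_funM.
split=> // f mf f0; rewrite (tonelli_dA2 mf f0) tonelli_dA2; [|exact: measurableT_comp|by move=> x; exact: f0].
apply: eq_integral => y _ /=.
have [_ H] := lebesgue_shift (t * y).
by apply: (H (fun x => f (x, y))) => //; exact: measurable_section1.
Qed.

Lemma dA_shear2 (t : R) :
  @integral_invariant _ (plane R) R (dA R) (fun p => (p.1, p.2 + t * p.1)).
Proof.
have ms : measurable_fun [set: plane R] (fun p : plane R => (p.1, p.2 + t * p.1) : plane R).
  apply: measurable_fun_pair => //=.
  by apply: measurable_funD => //; apply: measurable_funM.
split=> // f mf f0; rewrite (tonelli_dA mf f0) tonelli_dA; [|exact: measurableT_comp|by move=> x; exact: f0].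
apply: eq_integral => x _ /=.
have [_ H] := lebesgue_shift (t * x).
by apply: (H (fun y => f (x, y))) => //; exact: measurable_section2.
Qed.

Lemma dA_translation (a b : R) :
  @integral_invariant _ (plane R) R (dA R) (fun p => (p.1 + a, p.2 + b)).
Proof.
have ms : measurable_fun [set: plane R] (fun p : plane R => (p.1 + a, p.2 + b) : plane R).
  by apply: measurable_fun_pair => //=; apply: measurable_funD.
split=> // f mf f0; rewrite (tonelli_dA mf f0) tonelli_dA; [|exact: measurableT_comp|by move=> x; exact: f0].
have [_ H1] := lebesgue_shift a.
have [_ H2] := lebesgue_shift b.
rewrite -(H1 (fun x => \int[leb]_y f (x, y))%E).
- apply: eq_integral => x _ /=.
  by apply: (H2 (fun y => f (x + a, y))) => //; exact: measurable_section2.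
- exact: (@measurable_fun_fubini_tonelli_F _ _ _ _ _ leb f).
- by move=> x; apply: integral_ge0.
Qed.

(** A rotation is a composition of three shears. *)
Lemma dA_rotation (c s : R) : c ^+ 2 + s ^+ 2 = 1 ->
  @integral_invariant _ (plane R) R (dA R)
    (fun p => (c * p.1 - s * p.2, s * p.1 + c * p.2)).
Proof.
have H (c' s' : R) : c' ^+ 2 + s' ^+ 2 = 1 -> 1 + c' != 0 ->
  @integral_invariant _ (plane R) R (dA R)
    (fun p => (c' * p.1 - s' * p.2, s' * p.1 + c' * p.2)).
  (* [t] is minus the tangent of half the angle *)
  move=> cs c1; set t := - (s' / (1 + c')).
  have := integral_invariant_comp (dA_shear1 t)
    (integral_invariant_comp (dA_shear2 s') (dA_shear1 t)).
  congr integral_invariant; apply/funext => -[x y] /=.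
  have st : s' * t = c' - 1.
    rewrite /t mulrN mulrA -expr2.
    have -> : s' ^+ 2 = (1 - c') * (1 + c') by rewrite -[s' ^+ 2](addKr (c' ^+ 2)) cs; ring.
    by rewrite mulfK//; ring.
  have sE : - s' = t + t * c'.
    by rewrite /t; field.
  have yE : y + s' * (x + t * y) = s' * x + c' * y.
    have -> : y + s' * (x + t * y) = s' * x + (1 + s' * t) * y by ring.
    by rewrite st; ring.
  rewrite yE; congr pair.
  have -> : x + t * y + t * (s' * x + c' * y) = (1 + s' * t) * x + (t + t * c') * y by ring.
  by rewrite st -sE; ring.
(* the half-turn has no such decomposition: it is a quarter-turn, twice *)
move=> cs; have [c1|c1] := eqVneq (1 + c) 0; last exact: H.
have cE : c = -1 by lra.
have sE : s = 0.
  by apply/eqP; rewrite -sqrf_eq0; apply/eqP; rewrite cE in cs; lra.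
have H01 := H 0 1 ltac:(by rewrite expr0n expr1n add0r) ltac:(by rewrite addr0 oner_neq0).
have := integral_invariant_comp H01 H01.
by congr integral_invariant; apply/funext => -[x y] /=; rewrite cE sE; congr pair; ring.
Qed.

Lemma gauss_plane (c : R) : 0 < c -> exists2 K : R, 0 <= K & forall a b,
  (\int[dA R]_p (expR (- (c * ((p.1 - a) ^+ 2 + (p.2 - b) ^+ 2))))%:E = K%:E)%E.
Proof.
move=> c0; have [K K0 HK] := gauss_line c0.
exists (K * K) => [|a b]; first exact: mulr_ge0.
have mg (u : R) : measurable_fun setT (fun x : measurableTypeR R => expR (- (c * (x - u) ^+ 2))).
  apply: measurableT_comp => //.
  apply: measurable_funN; apply: measurable_funM => //.
  by apply: measurable_funX; exact: measurable_shift.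
rewrite tonelli_dA; last 2 first.
- apply/measurable_EFinP; apply: measurableT_comp => //; apply: measurable_funN.
  apply: measurable_funM => //; apply: measurable_funD; apply: measurable_funX.
    by apply: measurable_funB.
  by apply: measurable_funB.
- by move=> x; rewrite lee_fin expR_ge0.
under eq_integral => x _.
  under eq_integral => y _ do rewrite /= mulrDr opprD expRD EFinM.
  rewrite ge0_integralZl_EFin ?expR_ge0//; last exact/measurable_EFinP.
  rewrite HK.
  over.
rewrite ge0_integralZr//= ?HK// ?EFinM//; last exact/measurable_EFinP.
Qed.

End plane_measure.

(** Planar Lebesgue measure, under a name of its own that carries the
    structure of a sigma-finite measure. *)
Definition lebesgue2 (R : realType) : set (plane R) -> \bar R := dA R.

Section lebesgue2_sigma_finite.
Variable R : realType.

HB.instance Definition _ := Measure.on (@lebesgue2 R).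

Lemma lebesgue2_sigma_finite : sigma_finite setT (@lebesgue2 R).
Proof.
pose I (n : nat) : set (measurableTypeR R) := `[- n%:R, n%:R]%classic.
exists (fun n => I n `*` I n) => [|n].
  apply/esym; rewrite -subTset => -[x y] _ /=.
  have [nx ny] := (archi_boundP (normr_ge0 x), archi_boundP (normr_ge0 y)).
  exists (maxn (Num.bound `|x|) (Num.bound `|y|)) => //=.
  rewrite /I /= !in_itv/= -!ler_norml; split.
    by apply: le_trans (ltW nx) _; rewrite ler_nat leq_maxl.
  by apply: le_trans (ltW ny) _; rewrite ler_nat leq_maxr.
have mI : measurable (I n) by exact: measurable_itv.
have Ioo : (@lebesgue_measure R (I n) < +oo)%E.
  by rewrite lebesgue_measure_itv/=; case: ifP => // _; rewrite -EFinD ltry.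
split; first exact: measurableX.
by rewrite [ltLHS]product_measure1E//= lte_mul_pinfty// ge0_fin_numE.
Qed.

HB.instance Definition _ := Measure_isSigmaFinite.Build _ _ _ (@lebesgue2 R)
  lebesgue2_sigma_finite.

End lebesgue2_sigma_finite.

Section gaussian_measure.
Variable R : realType.
Local Notation leb := (@lebesgue_measure R).
Implicit Types (f : plane R -> \bar R).

Lemma gauss_weightE (p : plane R) :
  gauss_weight p = pi^-1 * expR (- (p.1 ^+ 2 + p.2 ^+ 2)).
Proof. by rewrite /gauss_weight sqr_normc_def. Qed.

Lemma gauss_measure_setT : dmu R setT = 1%E.
Proof.
rewrite /gauss_measure tonelli_dA; last 2 first.
- by apply/measurable_EFinP; exact: measurable_gauss_weight.
- by move=> p; rewrite lee_fin gauss_weight_ge0.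
have mg : measurable_fun setT (EFin \o @gauss_fun R).
  by apply/measurable_EFinP; exact: measurable_gauss_fun.
have g0 x : (0 <= (@gauss_fun R x)%:E)%E by rewrite lee_fin gauss_fun_ge0.
under eq_integral => x _.
  under eq_integral => y _ do rewrite gauss_weightE /= opprD expRD mulrA EFinM.
  rewrite ge0_integralZl_EFin ?mulr_ge0 ?expR_ge0 ?invr_ge0 ?pi_ge0//.
  rewrite integralT_gauss EFinM -muleA.
  over.
rewrite ge0_integralZl_EFin ?invr_ge0 ?pi_ge0//; last by apply: emeasurable_funM.
rewrite ge0_integralZr// ?lee_fin ?sqrtr_ge0// integralT_gauss.
rewrite -!EFinM -expr2 sqr_sqrtr ?pi_ge0// mulVf//.
by rewrite gt_eqF// pi_gt0.
Qed.

HB.instance Definition _ := @Measure_isProbability.Build _ _ R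
  (@gauss_measure R) gauss_measure_setT.

Lemma ge0_integral_dmu f : measurable_fun setT f -> (forall x, 0 <= f x)%E ->
  (\int[dmu R]_p f p = \int[dA R]_p (f p * (gauss_weight p)%:E))%E.
Proof.
move=> mf f0.
have nuE A : measurable A -> dmu R A = (\int[@lebesgue2 R]_(x in A) (gauss_weight x)%:E)%E.
  by [].
exact: (@ge0_integral_density _ (plane R) R (@lebesgue2 R) (dmu R) (@gauss_weight R) (@measurable_gauss_weight R) nuE f mf f0).
Qed.

Lemma dmu_rotation (c s : R) : c ^+ 2 + s ^+ 2 = 1 ->
  @integral_invariant _ (plane R) R (dmu R)
    (fun p => (c * p.1 - s * p.2, s * p.1 + c * p.2)).
Proof.
move=> cs; have [mr ir] := dA_rotation cs; split => // f mf f0.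
rewrite !ge0_integral_dmu//; last exact: measurableT_comp.
rewrite -[RHS]ir; last 2 first.
- apply: emeasurable_funM => //; apply/measurable_EFinP; exact: measurable_gauss_weight.
- by move=> x; rewrite mule_ge0// lee_fin gauss_weight_ge0.
apply: eq_integral => p _ /=; congr (_ * _%:E)%E.
rewrite !gauss_weightE/=; congr (_ * expR (- _)).
transitivity ((c ^+ 2 + s ^+ 2) * (p.1 ^+ 2 + p.2 ^+ 2)); last ring.
by rewrite cs mul1r.
Qed.

End gaussian_measure.

(** * Integrals of complex-valued functions *)

Section complex_integral.
Context d (T : measurableType d) (R : realType) (m : {measure set T -> \bar R}).
Implicit Types (F G : T -> R[i]) (a b : T -> R).

(** Measurability and integrability of a complex-valued function, by real and
    imaginary parts. *)
Definition cmeasurable F := measurable_fun setT (fun x => complex.Re (F x)) /\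
  measurable_fun setT (fun x => complex.Im (F x)).

Definition cintegrable F := m.-integrable setT (fun x => (complex.Re (F x))%:E) /\
  m.-integrable setT (fun x => (complex.Im (F x))%:E).

(** The integral of a complex-valued function. *)
Definition cint F : R[i] :=
  (\int[m]_x complex.Re (F x)) +i* (\int[m]_x complex.Im (F x)).

Lemma cmeasurableD F G : cmeasurable F -> cmeasurable G ->
  cmeasurable (fun x => F x + G x).
Proof.
move=> [F1 F2] [G1 G2]; split.
  by under eq_fun do rewrite ReD; exact: measurable_funD.
by under eq_fun do rewrite ImD; exact: measurable_funD.
Qed.

Lemma cmeasurableM F G : cmeasurable F -> cmeasurable G ->
  cmeasurable (fun x => F x * G x).
Proof.
move=> [F1 F2] [G1 G2]; split.
  under eq_fun do rewrite ReM.
  by apply: measurable_funB; exact: measurable_funM.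
under eq_fun do rewrite ImM.
by apply: measurable_funD; exact: measurable_funM.
Qed.

Lemma cmeasurableC F : cmeasurable F -> cmeasurable (fun x => (F x)^*).
Proof.
move=> [F1 F2]; split; first by under eq_fun do rewrite ReC.
by under eq_fun do rewrite ImC; exact: measurable_funN.
Qed.

Lemma cmeasurable_cst (c : R[i]) : cmeasurable (fun=> c).
Proof. by split. Qed.

Lemma cmeasurableR a : measurable_fun setT a -> cmeasurable (fun x => (a x)%:C).
Proof. by move=> ma; split. Qed.

Lemma measurable_normc F : cmeasurable F ->
  measurable_fun setT (fun x => normc (F x)).
Proof.
move=> [F1 F2].
under eq_fun do rewrite -[normc _]ger0_norm ?normc_ge0// -sqrtr_sqr sqr_normc_def.
apply: measurableT_comp => //.
  by apply: continuous_measurable_fun; exact: sqrt_continuous.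
by apply: measurable_funD; exact: measurable_funX.
Qed.

Lemma cmeasurable_cexp F : cmeasurable F -> cmeasurable (fun x => cexp (F x)).
Proof.
move=> [F1 F2]; apply: cmeasurableM.
  by apply: cmeasurableR; exact: measurableT_comp.
by split => /=; apply: measurableT_comp => //;
  apply: continuous_measurable_fun; [exact: continuous_cos|exact: continuous_sin].
Qed.

Lemma cintegrable_measurable F : cintegrable F -> cmeasurable F.
Proof.
by move=> [/measurable_int/measurable_EFinP F1 /measurable_int/measurable_EFinP F2].
Qed.

Lemma integrable_dominated a b : measurable_fun setT a ->
  m.-integrable setT (fun x => (b x)%:E) -> (forall x, `|a x| <= b x) ->
  m.-integrable setT (fun x => (a x)%:E).
Proof.
move=> ma ib ab; apply: le_integrable ib => //; first exact/measurable_EFinP.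
by move=> x _; rewrite /= lee_fin (le_trans (ab x))// ler_norm.
Qed.

Lemma cintegrable_dominated F b : cmeasurable F ->
  m.-integrable setT (fun x => (b x)%:E) -> (forall x, normc (F x) <= b x) ->
  cintegrable F.
Proof.
move=> [F1 F2] ib Fb; split; apply: integrable_dominated ib _ => // x.
  exact: le_trans (ler_Re_normc _) (Fb x).
exact: le_trans (ler_Im_normc _) (Fb x).
Qed.

Lemma ge0_integrable a : measurable_fun setT a -> (forall x, 0 <= a x) ->
  (\int[m]_x (a x)%:E < +oo)%E -> m.-integrable setT (fun x => (a x)%:E).
Proof.
move=> ma a0 ioo; apply/integrableP; split; first exact/measurable_EFinP.
by under eq_integral do rewrite gee0_abs ?lee_fin//.
Qed.

Lemma cintegrable_norm F : cmeasurable F ->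
  (\int[m]_x (normc (F x))%:E < +oo)%E -> cintegrable F.
Proof.
move=> mF ioo; apply: (cintegrable_dominated mF (b := fun x => normc (F x))) => //.
by apply: ge0_integrable => //; [exact: measurable_normc|move=> x; exact: normc_ge0].
Qed.

Lemma integrable_normc F : cintegrable F ->
  m.-integrable setT (fun x => (normc (F x))%:E).
Proof.
move=> iF; have [F1 F2] := iF.
have mF := cintegrable_measurable iF.
apply: (@integrable_dominated _ (fun x => `|complex.Re (F x)| + `|complex.Im (F x)|)).
- exact: measurable_normc.
- under eq_fun do rewrite EFinD.
  by apply: integrableD => //; [exact: (integrable_norm F1)|exact: (integrable_norm F2)].
- by move=> x; rewrite ger0_norm ?normc_ge0// normc_le_ReIm.
Qed.

Lemma cintegrableD F G : cintegrable F -> cintegrable G ->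
  cintegrable (fun x => F x + G x).
Proof.
move=> [F1 F2] [G1 G2]; split.
  by under eq_fun do rewrite ReD EFinD; exact: integrableD.
by under eq_fun do rewrite ImD EFinD; exact: integrableD.
Qed.

Lemma cintegrableZ (c : R[i]) F : cintegrable F -> cintegrable (fun x => c * F x).
Proof.
move=> iF; have mF := cintegrable_measurable iF.
apply: (@cintegrable_dominated _ (fun x => normc c * normc (F x))).
- by apply: cmeasurableM => //; exact: cmeasurable_cst.
- under eq_fun do rewrite EFinM.
  by apply: integrableZl => //; exact: integrable_normc.
- by move=> x; rewrite normcM.
Qed.

Lemma cintegrableC F : cintegrable F -> cintegrable (fun x => (F x)^*).
Proof.
move=> [F1 F2]; split; first by under eq_fun do rewrite ReC.
by under eq_fun do rewrite ImC EFinN; exact: integrableN.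
Qed.

Lemma cintD F G : cintegrable F -> cintegrable G ->
  cint (fun x => F x + G x) = cint F + cint G.
Proof.
move=> [F1 F2] [G1 G2]; apply: complex_ext; rewrite !ReImE/= -RintegralD//.
  by apply: eq_Rintegral => x _; rewrite ReD.
by apply: eq_Rintegral => x _; rewrite ImD.
Qed.

Lemma cintZ (c : R[i]) F : cintegrable F -> cint (fun x => c * F x) = c * cint F.
Proof.
move=> [F1 F2].
have Z (k : R) : m.-integrable setT (fun x => (k * complex.Re (F x))%:E) /\
    m.-integrable setT (fun x => (k * complex.Im (F x))%:E).
  by split; under eq_fun do rewrite EFinM; exact: integrableZl.
apply: complex_ext; rewrite !ReImE/= -!RintegralZl//.
  rewrite -RintegralB//; [|exact: (Z _).1|exact: (Z _).2].
  by apply: eq_Rintegral => x _; rewrite ReM.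
rewrite -RintegralD//; [|exact: (Z _).2|exact: (Z _).1].
by apply: eq_Rintegral => x _; rewrite ImM.
Qed.

Lemma cintN F : cintegrable F -> cint (fun x => - F x) = - cint F.
Proof.
move=> iF; rewrite -mulN1r -cintZ//; congr cint; apply/funext => x.
by rewrite mulN1r.
Qed.

Lemma cintegrableN F : cintegrable F -> cintegrable (fun x => - F x).
Proof.
by move=> /(cintegrableZ (-1)); under eq_fun do rewrite mulN1r.
Qed.

Lemma cintB F G : cintegrable F -> cintegrable G ->
  cint (fun x => F x - G x) = cint F - cint G.
Proof.
by move=> iF iG; rewrite cintD ?cintN//; exact: cintegrableN.
Qed.

Lemma cintC F : cintegrable F -> cint (fun x => (F x)^*) = (cint F)^*.
Proof.
move=> [F1 F2]; apply: complex_ext; rewrite !ReImE/=.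
  by apply: eq_Rintegral => x _; rewrite ReC.
rewrite -[RHS]mulN1r -RintegralZl//; apply: eq_Rintegral => x _.
by rewrite ImC mulN1r.
Qed.

Lemma normc_cint_le F : cintegrable F ->
  normc (cint F) <= \int[m]_x normc (F x).
Proof.
move=> iF; set I := cint F.
have [->|I0] := eqVneq I 0.
  by rewrite normc0; apply: Rintegral_ge0 => x _; exact: normc_ge0.
have nI : normc I != 0 by rewrite normc_eq0.
(* the integral is turned to a nonnegative real by a unimodular factor *)
pose c := I^* * ((normc I)^-1)%:C.
have nc : normc c = 1 by rewrite normcM normcC normcR normfV ger0_norm ?normc_ge0// mulfV.
have cI : c * I = (normc I)%:C.
  rewrite /c mulrAC [_^* * _]mulrC mulc_conj -rmorphM/=; congr (_%:C).
  by rewrite expr2 mulfK.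
have := cintZ c iF; rewrite -/I cI => /(congr1 (@complex.Re R)) /= <-.
have icF := cintegrableZ c iF.
apply: le_Rintegral => //; first exact: icF.1.
- exact: integrable_normc.
- move=> x _; apply: le_trans (ler_norm _) _; apply: le_trans (ler_Re_normc _) _.
  by rewrite normcM nc mul1r.
Qed.

End complex_integral.

Section cauchy_schwarz.
Context d (T : measurableType d) (R : realType) (m : {measure set T -> \bar R}).
Implicit Types (a b : T -> R).

Lemma ge0_cauchy_schwarz a b (A B : R) :
  measurable_fun setT a -> measurable_fun setT b ->
  (forall x, 0 <= a x) -> (forall x, 0 <= b x) ->
  (\int[m]_x (a x ^+ 2)%:E <= A%:E)%E -> (\int[m]_x (b x ^+ 2)%:E <= B%:E)%E ->
  (\int[m]_x (a x * b x)%:E <= (Num.sqrt A * Num.sqrt B)%:E)%E.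
Proof.
move=> ma mb a0 b0 iA iB.
have L2 (f : T -> R) (M : R) : (forall x, 0 <= f x) -> measurable_fun setT f ->
    (\int[m]_x (f x ^+ 2)%:E <= M%:E)%E -> ('N[m]_2%:E[EFin \o f] <= (Num.sqrt M)%:E)%E.
  move=> f0 mf iM; rewrite unlock /Lnorm.
  under eq_integral => x _.
    rewrite /= ger0_norm// powR_mulrn//.
    over.
  set I := (\int[_]_x _)%E in iM *.
  have I0 : (0 <= I)%E by apply: integral_ge0 => x _; rewrite lee_fin sqr_ge0.
  case: I I0 iM => [r||]//; rewrite !lee_fin => r0 rM.
  by rewrite powR12_sqrt// ler_wsqrtr.
have := @hoelder _ _ _ m a b 2 2 ma mb ltac:(by []) ltac:(by []) ltac:(lra).
rewrite Lnorm1.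
under eq_integral => x _ do rewrite /= ger0_norm ?mulr_ge0//.
move=> h; apply: le_trans h _; rewrite EFinM.
by apply: lee_pmul; rewrite ?Lnorm_ge0 ?L2.
Qed.

End cauchy_schwarz.

Section real_fubini.
Context d1 d2 (T1 : measurableType d1) (T2 : measurableType d2) (R : realType).
Variables (m1 : {sigma_finite_measure set T1 -> \bar R}).
Variables (m2 : {sigma_finite_measure set T2 -> \bar R}).

Lemma Rfubini (f : T1 * T2 -> R) :
  (m1 \x m2)%E.-integrable setT (fun p => (f p)%:E) ->
  \int[m1]_x (\int[m2]_y f (x, y)) = \int[m2]_y (\int[m1]_x f (x, y)).
Proof.
move=> fi; rewrite /Rintegral; congr fine.
have F1 : (\int[m1]_x (fine (\int[m2]_y (f (x, y))%:E))%:E =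
   \int[m1]_x \int[m2]_y (f (x, y))%:E)%E.
  have mF := measurable_fubini_F fi.
  apply: ae_eq_integral => //.
    by apply/measurable_EFinP; apply: measurableT_comp => //; exact: mF.
  have := ae_integrable1 fi; apply: filterS => x ix _ /=.
  by rewrite fineK//; exact: integrable_fin_num.
have F2 : (\int[m2]_y (fine (\int[m1]_x (f (x, y))%:E))%:E =
   \int[m2]_y \int[m1]_x (f (x, y))%:E)%E.
  have mF := measurable_fubini_G fi.
  apply: ae_eq_integral => //.
    by apply/measurable_EFinP; apply: measurableT_comp => //; exact: mF.
  have := ae_integrable2 fi; apply: filterS => x ix _ /=.
  by rewrite fineK//; exact: integrable_fin_num.
by rewrite F1 F2; exact: (@Fubini _ _ _ _ _ m1 m2 _ fi).
Qed.

Lemma cfubini (f : T1 * T2 -> R[i]) : cintegrable (m1 \x m2)%E f ->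
  cint m1 (fun x => cint m2 (fun y => f (x, y))) =
  cint m2 (fun y => cint m1 (fun x => f (x, y))).
Proof.
move=> [f1 f2]; apply: complex_ext => /=.
  exact: (Rfubini (f := fun p => complex.Re (f p))).
exact: (Rfubini (f := fun p => complex.Im (f p))).
Qed.

End real_fubini.

(** * The reproducing formula *)

Section mean_value.
Variable R : realType.
Local Notation leb := (@lebesgue_measure R).

(** The rotation of angle [t]. *)
Definition rot (t : R) (p : plane R) : plane R :=
  (cos t * p.1 - sin t * p.2, sin t * p.1 + cos t * p.2).

Lemma cplx_rot t p : cplx (rot t p) = (cos t +i* sin t) * cplx p.
Proof. by apply: complex_ext; rewrite ReImE/=; ring. Qed.

Lemma measurable_rot :
  measurable_fun [set: measurableTypeR R * plane R] (fun q => rot q.1 q.2).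
Proof.
have m1 : measurable_fun [set: measurableTypeR R * plane R] (fun q => q.2.1 : measurableTypeR R).
  by apply: measurableT_comp.
have m2 : measurable_fun [set: measurableTypeR R * plane R] (fun q => q.2.2 : measurableTypeR R).
  by apply: measurableT_comp.
have mc : measurable_fun [set: measurableTypeR R * plane R] (fun q => cos q.1).
  by apply: measurableT_comp => //; apply: continuous_measurable_fun; exact: continuous_cos.
have ms : measurable_fun [set: measurableTypeR R * plane R] (fun q => sin q.1).
  by apply: measurableT_comp => //; apply: continuous_measurable_fun; exact: continuous_sin.
by apply: measurable_fun_pair; [apply: measurable_funB|apply: measurable_funD];
  exact: measurable_funM.
Qed.

(** Averaging over rotations, which preserve the Gaussian measure, replaces [f]
    by its means over circles centred at the origin. *)
Lemma dmu_mean_Re (f : R[i] -> R[i]) : entire f ->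
  cintegrable (dmu R) (fun p => f (cplx p)) ->
  \int[dmu R]_p complex.Re (f (cplx p)) = complex.Re (f 0).
Proof.
move=> fE [iu _]; pose u p := complex.Re (f (cplx p)).
set T : R := pi *+ 2.
have T0 : 0 < T by rewrite mulrn_wgt0// pi_gt0.
pose D : set (measurableTypeR R) := `[0, T]%classic.
have mD : measurable D by exact: measurable_itv.
have mu_ : measurable_fun setT u by move/measurable_int/measurable_EFinP : iu.
pose v (q : measurableTypeR R * plane R) := \1_D q.1 * u (rot q.1 q.2).
have mv : measurable_fun setT v.
  apply: measurable_funM.
    by apply: measurableT_comp => //; exact: measurable_indic.
  by apply: measurableT_comp => //; exact: measurable_rot.
have inv t : integral_invariant (dmu R) (rot t).
  by apply: dmu_rotation; exact: cos2Dsin2.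
have absu : (\int[dmu R]_p `|(u p)%:E| < +oo)%E by case/integrableP : iu.
have lD : leb D = T%:E by rewrite /D lebesgue_measure_itv/= lte_fin T0 oppr0 addr0.
have mau : measurable_fun setT (fun p => `|(u p)%:E|)%E.
  by apply: measurableT_comp => //; exact/measurable_EFinP.
have iv : (leb \x dmu R)%E.-integrable setT (fun q => (v q)%:E).
  apply/(integrable12ltyP leb (dmu R)); first exact/measurable_EFinP.
  under eq_integral => t _.
    under eq_integral => p _.
      rewrite /v /= normrM EFinM ger0_norm//.
      over.
    rewrite ge0_integralZl_EFin//; last first.
      have [mr _] := inv t.
      by apply: (measurableT_comp mau mr).
    have [_ /(_ _ mau)] := inv t; rewrite /= => ->//.
    over.
  rewrite ge0_integralZr//; last 2 first.
  - by apply/measurable_EFinP; exact: measurable_indic.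
  - exact: integral_ge0.
  rewrite integral_indic// setIT -/D [X in (X * _)%E]lD.
  by rewrite lte_mul_pinfty// lee_fin ltW.
have := Rfubini iv.
have -> : \int[leb]_x \int[dmu R]_y v (x, y) = T * \int[dmu R]_p u p.
  transitivity (\int[leb]_x (\1_D x * \int[dmu R]_p u p)).
    apply: eq_Rintegral => t _.
    have ivu : \int[dmu R]_p u (rot t p) = \int[dmu R]_p u p.
      rewrite /Rintegral; congr fine.
      have mEu : measurable_fun setT (EFin \o u) by exact/measurable_EFinP.
      have H := integral_invariant_signed (inv t) mEu.
      exact: H.
    rewrite -ivu /v /= RintegralZl//.
    have [mr ir] := inv t.
    apply/integrableP; split.
      by apply/measurable_EFinP; exact: measurableT_comp.
    by rewrite (ir _ mau).
  rewrite RintegralZr//; last first.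
    apply/integrableP; split; first by apply/measurable_EFinP; exact: measurable_indic.
    under eq_integral do rewrite /= ger0_norm//.
    by rewrite integral_indic// setIT [X in (X < _)%E]lD ltry.
  congr (_ * _); rewrite /Rintegral integral_indic// setIT.
  by rewrite [X in fine X]lD.
have -> : \int[dmu R]_y \int[leb]_x v (x, y) = complex.Re (f 0) * T.
  transitivity (\int[dmu R]_p (complex.Re (f 0) * T)).
    apply: eq_Rintegral => p _.
    have fpE : entire (f \o (fun w => cplx p * w + 0)).
      exact: (@entire_comp R f _ fE (@entire_affine R (cplx p) 0)).
    have := circle_mean_Re fpE; rewrite /= mulr0 addr0 -/T => <-.
    rewrite /itg Rintegral_mkcond; apply: eq_Rintegral => t _.
    rewrite patchE /v /= indicE; case: ifPn => _; rewrite ?mul0r// mul1r.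
    by rewrite /u cplx_rot addr0 mulrC.
  by rewrite Rintegral_cst// [X in fine X]gauss_measure_setT mulr1.
rewrite mulrC => /mulIf ->//.
by rewrite gt_eqF.
Qed.

Lemma dmu_mean (f : R[i] -> R[i]) : entire f ->
  cintegrable (dmu R) (fun p => f (cplx p)) ->
  cint (dmu R) (fun p => f (cplx p)) = f 0.
Proof.
move=> fE fi; apply: complex_ext => /=; first exact: dmu_mean_Re.
pose g z := - 'i%C * f z.
have gE : entire g by apply: entireM fE => z; exact: derivable_cst.
have gi : cintegrable (dmu R) (fun p => g (cplx p)) by exact: cintegrableZ.
have gRe z : complex.Re (g z) = complex.Im (f z) by rewrite /g !ReImE/=; ring.
rewrite -gRe -dmu_mean_Re//.
by apply: eq_Rintegral => p _; rewrite gRe.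
Qed.

End mean_value.

Section gaussian_shift.
Variable R : realType.
Implicit Types (a b : R) (u : plane R -> R).

(** The density, with respect to the Gaussian measure, of its translate by
    [- (a, b)]. *)
Definition shift_density a b (p : plane R) : R :=
  expR (- (2 * (a * p.1 + b * p.2) + (a ^+ 2 + b ^+ 2))).

(** The translation by [(a, b)]. *)
Definition shift2 a b (p : plane R) : plane R := (p.1 + a, p.2 + b).

Lemma measurable_shift_density a b : measurable_fun setT (shift_density a b).
Proof.
apply: measurableT_comp => //; apply: measurable_funN; apply: measurable_funD => //.
by apply: measurable_funM => //; apply: measurable_funD; apply: measurable_funM.
Qed.

Lemma ge0_dmu_shift a b u : measurable_fun setT u -> (forall p, 0 <= u p) ->
  (\int[dmu R]_p (u (shift2 a b p) * shift_density a b p)%:E =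
   \int[dmu R]_p (u p)%:E)%E.
Proof.
move=> mu_ u0; have [ms is_] := dA_translation a b.
have mu2 : measurable_fun setT (fun p => u (shift2 a b p) * shift_density a b p).
  apply: measurable_funM; last exact: measurable_shift_density.
  exact: measurableT_comp.
have p2 p : (0 <= (u (shift2 a b p) * shift_density a b p)%:E)%E.
  by rewrite lee_fin mulr_ge0// expR_ge0.
have mE : measurable_fun setT (fun p => (u p)%:E) by exact/measurable_EFinP.
have pE p : (0 <= (u p)%:E)%E by rewrite lee_fin.
have mw : measurable_fun setT (fun p : plane R => (gauss_weight p)%:E).
  by apply/measurable_EFinP; exact: measurable_gauss_weight.
rewrite (ge0_integral_dmu mE pE) (ge0_integral_dmu _ p2); last exact/measurable_EFinP.
rewrite -[RHS]is_; last 2 first.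
- exact: emeasurable_funM.
- by move=> p; rewrite mule_ge0 ?lee_fin ?gauss_weight_ge0.
apply: eq_integral => p _ /=.
rewrite -!EFinM -mulrA; congr (_%:E); congr (_ * _).
by rewrite !gauss_weightE mulrCA -expRD; congr (_ * expR _) => /=; ring.
Qed.

Lemma dmu_shift_integrable a b u : (dmu R).-integrable setT (fun p => (u p)%:E) ->
  (dmu R).-integrable setT (fun p => (u (shift2 a b p) * shift_density a b p)%:E).
Proof.
move=> /integrableP[/measurable_EFinP mu_ iu]; have [ms _] := dA_translation a b.
apply/integrableP; split.
  apply/measurable_EFinP; apply: measurable_funM; last exact: measurable_shift_density.
  exact: measurableT_comp.
under eq_integral do rewrite /= normrM (ger0_norm (expR_ge0 _)).
rewrite (ge0_dmu_shift a b (u := fun p => `|u p|))//.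
exact: measurableT_comp.
Qed.

Lemma dmu_shift a b u : (dmu R).-integrable setT (fun p => (u p)%:E) ->
  \int[dmu R]_p (u (shift2 a b p) * shift_density a b p) = \int[dmu R]_p u p.
Proof.
move=> iu; have mu_ : measurable_fun setT u by move/measurable_int/measurable_EFinP : iu.
pose v p := `|u p|; pose w p := v p + u p.
have iv : (dmu R).-integrable setT (fun p => (v p)%:E).
  exact: (integrable_norm iu).
have iw : (dmu R).-integrable setT (fun p => (w p)%:E).
  by under eq_fun do rewrite EFinD; exact: integrableD.
have E x : (dmu R).-integrable setT (fun p => (x p)%:E) -> (forall p, 0 <= x p) ->
    \int[dmu R]_p (x (shift2 a b p) * shift_density a b p) = \int[dmu R]_p x p.
  move=> ix x0; rewrite /Rintegral (ge0_dmu_shift a b)//.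
  by move/measurable_int/measurable_EFinP : ix.
have -> : \int[dmu R]_p u p = \int[dmu R]_p w p - \int[dmu R]_p v p.
  by rewrite -RintegralB//; apply: eq_Rintegral => p _; rewrite /w; ring.
have w0 p : 0 <= w p.
  by rewrite /w /v; have := ler_norm (- u p); rewrite normrN => ?; lra.
have v0 p : 0 <= v p by exact: normr_ge0.
rewrite -(E w iw w0) -(E v iv v0).
rewrite -RintegralB//; [|exact: dmu_shift_integrable|exact: dmu_shift_integrable].
by apply: eq_Rintegral => p _; rewrite /w; ring.
Qed.

End gaussian_shift.

Section gaussian_growth.
Variable R : realType.

Lemma linear_le_quadratic (B t : R) : B * t <= B ^+ 2 + t ^+ 2 / 4.
Proof. by have := sqr_ge0 (B - t / 2) => ?; nra. Qed.

Lemma gauss_square_integrable (a : plane R -> R) (C : R) : measurable_fun setT a ->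
  (forall p, `|a p| <= C * expR (normc (cplx p) ^+ 2 / 4)) ->
  (\int[dmu R]_p (a p ^+ 2)%:E < +oo)%E.
Proof.
move=> ma aC.
have h0 : 0 < 2^-1 :> R by [].
have [K K0 HK] := gauss_plane h0.
have ma2 : measurable_fun setT (fun p => (a p ^+ 2)%:E).
  by apply/measurable_EFinP; exact: measurable_funX.
rewrite (ge0_integral_dmu ma2) => [|p]; last by rewrite lee_fin sqr_ge0.
apply: (@le_lt_trans _ _ (\int[dA R]_p ((pi^-1 * C ^+ 2) %:E *
   (expR (- (2^-1 * ((p.1 - 0) ^+ 2 + (p.2 - 0) ^+ 2))))%:E))%E).
  have mg : measurable_fun setT (fun p : plane R => (expR (- (2^-1 * ((p.1 - 0) ^+ 2 + (p.2 - 0) ^+ 2))))%:E).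
    apply/measurable_EFinP; apply: measurableT_comp => //; apply: measurable_funN.
    apply: measurable_funM => //; apply: measurable_funD; apply: measurable_funX.
      by apply: measurable_funB.
    by apply: measurable_funB.
  apply: ge0_le_integral => //.
  - by move=> p _; rewrite mule_ge0 ?lee_fin ?sqr_ge0 ?gauss_weight_ge0.
  - by apply: emeasurable_funM => //; apply/measurable_EFinP; exact: measurable_gauss_weight.
  - by apply: emeasurable_funM.
  - move=> p _; rewrite -!EFinM lee_fin.
    have := aC p; set s := normc (cplx p) ^+ 2 => H.
    have sE : s = p.1 ^+ 2 + p.2 ^+ 2 by rewrite /s sqr_normc_def.
    have a2 : a p ^+ 2 <= C ^+ 2 * expR (s / 2).
      rewrite -[a p ^+ 2]real_normK ?num_real//.
      have -> : C ^+ 2 * expR (s / 2) = (C * expR (s / 4)) ^+ 2.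
        by rewrite exprMn [expR _ ^+ 2]expr2 -expRD; congr (_ * expR _); field.
      by rewrite ler_pXn2r// nnegrE// (le_trans _ H).
    rewrite gauss_weightE !subr0 -sE.
    apply: (@le_trans _ _ (C ^+ 2 * expR (s / 2) * (pi^-1 * expR (- s)))).
      by rewrite ler_wpM2r// mulr_ge0 ?expR_ge0// invr_ge0 pi_ge0.
    rewrite mulrACA -expRD [_ * pi^-1]mulrC.
    by rewrite (_ : s / 2 - s = - (2^-1 * s))//; field.
rewrite ge0_integralZl_EFin//; last 2 first.
- apply/measurable_EFinP; apply: measurableT_comp => //; apply: measurable_funN.
  apply: measurable_funM => //; apply: measurable_funD; apply: measurable_funX.
    by apply: measurable_funB.
  by apply: measurable_funB.
- by rewrite mulr_ge0 ?sqr_ge0// invr_ge0 pi_ge0.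
by rewrite HK -EFinM ltry.
Qed.

Lemma cmeasurable_cplx : cmeasurable (@cplx R : plane R -> R[i]).
Proof. by split => /=; [exact: measurable_fst|exact: measurable_snd]. Qed.

(** The reproducing kernel [exp (w * z^* )] of the Bargmann space. *)
Definition kern (w z : R[i]) : R[i] := cexp (w * z^*).

Lemma normc_kern w z : normc (kern w z) = expR (complex.Re (w * z^*)).
Proof. exact: normc_cexp. Qed.

Lemma normc_kern_le w z : normc (kern w z) <= expR (normc w * normc z).
Proof.
rewrite normc_kern ler_expR -[normc z]normcC -normcM.
exact: le_trans (ler_norm _) (ler_Re_normc _).
Qed.

Lemma kernC w z : (kern w z)^* = kern z w.
Proof.
rewrite /kern cexpC; congr cexp; apply: complex_ext; rewrite !ReImE/=; ring.
Qed.

Lemma cmeasurable_kern w : cmeasurable (fun p : plane R => kern w (cplx p)).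
Proof.
apply: cmeasurable_cexp; apply: cmeasurableM; first exact: cmeasurable_cst.
by apply: cmeasurableC; exact: cmeasurable_cplx.
Qed.

Lemma L2muP (f : R[i] -> R[i]) : L2mu f <->
  cmeasurable (fun p : plane R => f (cplx p)) /\
  (\int[dmu R]_p (normc (f (cplx p)) ^+ 2)%:E < +oo)%E.
Proof. by split=> [[]//|[[]]]. Qed.

Lemma L2mu_growth (f : R[i] -> R[i]) (C : R) :
  cmeasurable (fun p : plane R => f (cplx p)) ->
  (forall z, normc (f z) <= C * expR (normc z ^+ 2 / 4)) -> L2mu f.
Proof.
move=> mf fC; apply/L2muP; split => //.
apply: (@gauss_square_integrable _ C); first exact: measurable_normc.
by move=> p; rewrite ger0_norm ?normc_ge0.
Qed.

Lemma L2mu_kern w : L2mu (kern w).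
Proof.
apply: (@L2mu_growth _ (expR (normc w ^+ 2))); first exact: cmeasurable_kern.
move=> z; apply: le_trans (normc_kern_le _ _) _.
by rewrite -expRD ler_expR linear_le_quadratic.
Qed.

(** Products of square-integrable functions are integrable. *)
Lemma L2mu_cintegrableM (f g : plane R -> R[i]) :
  cmeasurable f -> cmeasurable g ->
  (\int[dmu R]_p (normc (f p) ^+ 2)%:E < +oo)%E ->
  (\int[dmu R]_p (normc (g p) ^+ 2)%:E < +oo)%E ->
  cintegrable (dmu R) (fun p => f p * g p).
Proof.
move=> mf mg f2 g2; apply: cintegrable_norm; first exact: cmeasurableM.
have fin (h : plane R -> R[i]) : (\int[dmu R]_p (normc (h p) ^+ 2)%:E < +oo)%E ->
    exists A : R, (\int[dmu R]_p (normc (h p) ^+ 2)%:E <= A%:E)%E.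
  have : (0 <= \int[dmu R]_p (normc (h p) ^+ 2)%:E)%E.
    by apply: integral_ge0 => p _; rewrite lee_fin sqr_ge0.
  by case: (\int[_]_p _)%E => // r _ _; exists r.
have [A fA] := fin f f2; have [B gB] := fin g g2.
under eq_integral do rewrite normcM.
apply: le_lt_trans (ge0_cauchy_schwarz _ _ _ _ fA gB) (ltry _).
- exact: measurable_normc.
- exact: measurable_normc.
- by move=> p; exact: normc_ge0.
- by move=> p; exact: normc_ge0.
Qed.

Lemma reproducing_integrable (h : R[i] -> R[i]) w : L2mu h ->
  cintegrable (dmu R) (fun p => h (cplx p) * kern w (cplx p)).
Proof.
move=> /L2muP[mh h2]; have /L2muP[mk k2] := L2mu_kern w.
exact: L2mu_cintegrableM.
Qed.

(** The reproducing formula of the Bargmann space: translating [w] to the origin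
    turns the integrand into [h (z + w) * exp (- w^* * z)], whose Gaussian mean is
    its value [h w] at the origin. *)
Lemma reproducing (h : R[i] -> R[i]) w : bargmann h ->
  cint (dmu R) (fun p => h (cplx p) * kern w (cplx p)) = h w.
Proof.
move=> [hE hL]; have iG := reproducing_integrable w hL.
set G := (fun p => h (cplx p) * kern w (cplx p)) in iG *.
pose a := complex.Re w; pose b := complex.Im w.
pose f z := h (1 * z + w) * cexp (- w^* * z + 0).
have fE : entire f.
  apply: entireM.
    exact: (@entire_comp R h _ hE (@entire_affine R 1 w)).
  exact: (@entire_comp R (@cexp R) _ (@entire_cexp R) (@entire_affine R (- w^*) 0)).
have fG p : f (cplx p) = G (shift2 a b p) * (shift_density a b p)%:C.
  rewrite /f /G.
  have -> : 1 * cplx p + w = cplx (shift2 a b p).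
    by apply: complex_ext; rewrite !ReImE/= /a /b; ring.
  rewrite -mulrA; congr (_ * _).
  have -> : (shift_density a b p)%:C =
      cexp (- (2 * (a * p.1 + b * p.2) + (a ^+ 2 + b ^+ 2)))%:C.
    by rewrite /cexp /= cos0 sin0; apply: complex_ext; rewrite !ReImE/= /shift_density; ring.
  rewrite /kern -cexpD; congr cexp; apply: complex_ext; rewrite !ReImE/= /a /b; ring.
have fRe p : complex.Re (f (cplx p)) = complex.Re (G (shift2 a b p)) * shift_density a b p.
  by rewrite fG !ReImE/=; ring.
have fIm p : complex.Im (f (cplx p)) = complex.Im (G (shift2 a b p)) * shift_density a b p.
  by rewrite fG !ReImE/=; ring.
have [iG1 iG2] := iG.
have if_ : cintegrable (dmu R) (fun p => f (cplx p)).
  split.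
    under eq_fun do rewrite fRe.
    exact: (dmu_shift_integrable a b (u := fun p => complex.Re (G p))).
  under eq_fun do rewrite fIm.
  exact: (dmu_shift_integrable a b (u := fun p => complex.Im (G p))).
have := dmu_mean fE if_; rewrite {2}/f mulr0 add0r addr0 mulr0 cexp0 mulr1 => <-.
apply: complex_ext => /=.
  rewrite -(dmu_shift a b iG1); apply: eq_Rintegral => p _; exact/esym/fRe.
rewrite -(dmu_shift a b iG2); apply: eq_Rintegral => p _; exact/esym/fIm.
Qed.

End gaussian_growth.

(** * Gaussian averages and Schur's test *)

Section schur_bound.
Variable R : realType.
Implicit Types (psi phi : plane R -> R) (G : plane R -> R[i]).

(** The Gaussian kernel [exp (- |w - z|^2 / 2)]. *)
Definition gkern (w : R[i]) (p : plane R) : R := expR (- (normc (w - cplx p) ^+ 2 / 2)).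

(** [psi] is a nonnegative measurable weight and the Gaussian averages of
    [psi ^ 2] are bounded by [C]. *)
Definition gauss_bounded psi (C : R) := [/\ measurable_fun setT psi,
  forall p, 0 <= psi p &
  forall w, (\int[dA R]_p (psi p ^+ 2 * gkern w p)%:E <= C%:E)%E].

Lemma sqr_normcB (w z : R[i]) :
  normc (w - z) ^+ 2 = normc w ^+ 2 + normc z ^+ 2 - 2 * complex.Re (w * z^*).
Proof. by rewrite !sqr_normc_def !ReImE/=; ring. Qed.

Lemma gkern_sym (p q : plane R) : gkern (cplx q) p = gkern (cplx p) q.
Proof. by rewrite /gkern -normc_opp opprB. Qed.

Lemma measurable_gkern2 :
  measurable_fun [set: plane R * plane R] (fun x => gkern (cplx x.1) x.2).
Proof.
apply: measurableT_comp => //; apply: measurable_funN; apply: measurable_funM => //.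
apply: measurable_funX; apply: (@measurable_normc _ (plane R * plane R)%type _
  (fun x => cplx x.1 - cplx x.2)).
have m11 : measurable_fun [set: plane R * plane R] (fun x => x.1.1) by apply: measurableT_comp.
have m12 : measurable_fun [set: plane R * plane R] (fun x => x.1.2) by apply: measurableT_comp.
have m21 : measurable_fun [set: plane R * plane R] (fun x => x.2.1) by apply: measurableT_comp.
have m22 : measurable_fun [set: plane R * plane R] (fun x => x.2.2) by apply: measurableT_comp.
by split => /=; exact: measurable_funB.
Qed.

Lemma measurable_gkern w : measurable_fun setT (gkern w).
Proof.
apply: measurableT_comp => //; apply: measurable_funN; apply: measurable_funM => //.
apply: measurable_funX; apply: (@measurable_normc _ (plane R) _ (fun p => w - cplx p)).
apply: cmeasurableD; first exact: cmeasurable_cst.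
by split => /=; apply: measurable_funN.
Qed.

Lemma gauss_bounded1 : exists C : R, gauss_bounded (fun=> 1) C.
Proof.
have h0 : 0 < 2^-1 :> R by [].
have [K K0 HK] := gauss_plane h0; exists K; split => // w.
rewrite -(HK (complex.Re w) (complex.Im w)) le_eqVlt; apply/orP; left; apply/eqP.
apply: eq_integral => p _; rewrite expr1n mul1r /gkern sqr_normc_def !ReImE/=.
by congr (expR (- _))%:E; ring.
Qed.

Section fixed_data.
Variables (psi : plane R -> R) (C : R) (G : plane R -> R[i]) (A : R).
Hypothesis psiC : gauss_bounded psi C.
Hypothesis mG : cmeasurable G.
Hypothesis GA : (\int[dmu R]_p (normc (G p) ^+ 2)%:E <= A%:E)%E.

Let mpsi : measurable_fun setT psi. Proof. by case: psiC. Qed.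
Let psi0 p : 0 <= psi p. Proof. by case: psiC. Qed.
Let mnG : measurable_fun setT (fun p => normc (G p)). Proof. exact: measurable_normc. Qed.

(** The modulus of the integrand [psi * G * kern w], and its integral. *)
Definition schur_integrand (w : R[i]) (p : plane R) : R :=
  psi p * normc (G p) * normc (kern w (cplx p)).

Definition schur_integral (w : R[i]) : R := \int[dmu R]_p schur_integrand w p.

(** The average of [|G| ^ 2] that dominates the square of [schur_integral]. *)
Definition gauss_average (w : R[i]) : \bar R :=
  (\int[dmu R]_p (normc (G p) ^+ 2 * gkern w p)%:E)%E.

Lemma schur_integrand_ge0 w p : 0 <= schur_integrand w p.
Proof. by rewrite !mulr_ge0// normc_ge0. Qed.

Lemma measurable_schur_integrand w : measurable_fun setT (schur_integrand w).
Proof.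
apply: measurable_funM; first exact: measurable_funM.
by apply: measurable_normc; exact: cmeasurable_kern.
Qed.

Lemma gkern_le1 w p : gkern w p <= 1.
Proof. by rewrite -expR0 ler_expR oppr_le0 divr_ge0// sqr_ge0. Qed.

Lemma gauss_average_le w : (gauss_average w <= A%:E)%E.
Proof.
apply: le_trans GA; apply: ge0_le_integral => //.
- by move=> p _; rewrite lee_fin mulr_ge0 ?sqr_ge0 ?expR_ge0.
- by apply/measurable_EFinP; apply: measurable_funM; [exact: measurable_funX|exact: measurable_gkern].
- by apply/measurable_EFinP; exact: measurable_funX.
- by move=> p _; rewrite lee_fin ler_piMr ?sqr_ge0// gkern_le1.
Qed.

Lemma gauss_average_ge0 w : (0 <= gauss_average w)%E.
Proof. by apply: integral_ge0 => p _; rewrite lee_fin mulr_ge0 ?sqr_ge0 ?expR_ge0. Qed.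

Lemma gauss_average_fin w : gauss_average w \is a fin_num.
Proof.
by rewrite ge0_fin_numE ?gauss_average_ge0//; exact: le_lt_trans (gauss_average_le w) (ltry _).
Qed.

(** Cauchy-Schwarz with the factor [exp (|w - z| ^ 2 / 4)] on [psi * |kern w|] and
    its inverse on [G]. The square of the former is a Gaussian average of
    [psi ^ 2] for Lebesgue measure, by the identity
    [|w| ^ 2 - 2 * Re (w * z^* ) + |z| ^ 2 = |w - z| ^ 2]. *)
Lemma schur_pointwise_le w : (\int[dmu R]_p (schur_integrand w p)%:E <=
  (Num.sqrt (expR (normc w ^+ 2) * fine (gauss_average w)) * Num.sqrt (C / pi))%:E)%E.
Proof.
pose e p := expR (normc (w - cplx p) ^+ 2 / 4).
pose a p := normc (G p) * ((e p)^-1 * expR (normc w ^+ 2 / 2)).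
pose b p := psi p * (normc (kern w (cplx p)) * (e p * expR (- (normc w ^+ 2 / 2)))).
have md : measurable_fun setT (fun p : plane R => normc (w - cplx p) ^+ 2 / 4).
  apply: measurable_funM => //.
  apply: measurable_funX; apply: (@measurable_normc _ (plane R) _ (fun p => w - cplx p)).
  apply: cmeasurableD; first exact: cmeasurable_cst.
  by split => /=; apply: measurable_funN.
have me : measurable_fun setT e by exact: measurableT_comp.
have mei : measurable_fun setT (fun p => (e p)^-1).
  under eq_fun do rewrite /e -expRN.
  by apply: measurableT_comp => //; exact: measurable_funN.
have ma : measurable_fun setT a.
  by apply: measurable_funM => //; exact: measurable_funM.
have mb : measurable_fun setT b.
  apply: measurable_funM => //; apply: measurable_funM.
    by apply: measurable_normc; exact: cmeasurable_kern.
  exact: measurable_funM.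
have e0 p : 0 < e p by exact: expR_gt0.
have a0 p : 0 <= a p by rewrite !mulr_ge0 ?normc_ge0 ?expR_ge0// invr_ge0 ltW.
have b0 p : 0 <= b p by rewrite !mulr_ge0 ?normc_ge0 ?expR_ge0// ltW.
have -> : (\int[dmu R]_p (schur_integrand w p)%:E = \int[dmu R]_p (a p * b p)%:E)%E.
  apply: eq_integral => p _; rewrite /a /b /schur_integrand; congr (_%:E).
  rewrite expRN; field; rewrite ?gt_eqF ?expR_gt0//.
apply: ge0_cauchy_schwarz => //.
- rewrite EFinM fineK ?gauss_average_fin//.
  rewrite -ge0_integralZl_EFin ?expR_ge0//; last 2 first.
  + by move=> p _; rewrite lee_fin mulr_ge0 ?sqr_ge0 ?expR_ge0.
  + by apply/measurable_EFinP; apply: measurable_funM; [exact: measurable_funX|exact: measurable_gkern].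
  rewrite le_eqVlt; apply/orP; left; apply/eqP; apply: eq_integral => p _.
  rewrite -EFinM; congr (_%:E); rewrite /a /e /gkern.
  move: (normc (G p)) (normc (w - cplx p) ^+ 2) (normc w ^+ 2) => g D N.
  rewrite -expRN 2!exprMn -!expRM_natl [RHS]mulrCA; congr (_ * _).
  by rewrite -!expRD; congr expR; field.
- case: psiC => _ _ /(_ w) Hw.
  rewrite ge0_integral_dmu; last 2 first.
  + by apply/measurable_EFinP; exact: measurable_funX.
  + by move=> p; rewrite lee_fin sqr_ge0.
  rewrite mulrC EFinM.
  apply: le_trans (lee_wpmul2l _ Hw); last by rewrite lee_fin invr_ge0 pi_ge0.
  rewrite -ge0_integralZl_EFin ?invr_ge0 ?pi_ge0//; last 2 first.
  + by move=> p _; rewrite lee_fin mulr_ge0 ?sqr_ge0 ?expR_ge0.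
  + by apply/measurable_EFinP; apply: measurable_funM; [exact: measurable_funX|exact: measurable_gkern].
  rewrite le_eqVlt; apply/orP; left; apply/eqP; apply: eq_integral => p _.
  rewrite -!EFinM; congr (_%:E).
  rewrite /b /e normc_kern gauss_weightE /gkern sqr_normcB.
  rewrite [normc (cplx p) ^+ 2]sqr_normc_def.
  move: (psi p) (normc w ^+ 2) (complex.Re (w * _)) (p.1 ^+ 2 + p.2 ^+ 2) => s N K P.
  rewrite 3!exprMn -!expRM_natl.
  have E : expR (- ((N + P - 2 * K) / 2)) = expR (2 * K) *
    (expR (2 * ((N + P - 2 * K) / 4)) * expR (2 * - (N / 2))) * expR (- P).
    by rewrite -!expRD; congr expR; field.
  by rewrite E; ring.
Qed.

End fixed_data.
End schur_bound.

Section weighted_projection.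
Variable R : realType.
Variables (psi : plane R -> R) (C : R) (G : plane R -> R[i]) (A : R).
Hypothesis psiC : gauss_bounded psi C.
Hypothesis mG : cmeasurable G.
Hypothesis GA : (\int[dmu R]_p (normc (G p) ^+ 2)%:E <= A%:E)%E.

Let mpsi : measurable_fun setT psi. Proof. by case: psiC. Qed.
Let psi0 p : 0 <= psi p. Proof. by case: psiC. Qed.
Let C0 : 0 <= C.
Proof.
case: psiC => _ _ /(_ 0); rewrite -lee_fin; apply: le_trans.
by apply: integral_ge0 => p _; rewrite lee_fin mulr_ge0 ?sqr_ge0 ?expR_ge0.
Qed.
Let pi0 : 0 < pi :> R. Proof. exact: pi_gt0. Qed.
Let mnG : measurable_fun setT (fun p => normc (G p)). Proof. exact: measurable_normc. Qed.

Lemma schur_integrable w :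
  (dmu R).-integrable setT (fun p => (schur_integrand psi G w p)%:E).
Proof.
apply: ge0_integrable; first exact: measurable_schur_integrand psiC mG w.
  by move=> p; exact: schur_integrand_ge0 psiC _ _.
exact: le_lt_trans (schur_pointwise_le psiC mG GA w) (ltry _).
Qed.

Lemma schur_integral_ge0 w : 0 <= schur_integral psi G w.
Proof. by apply: Rintegral_ge0 => p _; exact: schur_integrand_ge0 psiC _ _. Qed.

Lemma sqr_schur_integral_le w : schur_integral psi G w ^+ 2 <=
  expR (normc w ^+ 2) * fine (gauss_average G w) * (C / pi).
Proof.
have h0 : 0 <= expR (normc w ^+ 2) * fine (gauss_average G w).
  by rewrite mulr_ge0 ?expR_ge0// fine_ge0// gauss_average_ge0.
have h1 : 0 <= C / pi by rewrite divr_ge0// ltW.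
have := schur_pointwise_le psiC mG GA w.
rewrite -[X in (X <= _)%E]fineK; last exact: integrable_fin_num (schur_integrable w).
rewrite lee_fin -/(schur_integral psi G w) => H.
apply: (@le_trans _ _ ((Num.sqrt (expR (normc w ^+ 2) * fine (gauss_average G w)) *
  Num.sqrt (C / pi)) ^+ 2)).
  by rewrite ler_pXn2r ?nnegrE ?schur_integral_ge0// mulr_ge0 ?sqrtr_ge0.
by rewrite exprMn !sqr_sqrtr.
Qed.

Let mN2 : measurable_fun [set: plane R * plane R]
  (fun x => (normc (G x.2) ^+ 2 * gkern (cplx x.1) x.2)%:E).
Proof.
apply/measurable_EFinP; apply: measurable_funM; last exact: measurable_gkern2.
by apply: measurable_funX; exact: (measurableT_comp mnG measurable_snd).
Qed.

Lemma measurable_gauss_average : measurable_fun [set: plane R] (fun q => gauss_average G (cplx q)).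
Proof.
apply: (@measurable_fun_fubini_tonelli_F _ _ (plane R) (plane R) R (dmu R)
  (fun x => (normc (G x.2) ^+ 2 * gkern (cplx x.1) x.2)%:E)) => // x.
by rewrite lee_fin mulr_ge0 ?sqr_ge0 ?expR_ge0.
Qed.

Lemma cmeasurable_kern2 :
  cmeasurable (fun x : plane R * plane R => kern (cplx x.1) (cplx x.2)).
Proof.
have m11 : measurable_fun [set: plane R * plane R] (fun x => x.1.1) by apply: measurableT_comp.
have m12 : measurable_fun [set: plane R * plane R] (fun x => x.1.2) by apply: measurableT_comp.
have m21 : measurable_fun [set: plane R * plane R] (fun x => x.2.1) by apply: measurableT_comp.
have m22 : measurable_fun [set: plane R * plane R] (fun x => x.2.2) by apply: measurableT_comp.
apply: cmeasurable_cexp; apply: cmeasurableM; first by split.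
by apply: cmeasurableC; split.
Qed.

Lemma measurable_schur_integrand2 : measurable_fun [set: plane R * plane R]
  (fun x => schur_integrand psi G (cplx x.1) x.2).
Proof.
apply: measurable_funM; last by apply: measurable_normc; exact: cmeasurable_kern2.
apply: measurable_funM; first exact: (measurableT_comp mpsi measurable_snd).
exact: (measurableT_comp mnG measurable_snd).
Qed.

Lemma measurable_schur_integral :
  measurable_fun [set: plane R] (fun q => schur_integral psi G (cplx q)).
Proof.
have H := @measurable_fun_fubini_tonelli_F _ _ (plane R) (plane R) R (dmu R)
  (fun x => (schur_integrand psi G (cplx x.1) x.2)%:E).
have {}H : measurable_fun [set: plane R]
    (fun q => \int[dmu R]_p (schur_integrand psi G (cplx q) p)%:E)%E.
  apply: H; first by apply/measurable_EFinP; exact: measurable_schur_integrand2.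
  by move=> x; rewrite lee_fin; exact: schur_integrand_ge0 psiC _ _.
by apply: measurableT_comp => //; exact: H.
Qed.

(** The bound of [schur_integral] is integrated against the weight [phi ^ 2]; by
    symmetry of [gkern] the Gaussian averages are moved from [|G| ^ 2] to
    [phi ^ 2]. *)
Lemma schur_test (phi : plane R -> R) (C' : R) : gauss_bounded phi C' ->
  (\int[dmu R]_q (phi q ^+ 2 * schur_integral psi G (cplx q) ^+ 2)%:E <=
   (C / pi * (C' / pi) * A)%:E)%E.
Proof.
case=> mphi phi0 phiC.
have A0 : 0 <= A.
  by rewrite -lee_fin; apply: le_trans GA; apply: integral_ge0 => p _; rewrite lee_fin sqr_ge0.
have mphi2 : measurable_fun setT (fun q => phi q ^+ 2) by exact: measurable_funX.
have mS2 : measurable_fun setT (fun q => phi q ^+ 2 * schur_integral psi G (cplx q) ^+ 2).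
  by apply: measurable_funM => //; apply: measurable_funX; exact: measurable_schur_integral.
pose N q := gauss_average G (cplx q : R[i]).
have mN : measurable_fun setT N by exact: measurable_gauss_average.
have N0 q : (0 <= N q)%E by exact: gauss_average_ge0.
have k0 : 0 <= C / pi / pi by rewrite !divr_ge0// ltW.
rewrite ge0_integral_dmu; last 2 first.
- exact/measurable_EFinP.
- by move=> q; rewrite lee_fin mulr_ge0// sqr_ge0.
apply: (@le_trans _ _ (\int[@lebesgue2 R]_q ((C / pi / pi)%:E * ((phi q ^+ 2)%:E * N q)))%E).
  apply: ge0_le_integral => //.
  - by move=> q _; rewrite mule_ge0 ?lee_fin ?gauss_weight_ge0// mulr_ge0// sqr_ge0.
  - apply: emeasurable_funM; first exact/measurable_EFinP.
    by apply/measurable_EFinP; exact: measurable_gauss_weight.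
  - by apply: emeasurable_funM => //; apply: emeasurable_funM => //; exact/measurable_EFinP.
  - move=> q _.
    have NE : N q = (fine (N q))%:E by rewrite fineK//; exact: gauss_average_fin GA _.
    rewrite NE -!EFinM lee_fin.
    have := sqr_schur_integral_le (cplx q); rewrite -/(N q) => H.
    apply: (@le_trans _ _ (phi q ^+ 2 * (expR (normc (cplx q) ^+ 2) * fine (N q) * (C / pi)) * gauss_weight q)).
      by rewrite ler_wpM2r ?gauss_weight_ge0// ler_wpM2l ?sqr_ge0.
    rewrite /gauss_weight expRN le_eqVlt; apply/orP; left; apply/eqP.
    move: (pi : R) (lt0r_neq0 pi0) => P P0; field.
    by rewrite P0 gt_eqF ?expR_gt0.
rewrite ge0_integralZl_EFin//; last 2 first.
- by move=> q _; rewrite mule_ge0// lee_fin sqr_ge0.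
- by apply: emeasurable_funM => //; exact/measurable_EFinP.
have -> : (C / pi * (C' / pi) * A)%:E = ((C / pi / pi)%:E * (C' * A)%:E)%E.
  by rewrite -EFinM; congr (_%:E); ring.
apply: lee_wpmul2l; first by rewrite lee_fin.
pose g (x : plane R * plane R) := (phi x.1 ^+ 2 * (normc (G x.2) ^+ 2 * gkern (cplx x.1) x.2))%:E.
have mg : measurable_fun setT g.
  apply/measurable_EFinP; apply: measurable_funM; last by move/measurable_EFinP : mN2.
  by apply: measurable_funX; exact: (measurableT_comp mphi measurable_fst).
have g0 x : (0 <= g x)%E.
  rewrite lee_fin; apply: mulr_ge0; first exact: sqr_ge0.
  by rewrite mulr_ge0 ?sqr_ge0 ?expR_ge0.
have -> : (\int[@lebesgue2 R]_q ((phi q ^+ 2)%:E * N q) =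
           \int[@lebesgue2 R]_q \int[dmu R]_p g (q, p))%E.
  apply: eq_integral => q _; rewrite /g /=.
  under eq_integral do rewrite EFinM.
  rewrite ge0_integralZl_EFin ?sqr_ge0//.
  - by move=> p _; rewrite lee_fin mulr_ge0 ?sqr_ge0 ?expR_ge0.
  - apply/measurable_EFinP; apply: measurable_funM; first exact: measurable_funX.
    exact: measurable_gkern.
rewrite (fubini_tonelli (m1 := @lebesgue2 R) (m2 := dmu R))//.
apply: (@le_trans _ _ (\int[dmu R]_p (C'%:E * (normc (G p) ^+ 2)%:E))%E).
  apply: ge0_le_integral => //.
  - by move=> p _; apply: integral_ge0.
  - exact: (@measurable_fun_fubini_tonelli_G _ _ (plane R) (plane R) R (@lebesgue2 R) g).
  - by apply: emeasurable_funM => //; apply/measurable_EFinP; exact: measurable_funX.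
  - move=> p _; rewrite /g /=.
    under eq_integral => q _.
      rewrite gkern_sym mulrCA EFinM.
      over.
    rewrite ge0_integralZl_EFin ?sqr_ge0//.
    + by rewrite muleC; apply: lee_wpmul2r; [rewrite lee_fin sqr_ge0|exact: phiC].
    + by move=> q _; rewrite lee_fin mulr_ge0 ?sqr_ge0 ?expR_ge0.
    + by apply/measurable_EFinP; apply: measurable_funM => //; exact: measurable_gkern.
have C'0 : 0 <= C'.
  by rewrite -lee_fin; apply: le_trans (phiC 0); apply: integral_ge0 => p _;
    rewrite lee_fin mulr_ge0 ?sqr_ge0 ?expR_ge0.
rewrite ge0_integralZl_EFin//; last 2 first.
- by move=> p _; rewrite lee_fin sqr_ge0.
- by apply/measurable_EFinP; exact: measurable_funX.
by rewrite EFinM; apply: lee_wpmul2l; rewrite ?lee_fin.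
Qed.

End weighted_projection.

(** * The weighted Bargmann projection *)

Section gproj.
Variable R : realType.

(** The integral of [psi * G] against the reproducing kernel, that is, the
    Bargmann projection of [psi * G] when this function is square-integrable. *)
Definition gproj (psi : plane R -> R) (G : plane R -> R[i]) (w : R[i]) : R[i] :=
  cint (dmu R) (fun p => (psi p)%:C * G p * kern w (cplx p)).

Variables (psi : plane R -> R) (C : R) (G : plane R -> R[i]) (A : R).
Hypothesis psiC : gauss_bounded psi C.
Hypothesis mG : cmeasurable G.
Hypothesis GA : (\int[dmu R]_p (normc (G p) ^+ 2)%:E <= A%:E)%E.

Let mpsi : measurable_fun setT psi. Proof. by case: psiC. Qed.
Let psi0 p : 0 <= psi p. Proof. by case: psiC. Qed.
Let mnG : measurable_fun setT (fun p => normc (G p)). Proof. exact: measurable_normc. Qed.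

Lemma normc_gproj_integrand w p :
  normc ((psi p)%:C * G p * kern w (cplx p)) = schur_integrand psi G w p.
Proof. by rewrite /schur_integrand !normcM normcR ger0_norm. Qed.

Let mF : cmeasurable (fun p => (psi p)%:C * G p).
Proof. by apply: cmeasurableM => //; exact: cmeasurableR. Qed.

Lemma gproj_integrable w :
  cintegrable (dmu R) (fun p => (psi p)%:C * G p * kern w (cplx p)).
Proof.
apply: (cintegrable_dominated _ (schur_integrable psiC mG GA w)).
  by apply: cmeasurableM => //; exact: cmeasurable_kern.
by move=> p; rewrite normc_gproj_integrand.
Qed.

Lemma normc_gproj_le w : normc (gproj psi G w) <= schur_integral psi G w.
Proof.
apply: le_trans (normc_cint_le (gproj_integrable w)) _.
by rewrite le_eqVlt; apply/orP; left; apply/eqP; apply: eq_Rintegral => p _;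
  rewrite normc_gproj_integrand.
Qed.

Lemma sqr_schur_integral_lty :
  exists B : R, (\int[dmu R]_q (schur_integral psi G (cplx q) ^+ 2)%:E <= B%:E)%E.
Proof.
have [C1 H1] := gauss_bounded1 R.
exists (C / pi * (C1 / pi) * A); apply: le_trans (schur_test psiC mG GA H1).
by rewrite le_eqVlt; apply/orP; left; apply/eqP; apply: eq_integral => q _;
  rewrite expr1n mul1r.
Qed.

Lemma gproj_product_integrable (H : plane R -> R[i]) : cmeasurable H ->
  (\int[dmu R]_p (normc (H p) ^+ 2)%:E < +oo)%E ->
  cintegrable (dmu R \x dmu R)%E
    (fun x => (psi x.2)%:C * G x.2 * kern (cplx x.1) (cplx x.2) * H x.1).
Proof.
move=> mH H2; have [B HB] := sqr_schur_integral_lty.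
have [B' HB'] : exists B' : R, (\int[dmu R]_p (normc (H p) ^+ 2)%:E <= B'%:E)%E.
  have : (0 <= \int[dmu R]_p (normc (H p) ^+ 2)%:E)%E.
    by apply: integral_ge0 => p _; rewrite lee_fin sqr_ge0.
  by move: H2; case: (\int[_]_p _)%E => // r _ _; exists r.
have mnH : measurable_fun setT (fun q => normc (H q)) by exact: measurable_normc.
have mS := measurable_schur_integral psiC mG.
have mall : cmeasurable (fun x : plane R * plane R =>
    (psi x.2)%:C * G x.2 * kern (cplx x.1) (cplx x.2) * H x.1).
  apply: cmeasurableM.
    apply: cmeasurableM; last exact: cmeasurable_kern2.
    by case: mF => m1 m2; split;
      [exact: (measurableT_comp m1 measurable_snd)|exact: (measurableT_comp m2 measurable_snd)].
  by case: mH => m1 m2; split;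
    [exact: (measurableT_comp m1 measurable_fst)|exact: (measurableT_comp m2 measurable_fst)].
have key : (dmu R \x dmu R)%E.-integrable setT
    (fun x => (schur_integrand psi G (cplx x.1) x.2 * normc (H x.1))%:E).
  have mk : measurable_fun [set: plane R * plane R]
      (fun x => schur_integrand psi G (cplx x.1) x.2 * normc (H x.1)).
    apply: measurable_funM; first exact: measurable_schur_integrand2 psiC mG.
    exact: (measurableT_comp mnH measurable_fst).
  apply/(integrable12ltyP (dmu R) (dmu R)); first exact/measurable_EFinP.
  under eq_integral => q _.
    under eq_integral => p _.
      rewrite /= ger0_norm; last first.
        by rewrite mulr_ge0 ?normc_ge0//; exact: schur_integrand_ge0 psiC _ _.
      rewrite EFinM.
      over.
    rewrite ge0_integralZr ?lee_fin ?normc_ge0//.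
    + rewrite -[X in (X * _)%E]fineK; last exact: integrable_fin_num (schur_integrable psiC mG GA _).
      rewrite -/(schur_integral psi G (cplx q)) -EFinM.
      over.
    + by apply/measurable_EFinP; exact: measurable_schur_integrand psiC mG _.
    + by move=> p _; rewrite lee_fin; exact: schur_integrand_ge0 psiC _ _.
  apply: le_lt_trans (ge0_cauchy_schwarz mS mnH _ _ HB HB') (ltry _).
    by move=> q; exact: schur_integral_ge0 psiC _.
  by move=> q; exact: normc_ge0.
apply: (cintegrable_dominated mall key) => x.
by rewrite normcM normc_gproj_integrand.
Qed.

Let congr_cint (F1 F2 : plane R -> R[i]) : (forall p, F1 p = F2 p) ->
  cint (dmu R) F1 = cint (dmu R) F2.
Proof. by move=> /funext ->. Qed.

Lemma cmeasurable_gproj : cmeasurable (fun q : plane R => gproj psi G (cplx q)).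
Proof.
have one2 : (\int[dmu R]_p (normc (1 : R[i]) ^+ 2)%:E < +oo)%E.
  rewrite normc1 expr1n integral_cst// [X in (_ * X < _)%E]gauss_measure_setT.
  by rewrite mule1 ltry.
have [i1 i2] := gproj_product_integrable (cmeasurable_cst _ 1) one2.
have E (P : R[i] -> R) : (fun q : plane R => \int[dmu R]_p P ((psi p)%:C * G p * kern (cplx q) (cplx p))) =
    (fun q => fine (\int[dmu R]_p (P ((psi p)%:C * G p * kern (cplx q) (cplx p) * 1))%:E)%E).
  by apply/funext => q; congr fine; apply: eq_integral => p _; rewrite mulr1.
split.
  rewrite /gproj /cint /= (E (@complex.Re R)).
  by apply: measurableT_comp => //; exact: (measurable_fubini_F i1).
rewrite /gproj /cint /= (E (@complex.Im R)).
by apply: measurableT_comp => //; exact: (measurable_fubini_F i2).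
Qed.

(** The operator [G |-> phi * P (psi * G)] is bounded on square-integrable
    functions. *)
Lemma gproj_L2_le (phi : plane R -> R) (C' : R) : gauss_bounded phi C' ->
  (\int[dmu R]_q (phi q ^+ 2 * normc (gproj psi G (cplx q)) ^+ 2)%:E <=
   (C / pi * (C' / pi) * A)%:E)%E.
Proof.
move=> phiC; apply: le_trans (schur_test psiC mG GA phiC).
have [mphi phi0 _] := phiC.
have mphi2 : measurable_fun setT (fun q => phi q ^+ 2) by exact: measurable_funX.
apply: ge0_le_integral => //.
- by move=> q _; rewrite lee_fin mulr_ge0 ?sqr_ge0.
- apply/measurable_EFinP; apply: measurable_funM => //; apply: measurable_funX.
  by apply: measurable_normc; exact: cmeasurable_gproj.
- apply/measurable_EFinP; apply: measurable_funM => //; apply: measurable_funX.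
  exact: measurable_schur_integral psiC mG.
- move=> q _; rewrite lee_fin ler_wpM2l ?sqr_ge0//.
  rewrite ler_pXn2r ?nnegrE ?normc_ge0// ?normc_gproj_le//.
  exact: schur_integral_ge0 psiC _.
Qed.

Lemma gproj_L2mu : L2mu (gproj psi G).
Proof.
apply/L2muP; split; first exact: cmeasurable_gproj.
have [C1 H1] := gauss_bounded1 R.
apply: le_lt_trans (ltry (C / pi * (C1 / pi) * A)).
apply: le_trans (gproj_L2_le H1).
by rewrite le_eqVlt; apply/orP; left; apply/eqP; apply: eq_integral => q _;
  rewrite expr1n mul1r.
Qed.

(** [gproj psi G] and [psi * G] have the same pairing with the Bargmann space. *)
Lemma gproj_adjoint (h : R[i] -> R[i]) : bargmann h ->
  cint (dmu R) (fun q => gproj psi G (cplx q) * (h (cplx q))^*) =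
  cint (dmu R) (fun p => (psi p)%:C * G p * (h (cplx p))^*).
Proof.
move=> hB; have [_ hL] := hB; have /L2muP[mh h2] := hL.
have mhC := cmeasurableC mh.
have h2C : (\int[dmu R]_p (normc (h (cplx p))^* ^+ 2)%:E < +oo)%E.
  by under eq_integral do rewrite normcC.
have := cfubini (gproj_product_integrable mhC h2C) => /=.
under [X in X = _ -> _]congr_cint => q.
  rewrite (_ : (fun y => _) = (fun y => (h (cplx q))^* * ((psi y)%:C * G y * kern (cplx q) (cplx y)))); last first.
    by apply/funext => y; rewrite mulrC.
  rewrite cintZ; last exact: gproj_integrable.
  rewrite mulrC -/(gproj psi G (cplx q)).
  over.
under [X in _ = X -> _]congr_cint => p.
  rewrite (_ : (fun x => _) = (fun x => (psi p)%:C * G p * (h (cplx x) * kern (cplx p) (cplx x))^*)); last first.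
    by apply/funext => x; rewrite rmorphM/= kernC; ring.
  rewrite cintZ; last by apply: cintegrableC; exact: reproducing_integrable.
  rewrite cintC ?reproducing//; last exact: reproducing_integrable.
  over.
by [].
Qed.

(** An integrable majorant for the differentiation of [gproj] under the
    integral sign. *)
Lemma gproj_exp_integrable w : (dmu R).-integrable setT
  (fun p => (schur_integrand psi G w p * expR (2 * normc (cplx p)))%:E).
Proof.
pose b p := psi p * (normc (kern w (cplx p)) * expR (2 * normc (cplx p))).
have mn : measurable_fun setT (fun p : plane R => normc (cplx p)).
  by apply: measurable_normc; exact: cmeasurable_cplx.
have mb : measurable_fun setT b.
  apply: measurable_funM => //; apply: measurable_funM.
    by apply: measurable_normc; exact: cmeasurable_kern.
  by apply: measurableT_comp => //; exact: measurable_funM.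
have b0 p : 0 <= b p by rewrite /b mulr_ge0// mulr_ge0 ?normc_ge0 ?expR_ge0.
have [mpsi_ _ /(_ 0) H0] := psiC.
pose B := normc w + 2.
have Hb : (\int[dmu R]_p (b p ^+ 2)%:E <= (expR ((2 * B) ^+ 2) / pi * C)%:E)%E.
  rewrite ge0_integral_dmu; last 2 first.
  - by apply/measurable_EFinP; exact: measurable_funX.
  - by move=> p; rewrite lee_fin sqr_ge0.
  have k0 : 0 <= expR ((2 * B) ^+ 2) / pi by rewrite divr_ge0 ?expR_ge0// pi_ge0.
  rewrite EFinM; apply: le_trans (lee_wpmul2l _ H0); last by rewrite lee_fin.
  rewrite -ge0_integralZl_EFin//; last 2 first.
  - by move=> p _; rewrite lee_fin mulr_ge0 ?sqr_ge0 ?expR_ge0.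
  - by apply/measurable_EFinP; apply: measurable_funM; [exact: measurable_funX|exact: measurable_gkern].
  apply: ge0_le_integral => //.
  - by move=> p _; rewrite mule_ge0 ?lee_fin ?sqr_ge0 ?gauss_weight_ge0.
  - apply: emeasurable_funM; apply/measurable_EFinP; first exact: measurable_funX.
    exact: measurable_gauss_weight.
  - apply: emeasurable_funM => //; apply/measurable_EFinP.
    by apply: measurable_funM; [exact: measurable_funX|exact: measurable_gkern].
  - move=> p _; rewrite -!EFinM lee_fin /b exprMn -[leLHS]mulrA.
    rewrite [leRHS]mulrCA; apply: ler_wpM2l; first exact: sqr_ge0.
    rewrite /gauss_weight /gkern sub0r normc_opp [leLHS]mulrCA.
    have := normc_kern_le w (cplx p); have := normc_ge0 (kern w (cplx p)).
    move: (normc (kern w _)) (normc (cplx p)) (normc_ge0 (cplx p)) => k t t0 k1 k2.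
    rewrite [X in _ <= X * _]mulrC -[leRHS]mulrA.
    apply: ler_wpM2l; first by rewrite invr_ge0 pi_ge0.
    apply: (@le_trans _ _ ((expR (normc w * t) * expR (2 * t)) ^+ 2 * expR (- t ^+ 2))).
      rewrite ler_wpM2r ?expR_ge0// ler_pXn2r ?nnegrE ?mulr_ge0 ?expR_ge0//.
      by rewrite ler_wpM2r ?expR_ge0.
    rewrite -expRD -expRM_natl -!expRD ler_expR.
    have := linear_le_quadratic (2 * B) t; have := sqr_ge0 t.
    rewrite /B => ? ?; lra.
apply: ge0_integrable.
- apply: measurable_funM; first exact: measurable_schur_integrand psiC mG w.
  by apply: measurableT_comp => //; exact: measurable_funM.
- by move=> p; rewrite mulr_ge0 ?expR_ge0//; exact: schur_integrand_ge0 psiC _ _.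
have -> : (\int[dmu R]_p (schur_integrand psi G w p * expR (2 * normc (cplx p)))%:E =
    \int[dmu R]_p (normc (G p) * b p)%:E)%E.
  by apply: eq_integral => p _; rewrite /b /schur_integrand; congr (_%:E); ring.
apply: le_lt_trans (ge0_cauchy_schwarz mnG mb _ b0 GA Hb) (ltry _).
by move=> p; exact: normc_ge0.
Qed.

Lemma gproj_entire : entire (gproj psi G).
Proof.
apply/entireP => w.
pose F p := (psi p)%:C * G p * kern w (cplx p).
pose D p := schur_integrand psi G w p * expR (2 * normc (cplx p)).
have iD : (dmu R).-integrable setT (fun p => (D p)%:E) := gproj_exp_integrable w.
have D0 p : 0 <= D p.
  by rewrite mulr_ge0 ?expR_ge0//; exact: schur_integrand_ge0 psiC _ _.
have mF' : cmeasurable F by apply: cmeasurableM => //; exact: cmeasurable_kern.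
have FE p : normc (F p) = schur_integrand psi G w p by exact: normc_gproj_integrand.
have FD p : normc (F p) <= D p.
  rewrite FE /D; apply: ler_peMr; first exact: schur_integrand_ge0 psiC _ _.
  by apply: expR_ge1_nneg; rewrite mulr_ge0 ?normc_ge0.
have mz : cmeasurable (fun p : plane R => (cplx p)^*) by apply: cmeasurableC; exact: cmeasurable_cplx.
have expn (t : R) : 0 <= t -> t <= expR t.
  by move=> t0; have := expR_ge1Dx t => ?; lra.
have iF1 : cintegrable (dmu R) (fun p => F p * (cplx p)^*).
  apply: (cintegrable_dominated _ iD); first exact: cmeasurableM.
  move=> p; rewrite normcM normcC FE /D; apply: ler_wpM2l.
    exact: schur_integrand_ge0 psiC _ _.
  have t0 := normc_ge0 (cplx p); apply: le_trans (expn _ t0) _.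
  by rewrite ler_expR; lra.
exists (cint (dmu R) (fun p => F p * (cplx p)^*)) => e e0.
set I := \int[dmu R]_p D p.
have I0 : 0 <= I by apply: Rintegral_ge0 => p _.
have I1 : 0 < 16 * I + 1 by lra.
exists (Num.min 1 (e / (16 * I + 1))) => [|h].
  by rewrite lt_min ltr01 divr_gt0.
rewrite lt_min => /andP[h1 he]; have h0 := normc_ge0 h.
pose r p := F p * (cexp (h * (cplx p)^*) - 1 - h * (cplx p)^*).
(* the kernel is expanded to second order by [cexp_sub1x_le]; for [|h| <= 1] the
   factor [exp (2 * |z|)] of [D] absorbs the square and the exponential *)
have rD p : normc (r p) <= 16 * normc h ^+ 2 * D p.
  rewrite /r normcM FE /D mulrCA; apply: ler_wpM2l.
    exact: schur_integrand_ge0 psiC _ _.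
  apply: le_trans (cexp_sub1x_le _) _; rewrite normcM normcC.
  have t0 := normc_ge0 (cplx p); move: (normc (cplx p)) t0 => t t0.
  rewrite exprMn.
  have t2 : t ^+ 2 <= 4 * expR t.
    have := expn (t / 2) ltac:(lra) => H.
    have -> : expR t = expR (t / 2) ^+ 2 by rewrite -expRM_natl; congr expR; field.
    have : (t / 2) ^+ 2 <= expR (t / 2) ^+ 2 by rewrite ler_pXn2r ?nnegrE ?expR_ge0//; lra.
    have -> : (t / 2) ^+ 2 = t ^+ 2 / 4 by field.
    by move=> ?; lra.
  have et : expR (normc h * t) <= expR t.
    by rewrite ler_expR ler_piMl// ltW.
  have -> : expR (2 * t) = expR t * expR t by rewrite -expRD; congr expR; ring.
  have -> : 4 * (normc h ^+ 2 * t ^+ 2) * expR (normc h * t) =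
    4 * normc h ^+ 2 * (t ^+ 2 * expR (normc h * t)) by ring.
  have -> : 16 * normc h ^+ 2 * (expR t * expR t) =
    4 * normc h ^+ 2 * (4 * expR t * expR t) by ring.
  apply: ler_wpM2l; first by rewrite mulr_ge0// sqr_ge0.
  by apply: ler_pM; rewrite ?sqr_ge0 ?expR_ge0.
have rE p : r p = (psi p)%:C * G p * kern (w + h) (cplx p) - F p - h * (F p * (cplx p)^*).
  by rewrite /r /F /kern mulrDl cexpD; ring.
have ir : cintegrable (dmu R) r.
  have -> : r = (fun p => (psi p)%:C * G p * kern (w + h) (cplx p) + (- F p) + (- (h * (F p * (cplx p)^*)))).
    by apply/funext => p; rewrite rE.
  apply: cintegrableD; last by apply: cintegrableN; exact: cintegrableZ.
  by apply: cintegrableD; [exact: gproj_integrable|apply: cintegrableN; exact: gproj_integrable].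
have -> : gproj psi G (w + h) - gproj psi G w - cint (dmu R) (fun p => F p * (cplx p)^*) * h =
    cint (dmu R) r.
  rewrite [_ * h]mulrC -cintZ// -[gproj psi G w]/(cint (dmu R) F).
  rewrite -cintB; [|exact: gproj_integrable|exact: gproj_integrable].
  rewrite -cintB; [|exact: (cintegrableD (gproj_integrable _) (cintegrableN (gproj_integrable _)))|exact: cintegrableZ].
  by congr cint; apply/funext => p; rewrite rE.
apply: le_trans (normc_cint_le ir) _.
apply: (@le_trans _ _ (\int[dmu R]_p (16 * normc h ^+ 2 * D p))).
  have iKD : (dmu R).-integrable setT (fun p => (16 * normc h ^+ 2 * D p)%:E).
    by under eq_fun do rewrite EFinM; exact: integrableZl.
  by apply: le_Rintegral => //; exact: integrable_normc.
rewrite RintegralZl// -/I.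
have : normc h * (16 * I + 1) <= e by rewrite -ler_pdivlMr// ltW.
move=> H; nra.
Qed.

Lemma gproj_bargmann : bargmann (gproj psi G).
Proof. by split; [exact: gproj_entire|exact: gproj_L2mu]. Qed.

End gproj.

(** * Orthogonal projection and Toeplitz operators *)

Section square_integrable.
Variable R : realType.
Implicit Types (f h : R[i] -> R[i]).

Lemma sqr_norm2 f : L2mu f ->
  ((norm2 f ^+ 2)%:E = \int[dmu R]_p (normc (f (cplx p)) ^+ 2)%:E)%E.
Proof.
move=> /L2muP[mf f2]; rewrite /norm2 sqr_sqrtr; last first.
  by apply: Rintegral_ge0 => p _; exact: sqr_ge0.
rewrite fineK// ge0_fin_numE//; apply: integral_ge0 => p _.
by rewrite lee_fin sqr_ge0.
Qed.

Lemma norm2_ge0 f : 0 <= norm2 f. Proof. exact: sqrtr_ge0. Qed.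

Lemma norm2_le f (A : R) : 0 <= A -> L2mu f ->
  (\int[dmu R]_p (normc (f (cplx p)) ^+ 2)%:E <= (A ^+ 2)%:E)%E -> norm2 f <= A.
Proof.
move=> A0 fL; rewrite -sqr_norm2// lee_fin => H.
by rewrite -(ler_pXn2r (n := 2)) ?nnegrE ?norm2_ge0.
Qed.

Lemma L2mu_cintegrable f h : L2mu f -> L2mu h ->
  cintegrable (dmu R) (fun p => f (cplx p) * (h (cplx p))^*).
Proof.
move=> /L2muP[mf f2] /L2muP[mh h2]; apply: L2mu_cintegrableM => //.
  exact: cmeasurableC.
by under eq_integral do rewrite normcC.
Qed.

Lemma normc_inner_le f h : L2mu f -> L2mu h ->
  normc (inner f h) <= norm2 f * norm2 h.
Proof.
move=> fL hL; have /L2muP[mf f2] := fL; have /L2muP[mh h2] := hL.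
have i := L2mu_cintegrable fL hL.
apply: le_trans (normc_cint_le i) _.
rewrite -lee_fin.
have ii := integrable_normc i.
rewrite fineK; last exact: integrable_fin_num ii.
under eq_integral do rewrite normcM normcC.
have := @ge0_cauchy_schwarz _ _ _ (dmu R) (fun p => normc (f (cplx p)))
  (fun p => normc (h (cplx p))) (norm2 f ^+ 2) (norm2 h ^+ 2)
  (measurable_normc mf) (measurable_normc mh)
  (fun p => normc_ge0 _) (fun p => normc_ge0 _).
by rewrite !sqrtr_sqr !ger0_norm ?norm2_ge0 ?sqr_norm2//; apply.
Qed.

Lemma L2mu_lin (a : R[i]) f h : L2mu f -> L2mu h -> L2mu (fun z => a * f z + h z).
Proof.
move=> fL hL; have /L2muP[mf f2] := fL; have /L2muP[mh h2] := hL.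
have maf : cmeasurable (fun p : plane R => a * f (cplx p)).
  by apply: cmeasurableM => //; exact: cmeasurable_cst.
apply/L2muP; split; first exact: cmeasurableD.
have i (u : R[i] -> R[i]) (c : R) : 0 <= c -> L2mu u ->
    (dmu R).-integrable setT (fun p => (c * normc (u (cplx p)) ^+ 2)%:E).
  move=> c0 /L2muP[mu_ u2]; under eq_fun do rewrite EFinM.
  apply: integrableZl => //; apply: ge0_integrable => //.
    by apply: measurable_funX; exact: measurable_normc.
  by move=> p; exact: sqr_ge0.
have iS : (dmu R).-integrable setT (fun p => (2 * normc a ^+ 2 * normc (f (cplx p)) ^+ 2 +
    2 * normc (h (cplx p)) ^+ 2)%:E).
  under eq_fun do rewrite EFinD; apply: integrableD => //.
    by apply: i => //; rewrite mulr_ge0// sqr_ge0.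
  exact: i.
have /integrableP[_] : (dmu R).-integrable setT
    (fun p => (normc (a * f (cplx p) + h (cplx p)) ^+ 2)%:E).
  apply: integrable_dominated iS _.
    by apply: measurable_funX; apply: measurable_normc; exact: cmeasurableD.
  move=> p; rewrite ger0_norm ?sqr_ge0//.
  have := normc_triangle (a * f (cplx p)) (h (cplx p)); rewrite normcM.
  have := normc_ge0 (a * f (cplx p) + h (cplx p)).
  move: (normc _) (normc a) (normc (f _)) (normc (h _)) => x y u v x0 xy.
  have : x ^+ 2 <= (y * u + v) ^+ 2.
    by rewrite ler_pXn2r// nnegrE (le_trans x0).
  have := sqr_ge0 (y * u - v); move=> ? ?; nra.
by under eq_integral do rewrite /= ger0_norm ?sqr_ge0//.
Qed.

Lemma bargmann_lin (a : R[i]) f h : bargmann f -> bargmann h ->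
  bargmann (fun z => a * f z + h z).
Proof.
move=> [fE fL] [hE hL]; split; last exact: L2mu_lin.
have aE : entire (fun=> a) by move=> z; exact: derivable_cst.
exact: (entireD (entireM aE fE) hE).
Qed.

Lemma bargmannB f h : bargmann f -> bargmann h -> bargmann (fun z => f z - h z).
Proof.
move=> fB hB; rewrite (_ : (fun z => _) = (fun z => (-1) * h z + f z)).
  exact: bargmann_lin.
by apply/funext => z; rewrite mulN1r addrC.
Qed.

Lemma L2muB f h : L2mu f -> L2mu h -> L2mu (fun z => f z - h z).
Proof.
move=> fB hB; rewrite (_ : (fun z => _) = (fun z => (-1) * h z + f z)).
  exact: L2mu_lin.
by apply/funext => z; rewrite mulN1r addrC.
Qed.

Lemma inner_self f : L2mu f -> inner f f = (norm2 f ^+ 2)%:C.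
Proof.
move=> fL; have h := sqr_norm2 fL; apply: complex_ext => /=.
  have -> : norm2 f ^+ 2 = fine (norm2 f ^+ 2)%:E by [].
  rewrite h; congr fine; apply: eq_integral => p _.
  by rewrite mulc_conj.
transitivity (\int[dmu R]_p (0 : R)); last by rewrite Rintegral_cst// mul0r.
by apply: eq_Rintegral => p _; rewrite mulc_conj.
Qed.

Lemma innerBl f h k : L2mu f -> L2mu h -> L2mu k ->
  inner (fun z => f z - h z) k = inner f k - inner h k.
Proof.
move=> fL hL kL; rewrite /inner -[mu_integral _]/(cint (dmu R) _).
transitivity (cint (dmu R) (fun p => f (cplx p) * (k (cplx p))^* - h (cplx p) * (k (cplx p))^*)).
  by congr cint; apply/funext => p; rewrite mulrBl.
by rewrite cintB//; exact: L2mu_cintegrable.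
Qed.

(** A function of the Bargmann space with zero norm vanishes everywhere, by the
    reproducing formula. *)
Lemma bargmann_eq0 f : bargmann f -> norm2 f = 0 -> forall z, f z = 0.
Proof.
move=> fB f0 z; have [_ fL] := fB.
apply/eqP; rewrite -normc_eq0 -(reproducing z fB); apply/eqP/le_anti.
rewrite normc_ge0 andbT.
have -> : (fun p : plane R => f (cplx p) * kern z (cplx p)) =
    (fun p => f (cplx p) * (kern (cplx p) z)^*).
  by apply/funext => p; rewrite kernC.
have kL : L2mu (fun w => kern w z).
  have /L2muP[mk k2] := L2mu_kern z; apply/L2muP; split.
    rewrite (_ : (fun p => _) = (fun p : plane R => (kern z (cplx p))^*)).
      exact: cmeasurableC.
    by apply/funext => p; rewrite kernC.
  by under eq_integral do rewrite -normcC kernC.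
by have := normc_inner_le fL kL; rewrite f0 mul0r.
Qed.

(** Every square-integrable function has an orthogonal projection. *)
Lemma bargmann_projP f : L2mu f -> bargmann (bargmann_proj f) /\
  forall k, bargmann k -> inner (fun z => f z - bargmann_proj f z) k = 0.
Proof.
move=> fL; have /L2muP[mf f2] := fL.
have [C1 H1] := gauss_bounded1 R.
have fA : (\int[dmu R]_p (normc (f (cplx p)) ^+ 2)%:E <= (norm2 f ^+ 2)%:E)%E.
  by rewrite sqr_norm2.
pose h := gproj (fun=> 1) (fun p => f (cplx p)).
have hB : bargmann h := gproj_bargmann H1 mf fA.
suff : [set h | bargmann h /\
    forall k, bargmann k -> inner (fun z => f z - h z) k = 0] (bargmann_proj f) by [].
apply: xgetPex; exists h; split => // k kB.
have [_ hL] := hB; have [_ kL] := kB.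
rewrite (innerBl fL hL kL).
have -> : inner f k = cint (dmu R) (fun p => (1 : R)%:C * f (cplx p) * (k (cplx p))^*).
  rewrite -[LHS]/(cint (dmu R) (fun p => f (cplx p) * (k (cplx p))^*)).
  by congr cint; apply/funext => p; rewrite mul1r.
by rewrite -(gproj_adjoint H1 mf fA kB) subrr.
Qed.

End square_integrable.

Lemma conjcM (R : realType) (x y : R[i]) : (x * y)^* = x^* * y^*.
Proof. by apply: complex_ext; rewrite !ReImE; ring. Qed.

Lemma conjcD (R : realType) (x y : R[i]) : (x + y)^* = x^* + y^*.
Proof. by apply: complex_ext; rewrite !ReImE; ring. Qed.

Lemma conjcR (R : realType) (x : R) : (x%:C)^* = x%:C :> R[i].
Proof. by apply: complex_ext; rewrite !ReImE/= ?oppr0. Qed.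

Section toeplitz.
Variable R : realType.
Variables (g : R[i] -> R) (C : R).
Hypothesis mg : measurable_fun [set: plane R] (fun p => g (cplx p)).
Hypothesis g0 : forall z, 0 <= g z.
Hypothesis gC : forall w, (\int[dA R]_p (g (cplx p) * gkern w p)%:E <= C%:E)%E.

(** The form of [g] is [<sqrt g * f, sqrt g * h>]; [sqrt g] is the weight to
    which the Schur bound applies. *)
Definition sqrt_symbol (p : plane R) : R := Num.sqrt (g (cplx p)).
Local Notation psi := sqrt_symbol.

Lemma sqrt_symbolC : gauss_bounded psi C.
Proof.
split.
- apply: measurableT_comp => //.
  by apply: continuous_measurable_fun; exact: sqrt_continuous.
- by move=> p; exact: sqrtr_ge0.
- by move=> w; under eq_integral do rewrite /psi sqr_sqrtr//.
Qed.

Lemma gproj1 (f : R[i] -> R[i]) w : bargmann f ->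
  gproj (fun=> 1) (fun p => f (cplx p)) w = f w.
Proof.
move=> fB; rewrite -(reproducing w fB); congr cint; apply/funext => p.
by rewrite mul1r.
Qed.

Let psif (f : R[i] -> R[i]) : R[i] -> R[i] := fun z => (Num.sqrt `|g z|)%:C * f z.

Let psifE f p : psif f (cplx p) = (psi p)%:C * f (cplx p).
Proof. by rewrite /psif /psi ger0_norm. Qed.

Let measurable_psif f : cmeasurable (fun p : plane R => f (cplx p)) ->
  cmeasurable (fun p : plane R => psif f (cplx p)).
Proof.
move=> mf; under eq_fun do rewrite psifE; apply: cmeasurableM => //.
by apply: cmeasurableR; case: sqrt_symbolC.
Qed.

(** Multiplication by [sqrt g] is bounded on the Bargmann space: a function of
    that space is its own projection, and [G |-> sqrt g * P G] is bounded. *)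
Lemma toeplitz_norm_le : exists2 k : R, 0 < k & forall f, bargmann f ->
  L2mu (psif f) /\ norm2 (psif f) <= k * norm2 f.
Proof.
have [C1 H1] := gauss_bounded1 R.
pose k := Num.sqrt (C1 / pi * (C / pi)) + 1.
have k0 : 0 < k by rewrite ltr_wpDl// sqrtr_ge0.
exists k => // f fB; have [_ fL] := fB; have /L2muP[mf f2] := fL.
have fA : (\int[dmu R]_p (normc (f (cplx p)) ^+ 2)%:E <= (norm2 f ^+ 2)%:E)%E.
  by rewrite sqr_norm2.
have := gproj_L2_le H1 mf fA sqrt_symbolC.
have -> : (\int[dmu R]_q (psi q ^+ 2 * normc (gproj (fun=> 1) (fun p => f (cplx p)) (cplx q)) ^+ 2)%:E
    = \int[dmu R]_q (normc (psif f (cplx q)) ^+ 2)%:E)%E.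
  apply: eq_integral => q _; rewrite gproj1// psifE normcM normcR.
  by rewrite ger0_norm ?sqrtr_ge0// exprMn.
move=> H.
have pL : L2mu (psif f).
  apply/L2muP; split; first exact: measurable_psif.
  exact: le_lt_trans H (ltry _).
split => //; apply: norm2_le => //; first by rewrite mulr_ge0 ?norm2_ge0// ltW.
apply: le_trans H _; rewrite lee_fin exprMn ler_wpM2r ?sqr_ge0//.
have [c0|c0] := leP 0 (C1 / pi * (C / pi)).
  rewrite -[leLHS]sqr_sqrtr// ler_pXn2r ?nnegrE ?sqrtr_ge0//; last exact: ltW.
  by rewrite /k lerDl.
by apply: le_trans (ltW c0) _; exact: sqr_ge0.
Qed.

Lemma toeplitz_domE f : toeplitz_dom g f <-> bargmann f.
Proof.
split=> [[]//|fB]; split => //.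
by have [k _ /(_ f fB)[]] := toeplitz_norm_le.
Qed.

Let form_integrandE f h (p : plane R) : (g (cplx p))%:C * f (cplx p) * (h (cplx p))^* =
  psif f (cplx p) * (psif h (cplx p))^*.
Proof.
rewrite !psifE conjcM conjcR.
have {1}-> : g (cplx p) = psi p * psi p by rewrite -expr2 sqr_sqrtr.
by rewrite rmorphM/=; ring.
Qed.

Lemma toeplitz_formE f h : toeplitz_form g f h = inner (psif f) (psif h).
Proof.
rewrite -[LHS]/(cint (dmu R) (fun p => (g (cplx p))%:C * f (cplx p) * (h (cplx p))^*)).
rewrite -[RHS]/(cint (dmu R) (fun p => psif f (cplx p) * (psif h (cplx p))^*)).
by congr cint; apply/funext => p; exact: form_integrandE.
Qed.

Lemma toeplitz_form_le : exists2 k : R, 0 < k & forall f h, bargmann f -> bargmann h ->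
  normc (toeplitz_form g f h) <= k * norm2 f * norm2 h.
Proof.
have [k k0 Hk] := toeplitz_norm_le; exists (k * k) => [|f h fB hB].
  exact: mulr_gt0.
have [fL fk] := Hk f fB; have [hL hk] := Hk h hB.
rewrite toeplitz_formE; apply: le_trans (normc_inner_le fL hL) _.
apply: le_trans (ler_pM _ _ fk hk) _; rewrite ?norm2_ge0//.
by rewrite le_eqVlt; apply/orP; left; apply/eqP; ring.
Qed.

Lemma toeplitz_form_bounded_symbol : toeplitz_form_bounded g.
Proof.
split.
  move=> f fB e e0; exists f; first exact/toeplitz_domE.
  suff -> : norm2 (fun z => f z - f z) = 0 by [].
  have [_ fL] := fB; apply/eqP; rewrite -sqrf_eq0 -eqe sqr_norm2.
    rewrite integral0_eq// => p _; rewrite subrr normc0 expr0n//.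
  exact: L2muB.
have [k k0 Hk] := toeplitz_form_le; exists k => // f h /toeplitz_domE fB /toeplitz_domE hB.
exact: Hk.
Qed.

Lemma toeplitz_form_sesquilinear : sesquilinear_on_bargmann (toeplitz_form g).
Proof.
have [k k0 Hk] := toeplitz_norm_le.
have iF f h : bargmann f -> bargmann h -> cintegrable (dmu R)
    (fun p => (g (cplx p))%:C * f (cplx p) * (h (cplx p))^*).
  move=> fB hB; have [fL _] := Hk f fB; have [hL _] := Hk h hB.
  rewrite (_ : (fun p => _) = (fun p => psif f (cplx p) * (psif h (cplx p))^*)).
    exact: L2mu_cintegrable.
  by apply/funext => p; exact: form_integrandE.
have E f h : toeplitz_form g f h =
  cint (dmu R) (fun p => (g (cplx p))%:C * f (cplx p) * (h (cplx p))^*) by [].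
move=> a f1 f2 h f1B f2B hB; split; rewrite !E.
  rewrite -(cintZ a (iF _ _ f1B hB)) -(cintD (cintegrableZ a (iF _ _ f1B hB)) (iF _ _ f2B hB)).
  by congr cint; apply/funext => p; ring.
rewrite -(cintZ a^* (iF _ _ hB f1B)) -(cintD (cintegrableZ a^* (iF _ _ hB f1B)) (iF _ _ hB f2B)).
by congr cint; apply/funext => p; rewrite conjcD conjcM; ring.
Qed.

(** The Toeplitz operator, as [f |-> P (sqrt g * sqrt g * f)]. *)
Definition toeplitz (f : R[i] -> R[i]) : R[i] -> R[i] :=
  gproj psi (fun p => psif f (cplx p)).

Let psif_le f : bargmann f ->
  (\int[dmu R]_p (normc (psif f (cplx p)) ^+ 2)%:E <= (norm2 (psif f) ^+ 2)%:E)%E.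
Proof.
move=> fB; have [k k0 /(_ f fB)[fL _]] := toeplitz_norm_le.
by rewrite sqr_norm2.
Qed.

Let measurable_psif_bargmann f : bargmann f ->
  cmeasurable (fun p : plane R => psif f (cplx p)).
Proof. by move=> [_ /L2muP[mf _]]; exact: measurable_psif. Qed.

Lemma toeplitz_bargmann f : bargmann f -> bargmann (toeplitz f).
Proof.
by move=> fB; exact: gproj_bargmann sqrt_symbolC (measurable_psif_bargmann fB) (psif_le fB).
Qed.

Lemma toeplitz_bounded_operator : bounded_operator toeplitz.
Proof.
split; first exact: toeplitz_bargmann.
- move=> a f h fB hB; apply/funext => w.
  have fi := gproj_integrable sqrt_symbolC (measurable_psif_bargmann fB) (psif_le fB) w.
  have hi := gproj_integrable sqrt_symbolC (measurable_psif_bargmann hB) (psif_le hB) w.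
  rewrite /toeplitz /gproj -(cintZ a fi) -(cintD (cintegrableZ a fi) hi).
  by congr cint; apply/funext => p; rewrite /psif; ring.
- have [C1 H1] := gauss_bounded1 R.
  have [k k0 Hk] := toeplitz_norm_le.
  pose m := Num.sqrt (C / pi * (C1 / pi)) + 1.
  have m0 : 0 < m by rewrite ltr_wpDl// sqrtr_ge0.
  exists (m * k) => [|f fB]; first exact: mulr_gt0.
  have [_ TL] := toeplitz_bargmann fB.
  apply: norm2_le => //; first by rewrite !mulr_ge0 ?norm2_ge0// ltW.
  have := gproj_L2_le sqrt_symbolC (measurable_psif_bargmann fB) (psif_le fB) H1.
  under eq_integral do rewrite expr1n mul1r.
  move=> H; apply: le_trans H _; rewrite lee_fin (_ : (m * k * norm2 f) ^+ 2 = m ^+ 2 * (k * norm2 f) ^+ 2); last by rewrite -mulrA exprMn.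
  have [_ fk] := Hk f fB.
  have pk : norm2 (psif f) ^+ 2 <= (k * norm2 f) ^+ 2.
    by rewrite ler_pXn2r ?nnegrE ?norm2_ge0// mulr_ge0 ?norm2_ge0// ltW.
  apply: le_trans (ler_wpM2l (sqr_ge0 m) pk).
  apply: ler_wpM2r; first exact: sqr_ge0.
  have [c0|c0] := leP 0 (C / pi * (C1 / pi)).
    rewrite -[leLHS]sqr_sqrtr// ler_pXn2r ?nnegrE ?sqrtr_ge0//; last exact: ltW.
    by rewrite /m lerDl.
  by apply: le_trans (ltW c0) _; exact: sqr_ge0.
Qed.

Lemma inner_toeplitz f h : bargmann f -> bargmann h ->
  inner (toeplitz f) h = toeplitz_form g f h.
Proof.
move=> fB hB.
have := gproj_adjoint sqrt_symbolC (measurable_psif_bargmann fB) (psif_le fB) hB.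
rewrite -[X in X = _ -> _]/(inner (toeplitz f) h) => ->.
rewrite -[RHS]/(cint (dmu R) (fun p => (g (cplx p))%:C * f (cplx p) * (h (cplx p))^*)).
congr cint; apply/funext => p; rewrite psifE.
have -> : g (cplx p) = psi p * psi p by rewrite -expr2 sqr_sqrtr.
by rewrite rmorphM/=; ring.
Qed.

Lemma toeplitz_operator_exists : exists T, is_toeplitz_operator g T.
Proof.
exists toeplitz; split; first exact: toeplitz_bounded_operator.
- exists (toeplitz_form g); last exact: inner_toeplitz.
  split => //; first exact: toeplitz_form_sesquilinear.
  exact: toeplitz_form_le.
- move=> T' [T'B _ _] [t [_ _ tE] T't] f fB.
  have dB := bargmannB (T'B f fB) (toeplitz_bargmann fB).
  have [_ dL] := dB; have [_ T'L] := T'B f fB; have [_ TL] := toeplitz_bargmann fB.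
  apply/funext => z; apply/eqP; rewrite -subr_eq0; apply/eqP.
  apply: (bargmann_eq0 dB); apply/eqP; rewrite -sqrf_eq0; apply/eqP.
  apply: (@complexI R); rewrite -inner_self// innerBl//.
  rewrite T't// tE; [|exact/toeplitz_domE|exact/toeplitz_domE].
  by rewrite inner_toeplitz// subrr.
Qed.

(** If [U_g] is bounded then [h |-> g * h] is bounded on the Bargmann space:
    [f = g * h] satisfies [|f| ^ 2 = <g * f, h> = <U_g f, h> <= k * |f| * |h|]. *)
Lemma U_bounded_norm2_le : U_bounded g -> exists2 k : R, 0 < k &
  forall h, bargmann h -> mult_dom g (fun z => (g z)%:C * h z) ->
    norm2 (fun z => (g z)%:C * h z) <= k * norm2 h.
Proof.
move=> [k k0 Uk]; exists k => // h hB fD; have [fL gfL] := fD.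
set f := (fun z => (g z)%:C * h z) in fL gfL fD *.
have [hE hL] := hB; have [PB Porth] := bargmann_projP gfL; have [_ PL] := PB.
have := Porth h hB; rewrite innerBl// => /eqP; rewrite subr_eq0 => /eqP E.
have Ef : inner (fun z => (g z)%:C * f z) h = inner f f.
  rewrite -[LHS]/(cint (dmu R) (fun p => (g (cplx p))%:C * f (cplx p) * (h (cplx p))^*)).
  rewrite -[RHS]/(cint (dmu R) (fun p => f (cplx p) * (f (cplx p))^*)).
  by congr cint; apply/funext => p; rewrite {3}/f conjcM conjcR; ring.
have := normc_inner_le PL hL; rewrite -E Ef inner_self// normcR ger0_norm ?sqr_ge0//.
have := Uk f fD; rewrite /U_op => H1 H2.
have f0 := norm2_ge0 f; have h0 := norm2_ge0 h.
have [->|fn0] := eqVneq (norm2 f) 0; first by rewrite mulr_ge0// ltW.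
have fpos : 0 < norm2 f by rewrite lt_neqAle eq_sym fn0.
have : norm2 f * norm2 f <= k * norm2 f * norm2 h.
  rewrite -expr2; apply: le_trans H2 _.
  by rewrite ler_wpM2r.
by rewrite mulrAC ler_pM2r.
Qed.

End toeplitz.

(** * The radial profile *)

Section profile.
Variable R : realType.
Implicit Types (s t u v a b : R).

(** The profile is the derivative of
    [primitive s = s / 2 + arg (2 + s ^ 2 * (1 - exp (- i * s)))]. The number under
    the argument has a positive real part, so the argument is the arctangent
    below and [primitive s - s / 2] is bounded, while the profile has a peak of
    height about [s ^ 2 / 2] and width about [s ^ -2] at each multiple of
    [2 * pi]. Half the squared modulus of that number is [pden s]. *)
Definition pden s : R := 2 + (2 * s ^+ 2 + s ^+ 4) * (1 - cos s).
Definition profile s : R := (1 + s ^+ 2 + 2 * s * sin s) / pden s.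
Definition primitive s : R :=
  s / 2 + atan (s ^+ 2 * sin s / (2 + s ^+ 2 * (1 - cos s))).

Lemma pden_ge2 s : 2 <= pden s.
Proof.
rewrite lerDl; apply: mulr_ge0; last by rewrite subr_ge0 cos_le1.
by apply: addr_ge0; [rewrite mulr_ge0 ?sqr_ge0|exact: exprn_even_ge0].
Qed.

Lemma pden_gt0 s : 0 < pden s.
Proof. by apply: lt_le_trans (pden_ge2 s). Qed.

Lemma profile_ge0 s : 0 <= profile s.
Proof.
apply: divr_ge0; last exact/ltW/pden_gt0.
have := sin_le1 s; have := sin_geN1 s => h1 h2.
have [s0|s0] := leP 0 s; have := sqr_ge0 (1 - s); have := sqr_ge0 (1 + s) => ? ?; nra.
Qed.

Lemma profile_le s : 0 <= s -> profile s <= (1 + s) ^+ 2.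
Proof.
move=> s0; rewrite ler_pdivrMr ?pden_gt0//.
have h := pden_ge2 s; have h2 := sin_le1 s; have h3 := sqr_ge0 (1 + s).
apply: (@le_trans _ _ ((1 + s) ^+ 2 * 1)); last by rewrite ler_wpM2l//; lra.
nra.
Qed.

Lemma is_derive_primitive s : is_derive s 1 primitive (profile s).
Proof.
have D0 : 0 < 2 + s ^+ 2 * (1 - cos s).
  have := cos_le1 s; have := sqr_ge0 s => ? ?; nra.
have D1 : 2 + s ^+ 2 * (1 - cos s) != 0 by rewrite gt_eqF.
have P0 : pden s != 0 by rewrite gt_eqF// pden_gt0.
have S2 : sin s ^+ 2 = 1 - cos s ^+ 2 by rewrite sin2cos2.
rewrite /primitive; apply: is_derive_eq; rewrite /GRing.scale/=.
set D := 2 + s ^+ 2 * (1 - cos s) in D0 D1 *.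
have -> : (1 + (s ^+ 2 * sin s / D) ^+ 2)^-1 = D ^+ 2 / (2 * pden s).
  have -> : 1 + (s ^+ 2 * sin s / D) ^+ 2 = 2 * pden s / D ^+ 2.
    have -> : 1 + (s ^+ 2 * sin s / D) ^+ 2 = (D ^+ 2 + s ^+ 4 * sin s ^+ 2) / D ^+ 2 by field.
    by rewrite S2; congr (_ / _); rewrite /D /pden; ring.
  by field; rewrite P0 D1.
have num : (2 * s * sin s + s ^+ 2 * cos s) * D
    - s ^+ 2 * sin s * (s ^+ 2 * sin s + (1 - cos s) * (2 * s)) =
    4 * s * sin s + 2 * s ^+ 2 * cos s - s ^+ 4 * (1 - cos s).
  transitivity ((2 * s * sin s + s ^+ 2 * cos s) * D - s ^+ 4 * sin s ^+ 2
    - s ^+ 2 * sin s * ((1 - cos s) * (2 * s))); first ring.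
  by rewrite S2 /D; ring.
transitivity (2^-1 + ((2 * s * sin s + s ^+ 2 * cos s) * D
    - s ^+ 2 * sin s * (s ^+ 2 * sin s + (1 - cos s) * (2 * s))) / (2 * pden s)).
  by move: (pden s) P0 => P P0; field; rewrite P0 D1.
rewrite num /profile; move: P0; rewrite /pden => P0; field; exact: P0.
Qed.

Lemma primitive_increment a b : `|primitive b - primitive a - (b - a) / 2| <= pi.
Proof.
rewrite /primitive; set x := b ^+ 2 * sin b / _; set y := a ^+ 2 * sin a / _.
have -> : b / 2 + atan x - (a / 2 + atan y) - (b - a) / 2 = atan x - atan y by field.
have := atan_gtNpi2 x; have := atan_ltpi2 x; have := atan_gtNpi2 y; have := atan_ltpi2 y.
by move=> ? ? ? ?; rewrite ler_norml; apply/andP; split; lra.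
Qed.

Lemma continuous_profile : continuous profile.
Proof.
move=> s; apply: cvgM.
  apply: (@continuousD _ R^o R^o (fun s => 1 + s ^+ 2) (fun s => 2 * s * sin s)).
    by apply: cvgD; [exact: cvg_cst|exact: exprn_continuous].
  by apply: cvgM; [apply: cvgM; [exact: cvg_cst|exact: cvg_id]|exact: continuous_sin].
apply: cvgV; first by rewrite gt_eqF// pden_gt0.
apply: cvgD; first exact: cvg_cst.
apply: cvgM.
  apply: cvgD; last exact: exprn_continuous.
  by apply: cvgM; [exact: cvg_cst|exact: exprn_continuous].
by apply: cvgB; [exact: cvg_cst|exact: continuous_cos].
Qed.

Local Notation leb := (@lebesgue_measure R).

(** The mass of the profile along a unit interval of a horizontal or vertical
    line is bounded when [|u| >= b >= 1] there: the derivative of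
    [u ^ 2 + v ^ 2] has modulus at least [2 * b], that function varies by at most
    [2 * b + 1], and an increment of [primitive] is at most half the increment
    of its argument plus [pi]. The sign of [u] is [e]. *)
Lemma profile_interval_le (e a b v : R) : `|e| = 1 -> 1 <= b ->
  (forall u, a <= u <= a + 1 -> b <= e * u) ->
  e * ((a + 1) ^+ 2 - a ^+ 2) <= 2 * b + 1 ->
  (\int[leb]_(u in `[a, (a + 1)%R]) (profile (u ^+ 2 + v ^+ 2)%R)%:E <= (1 + pi)%:E)%E.
Proof.
move=> e1 b1 bu eb.
pose F u := (2 * b)^-1 * (e * primitive (u ^+ 2 + v ^+ 2)).
pose f u := (2 * b)^-1 * (e * (profile (u ^+ 2 + v ^+ 2) * (2 * u))).
have ab : a < a + 1 by rewrite ltrDl.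
have cq (u : R) : {for u, continuous (fun u : R => u ^+ 2 + v ^+ 2)}.
  by apply: cvgD; [exact: exprn_continuous|exact: cvg_cst].
have cp : continuous (fun u => profile (u ^+ 2 + v ^+ 2)).
  by move=> u; apply: (@continuous_comp _ _ _ (fun u : R => u ^+ 2 + v ^+ 2) profile u (cq u));
    exact: continuous_profile.
have cf : continuous f.
  move=> u; apply: cvgM; first exact: cvg_cst.
  apply: cvgM; first exact: cvg_cst.
  by apply: cvgM; [exact: cp|apply: cvgM; [exact: cvg_cst|exact: cvg_id]].
have dF u : is_derive u 1 F (f u).
  have dq : is_derive u 1 (fun u : R => u ^+ 2 + v ^+ 2) (2 * u).
    by apply: is_derive_eq; rewrite /GRing.scale/=; ring.
  have dp := is_derive_primitive (u ^+ 2 + v ^+ 2).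
  have dc := @is_derive1_comp _ primitive (fun u : R => u ^+ 2 + v ^+ 2) u _ _ dp dq.
  rewrite /F; apply: is_derive_eq; rewrite /GRing.scale/= /f; ring.
have cF : continuous F.
  by move=> u; apply: differentiable_continuous; apply/derivable1_diffP; have := dF u => -[].
have dLR : derivable_oo_LRcontinuous F a (a + 1).
  split.
  - by move=> u _; have [] := dF u.
  - by apply: cvg_at_right_filter; exact: cF.
  - by apply: cvg_at_left_filter; exact: cF.
have dE : {in `]a, a + 1[, (F^`())%classic =1 f}.
  by move=> u _; rewrite derive1E; have [] := dF u.
have FTC := continuous_FTC2 ab (continuous_subspaceT cf) dLR dE.
have b0 : 0 < 2 * b by lra.
apply: (@le_trans _ _ (\int[leb]_(u in `[a, (a + 1)%R]) (f u)%:E)%E).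
  apply: ge0_le_integral => //.
  - by move=> u _; rewrite lee_fin profile_ge0.
  - by apply/measurable_EFinP; apply: measurable_funTS; exact: continuous_measurable_fun.
  - by apply/measurable_EFinP; apply: measurable_funTS; exact: continuous_measurable_fun.
  - move=> u; rewrite /= in_itv/= => /bu H; rewrite lee_fin /f.
    have p0 := profile_ge0 (u ^+ 2 + v ^+ 2).
    rewrite mulrC ler_pdivlMr//.
    have -> : e * (profile (u ^+ 2 + v ^+ 2) * (2 * u)) = profile (u ^+ 2 + v ^+ 2) * (2 * (e * u)) by ring.
    by rewrite ler_wpM2l// ler_pM2l.
rewrite FTC -EFinB lee_fin /F -!mulrBr mulrC ler_pdivrMr//.
have := primitive_increment (a ^+ 2 + v ^+ 2) ((a + 1) ^+ 2 + v ^+ 2).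
set Y := primitive _ - primitive _ => H.
have : e * (Y - ((a + 1) ^+ 2 + v ^+ 2 - (a ^+ 2 + v ^+ 2)) / 2) <= pi.
  by apply: le_trans (ler_norm _) _; rewrite normrM e1 mul1r.
have p0 : 0 <= pi :> R by exact: pi_ge0.
move: (pi : R) p0 => P P0 H2.
have : e * Y <= P + b + 1 / 2 by lra.
move=> H3; nra.
Qed.

Lemma profile_interval_right (a v : R) : 1 <= a ->
  (\int[leb]_(u in `[a, (a + 1)%R]) (profile (u ^+ 2 + v ^+ 2)%R)%:E <= (1 + pi)%:E)%E.
Proof.
move=> a1; apply: (@profile_interval_le 1 a a v) => //; first by rewrite normr1.
  by move=> u /andP[]; rewrite mul1r.
by rewrite mul1r; nra.
Qed.

Lemma profile_interval_left (a v : R) : a <= -2 ->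
  (\int[leb]_(u in `[a, (a + 1)%R]) (profile (u ^+ 2 + v ^+ 2)%R)%:E <= (1 + pi)%:E)%E.
Proof.
move=> a1; apply: (@profile_interval_le (-1) a (- (a + 1)) v) => //.
- by rewrite normrN normr1.
- lra.
- by move=> u /andP[? ?]; lra.
- by nra.
Qed.

End profile.

(** * Gaussian averages of the symbol *)

Section gaussian_averages.
Variable R : realType.
Local Notation leb := (@lebesgue_measure R).

(** The radial symbol: the profile, as a function of the squared modulus. *)
Definition symbol (z : R[i]) : R := profile (normc z ^+ 2).

Lemma symbolE (p : plane R) : symbol (cplx p) = profile (p.1 ^+ 2 + p.2 ^+ 2).
Proof. by rewrite /symbol sqr_normc_def. Qed.

Lemma symbol_ge0 z : 0 <= symbol z. Proof. exact: profile_ge0. Qed.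

Lemma measurable_symbol : measurable_fun [set: plane R] (fun p => symbol (cplx p)).
Proof.
under eq_fun do rewrite symbolE.
apply: (@measurableT_comp _ _ _ _ _ _ (@profile R)).
  by apply: continuous_measurable_fun; exact: continuous_profile.
by apply: measurable_funD; apply: measurable_funX.
Qed.

(** The indicator function of the interval [a, a + 1], at [x]. *)
Definition unit_ind (a x : R) : R := \1_(`[0, 1]%classic : set R) (x - a).

Lemma unit_indE a x : unit_ind a x = (a <= x <= a + 1)%R%:R.
Proof.
rewrite /unit_ind indicE; congr (nat_of_bool _)%:R.
rewrite mem_setE in_itv/= subr_ge0 lerBlDl.
by [].
Qed.

Lemma unit_ind_ge0 a x : 0 <= unit_ind a x. Proof. by rewrite unit_indE. Qed.

Lemma unit_ind_swap a x : unit_ind a x = unit_ind (x - 1) a.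
Proof. by rewrite !unit_indE subrK lerBlDr andbC. Qed.

Lemma measurable_unit_ind1 a : measurable_fun setT (unit_ind a).
Proof.
by apply: measurableT_comp; [exact: measurable_indic|exact: measurable_funB].
Qed.

Lemma integral_unit_ind a (f : R -> R) :
  (\int[leb]_x (unit_ind a x * f x)%:E = \int[leb]_(x in `[a, (a + 1)%R]) (f x)%:E)%E.
Proof.
rewrite [RHS]integral_mkcond; apply: eq_integral => x _; rewrite patchE unit_indE.
by rewrite mem_setE in_itv/=; case: ifP => _; rewrite ?mul1r ?mul0r.
Qed.

Lemma integral_unit_ind1 a : (\int[leb]_x (unit_ind a x)%:E = 1)%E.
Proof.
under eq_integral do rewrite -[unit_ind _ _]mulr1.
rewrite integral_unit_ind integral_cst//= lebesgue_measure_itv/= lte_fin ltrDl ltr01.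
by rewrite mul1e -EFinB addrC addKr.
Qed.

(** The indicator function of the unit square with lower left corner [(a, b)]. *)
Definition square_ind (a b : R) (p : plane R) : R := unit_ind a p.1 * unit_ind b p.2.

Lemma square_ind_ge0 a b p : 0 <= square_ind a b p.
Proof. by rewrite mulr_ge0 ?unit_ind_ge0. Qed.

Lemma measurable_square_ind a b : measurable_fun setT (square_ind a b).
Proof.
by apply: measurable_funM; apply: measurableT_comp => //; exact: measurable_unit_ind1.
Qed.

Lemma integral_square_ind a b : (\int[dA R]_p (square_ind a b p)%:E = 1)%E.
Proof.
rewrite tonelli_dA.
- under eq_integral => x _.
    under eq_integral do rewrite /square_ind/= EFinM.
    rewrite ge0_integralZl_EFin ?unit_ind_ge0//.
    + rewrite integral_unit_ind1 mule1; over.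
    + by move=> y _; rewrite lee_fin unit_ind_ge0.
    + by apply/measurable_EFinP; exact: measurable_unit_ind1.
  exact: integral_unit_ind1.
- by apply/measurable_EFinP; exact: measurable_square_ind.
- by move=> p; rewrite lee_fin square_ind_ge0.
Qed.

Lemma measurable_square_symbol a b :
  measurable_fun setT (fun p => (square_ind a b p * symbol (cplx p))%:E).
Proof.
apply/measurable_EFinP; apply: measurable_funM; first exact: measurable_square_ind.
exact: measurable_symbol.
Qed.

Let square_symbol_ge0 a b p : (0 <= (square_ind a b p * symbol (cplx p))%:E)%E.
Proof. by rewrite lee_fin mulr_ge0 ?square_ind_ge0 ?symbol_ge0. Qed.

Let pi0 : 0 <= pi :> R. Proof. exact: pi_ge0. Qed.

Let mprofile_line v : measurable_fun setT (fun u : R => profile (u ^+ 2 + v ^+ 2)).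
Proof.
apply: (@measurableT_comp _ _ _ _ _ _ (@profile R)).
  by apply: continuous_measurable_fun; exact: continuous_profile.
by apply: measurable_funD => //; apply: measurable_funX.
Qed.

Let line_le a v : 1 <= a \/ a <= -2 ->
  (\int[leb]_u (unit_ind a u * profile (u ^+ 2 + v ^+ 2)%R)%:E <= (1 + pi)%:E)%E.
Proof.
rewrite integral_unit_ind => -[a1|a2].
  exact: profile_interval_right.
exact: profile_interval_left.
Qed.

Let outer_le b : (\int[leb]_y ((unit_ind b y)%:E * (1 + pi)%:E) <= (82 + pi)%:E)%E.
Proof.
rewrite ge0_integralZr//.
- by rewrite integral_unit_ind1 mul1e lee_fin lerD2r ler1n.
- by apply/measurable_EFinP; exact: measurable_unit_ind1.
- by move=> y _; rewrite lee_fin unit_ind_ge0.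
- by rewrite lee_fin addr_ge0.
Qed.

(** The symbol has bounded mass on unit squares. A square disjoint from the strip
    [|x| < 1] or from the strip [|y| < 1] is sliced by lines along which
    [profile_interval_le] applies; any other square lies within [|z| ^ 2 <= 8],
    where the symbol is at most [81]. *)
Lemma square_symbol_le a b :
  (\int[dA R]_p (square_ind a b p * symbol (cplx p))%:E <= (82 + pi)%:E)%E.
Proof.
have far1 a' b' : 1 <= a' \/ a' <= -2 ->
    (\int[leb]_y \int[leb]_x (unit_ind a' x * unit_ind b' y * profile (x ^+ 2 + y ^+ 2)%R)%:E <= (82 + pi)%:E)%E.
  move=> aP; apply: le_trans (outer_le b').
  have mF : measurable_fun setT (fun y => \int[leb]_x (unit_ind a' x * unit_ind b' y * profile (x ^+ 2 + y ^+ 2)%R)%:E)%E.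
    rewrite (_ : (fun y => _) = (fun y => \int[leb]_x (square_ind a' b' (x, y) * symbol (cplx (x, y)))%:E)%E).
      exact: (@measurable_fun_fubini_tonelli_G _ _ _ _ R leb
        (fun p : plane R => (square_ind a' b' p * symbol (cplx p))%:E)
        (measurable_square_symbol a' b') (square_symbol_ge0 a' b')).
    by apply/funext => y; apply: eq_integral => x _; rewrite symbolE.
  apply: ge0_le_integral => //.
  - move=> y _; apply: integral_ge0 => x _.
    by rewrite lee_fin mulr_ge0 ?profile_ge0// mulr_ge0 ?unit_ind_ge0.
  - apply: emeasurable_funM => //; apply/measurable_EFinP; exact: measurable_unit_ind1.
  - move=> y _.
    under eq_integral do rewrite mulrAC mulrC EFinM.
    rewrite ge0_integralZl_EFin ?unit_ind_ge0//.
    + by apply: lee_wpmul2l; [rewrite lee_fin unit_ind_ge0|exact: line_le].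
    + by move=> x _; rewrite lee_fin mulr_ge0 ?unit_ind_ge0 ?profile_ge0.
    + apply/measurable_EFinP; apply: measurable_funM; first exact: measurable_unit_ind1.
      exact: mprofile_line.
have [a1|a1] := leP 1 a.
  rewrite (tonelli_dA2 (measurable_square_symbol a b) (square_symbol_ge0 a b)).
  under eq_integral do under eq_integral do rewrite symbolE.
  by apply: far1; left.
have [a2|a2] := leP a (-2).
  rewrite (tonelli_dA2 (measurable_square_symbol a b) (square_symbol_ge0 a b)).
  under eq_integral do under eq_integral do rewrite symbolE.
  by apply: far1; right.
have tr : (\int[dA R]_p (square_ind a b p * symbol (cplx p))%:E =
    \int[leb]_x \int[leb]_y (unit_ind b y * unit_ind a x * profile (y ^+ 2 + x ^+ 2)%R)%:E)%E.
  rewrite (tonelli_dA (measurable_square_symbol a b) (square_symbol_ge0 a b)).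
  apply: eq_integral => x _; apply: eq_integral => y _.
  by rewrite symbolE /square_ind/= [unit_ind b y * _]mulrC addrC.
have [b1|b1] := leP 1 b; first by rewrite tr; apply: far1; left.
have [b2|b2] := leP b (-2); first by rewrite tr; apply: far1; right.
apply: (@le_trans _ _ (\int[dA R]_p (81%:E * (square_ind a b p)%:E))%E).
  apply: ge0_le_integral => //.
  - exact: measurable_square_symbol.
  - by apply: emeasurable_funM => //; apply/measurable_EFinP; exact: measurable_square_ind.
  - move=> p _; rewrite -EFinM lee_fin mulrC symbolE /square_ind !unit_indE.
    case: andP => [[p1 p2]|_]; last by rewrite mul0r !mulr0.
    case: andP => [[p3 p4]|_]; last by rewrite !mulr0.
    rewrite !mulr1; set s := p.1 ^+ 2 + p.2 ^+ 2.
    have s0 : 0 <= s by rewrite addr_ge0// sqr_ge0.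
    have s8 : s <= 8 by rewrite /s; nra.
    apply: le_trans (profile_le s0) _; nra.
rewrite ge0_integralZl_EFin//.
- by rewrite integral_square_ind mule1 lee_fin; apply: (@le_trans _ _ 82); [lra|rewrite lerDl].
- by move=> p _; rewrite lee_fin square_ind_ge0.
- by apply/measurable_EFinP; exact: measurable_square_ind.
Qed.

(** The Gaussian [exp (- c * |z - (x1, x2)| ^ 2)]. *)
Definition gauss_bump (c x1 x2 : R) (p : plane R) : R :=
  expR (- (c * ((p.1 - x1) ^+ 2 + (p.2 - x2) ^+ 2))).

Lemma measurable_gauss_bump c x1 x2 : measurable_fun setT (gauss_bump c x1 x2).
Proof.
apply: measurableT_comp => //; apply: measurable_funN.
apply: measurable_funM => //; apply: measurable_funD; apply: measurable_funX.
  by apply: measurable_funB.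
by apply: measurable_funB.
Qed.

Lemma gauss_bump_ge0 c x1 x2 p : 0 <= gauss_bump c x1 x2 p.
Proof. exact: expR_ge0. Qed.

(** Gaussian averages of the symbol are bounded, uniformly in the centre:
    a Gaussian is dominated by the average of a wider Gaussian over a unit
    square. *)
Lemma symbol_gauss_average_le c : 0 < c -> exists2 K : R, 0 <= K & forall x1 x2,
  (\int[dA R]_p (symbol (cplx p) * gauss_bump c x1 x2 p)%:E <= K%:E)%E.
Proof.
move=> c0; have c20 : 0 < c / 2 by rewrite divr_gt0.
have [K K0 HK] := gauss_plane c20.
pose A := expR (2 * c).
have A0 : 0 <= A by exact: expR_ge0.
have M0 : 0 <= 82 + pi :> R by rewrite addr_ge0.
exists (A * (82 + pi) * K) => [|x1 x2]; first by rewrite !mulr_ge0.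
pose E2 := gauss_bump (c / 2) x1 x2.
pose h (x : plane R * plane R) : R :=
  symbol (cplx x.1) * square_ind x.1.1 x.1.2 x.2 * (A * E2 x.2).
have mp11 : measurable_fun [set: plane R * plane R] (fun x => x.1.1) by apply: measurableT_comp.
have mp12 : measurable_fun [set: plane R * plane R] (fun x => x.1.2) by apply: measurableT_comp.
have mp21 : measurable_fun [set: plane R * plane R] (fun x => x.2.1) by apply: measurableT_comp.
have mp22 : measurable_fun [set: plane R * plane R] (fun x => x.2.2) by apply: measurableT_comp.
have mE2 := measurable_gauss_bump (c / 2) x1 x2.
have mh : measurable_fun setT (fun x => (h x)%:E).
  apply/measurable_EFinP; apply: measurable_funM.
    apply: measurable_funM; first exact: (measurableT_comp measurable_symbol measurable_fst).
    apply: measurable_funM.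
      by apply: measurableT_comp; [exact: measurable_indic|exact: measurable_funB].
    by apply: measurableT_comp; [exact: measurable_indic|exact: measurable_funB].
  by apply: measurable_funM => //; exact: (measurableT_comp mE2 measurable_snd).
have h0 x : (0 <= (h x)%:E)%E.
  rewrite lee_fin; apply: mulr_ge0; last exact: mulr_ge0 A0 (gauss_bump_ge0 _ _ _ _).
  by apply: mulr_ge0; [exact: symbol_ge0|exact: square_ind_ge0].
apply: (@le_trans _ _ (\int[@lebesgue2 R]_y \int[@lebesgue2 R]_p (h (y, p))%:E)%E).
  apply: ge0_le_integral => //.
  - by move=> y _; rewrite lee_fin mulr_ge0 ?symbol_ge0 ?gauss_bump_ge0.
  - apply/measurable_EFinP; apply: measurable_funM; first exact: measurable_symbol.
    exact: measurable_gauss_bump.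
  - exact: (@measurable_fun_fubini_tonelli_F _ _ (plane R) (plane R) R (@lebesgue2 R) (fun x => (h x)%:E)).
  - move=> y _.
    have -> : (symbol (cplx y) * gauss_bump c x1 x2 y)%:E =
      (\int[@lebesgue2 R]_p ((symbol (cplx y) * gauss_bump c x1 x2 y)%:E * (square_ind y.1 y.2 p)%:E))%E.
      rewrite ge0_integralZl_EFin//.
      + by rewrite [X in (_ * X)%E]integral_square_ind mule1.
      + by move=> p _; rewrite lee_fin square_ind_ge0.
      + by apply/measurable_EFinP; exact: measurable_square_ind.
      + by rewrite mulr_ge0 ?symbol_ge0 ?gauss_bump_ge0.
    apply: ge0_le_integral => //.
    + move=> p _; apply: mule_ge0; rewrite lee_fin ?square_ind_ge0//.
      by rewrite mulr_ge0 ?symbol_ge0 ?gauss_bump_ge0.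
    + by apply: emeasurable_funM => //; apply/measurable_EFinP; exact: measurable_square_ind.
    + have mhy : measurable_fun setT (fun p => symbol (cplx y) * square_ind y.1 y.2 p * (A * E2 p)).
        have m1 : measurable_fun setT (fun p : plane R => symbol (cplx y) * square_ind y.1 y.2 p).
          by apply: measurable_funM; [exact: measurable_cst|exact: measurable_square_ind].
        have m2 : measurable_fun setT (fun p : plane R => A * E2 p).
          by apply: measurable_funM; [exact: measurable_cst|exact: mE2].
        exact: measurable_funM m1 m2.
      by apply/measurable_EFinP; exact: mhy.
    + move=> p _; rewrite -EFinM lee_fin.
      have -> : h (y, p) = symbol (cplx y) * (square_ind y.1 y.2 p * (A * E2 p)).
        exact: (esym (mulrA _ _ _)).
      rewrite -[leLHS]mulrA; apply: (ler_wpM2l (symbol_ge0 _)).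
      rewrite [leRHS]mulrC mulrC /square_ind !unit_indE.
      case: andP => [[p1 p2]|_]; last by rewrite !mul0r mulr0.
      case: andP => [[p3 p4]|_]; last by rewrite mulr0 mul0r mulr0.
      rewrite !mulr1 mul1r /A /E2 /gauss_bump -expRD ler_expR.
      have q (r s t : R) : r <= s -> s <= r + 1 -> (s - t) ^+ 2 <= 2 * (r - t) ^+ 2 + 2.
        move=> rs sr; have := sqr_ge0 (s - r - (r - t)) => ?.
        have : (s - r) ^+ 2 <= 1 by nra.
        by nra.
      have := q _ _ x1 p1 p2; have := q _ _ x2 p3 p4.
      move: ((p.1 - x1) ^+ 2) ((p.2 - x2) ^+ 2) ((y.1 - x1) ^+ 2) ((y.2 - x2) ^+ 2) => u v u' v' H1 H2.
      nra.
rewrite (fubini_tonelli (m1 := @lebesgue2 R) (m2 := @lebesgue2 R) (fun x => (h x)%:E))//.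
apply: (@le_trans _ _ (\int[@lebesgue2 R]_p ((A * (82 + pi))%:E * (E2 p)%:E))%E).
  apply: ge0_le_integral => //.
  - by move=> p _; apply: integral_ge0.
  - exact: (@measurable_fun_fubini_tonelli_G _ _ (plane R) (plane R) R (@lebesgue2 R) (fun x => (h x)%:E)).
  - by apply: emeasurable_funM => //; exact/measurable_EFinP.
  - move=> p _.
    have -> : (\int[@lebesgue2 R]_y (h (y, p))%:E = \int[@lebesgue2 R]_y ((A * E2 p)%:E *
        (square_ind (p.1 - 1) (p.2 - 1) y * symbol (cplx y))%:E))%E.
      apply: eq_integral => y _; rewrite -EFinM; congr (_%:E).
      rewrite /h /= /square_ind (unit_ind_swap y.1) (unit_ind_swap y.2).
      by ring.
    rewrite ge0_integralZl_EFin//.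
    + have -> : ((A * (82 + pi))%:E * (E2 p)%:E = (A * E2 p)%:E * (82 + pi)%:E)%E.
        by rewrite -!EFinM; congr (_%:E); ring.
      apply: lee_wpmul2l; last exact: square_symbol_le.
      by rewrite lee_fin; exact: mulr_ge0 A0 (gauss_bump_ge0 _ _ _ _).
    + exact: measurable_square_symbol.
    + exact: mulr_ge0 A0 (gauss_bump_ge0 _ _ _ _).
rewrite ge0_integralZl_EFin//.
- rewrite [leRHS]EFinM; apply: lee_wpmul2l; last by rewrite -(HK x1 x2).
  by rewrite lee_fin; exact: mulr_ge0 A0 M0.
- by move=> p _; rewrite lee_fin gauss_bump_ge0.
- exact/measurable_EFinP.
- exact: mulr_ge0 A0 M0.
Qed.

End gaussian_averages.

(** * Smoothness and heat transforms *)

Section smoothness.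
Variable R : realType.
Local Notation P := (R^o * R^o)%type.
Implicit Types (f h : P -> R^o) (p v : P).

(** The functions of two real variables built from the coordinates by ring
    operations, sine, cosine and inversion of functions without zeros. The class
    is closed under directional derivatives, so its members are smooth. *)
Inductive elementary : (P -> R^o) -> Prop :=
| elementary_cst (c : R) : elementary (fun=> c)
| elementary_fst : elementary fst
| elementary_snd : elementary snd
| elementaryD f h : elementary f -> elementary h -> elementary (fun p => f p + h p)
| elementaryM f h : elementary f -> elementary h -> elementary (fun p => f p * h p)
| elementary_sin f : elementary f -> elementary (fun p => sin (f p))
| elementary_cos f : elementary f -> elementary (fun p => cos (f p))
| elementaryV f : elementary f -> (forall p, f p != 0) -> elementary (fun p => (f p)^-1).

Lemma derive_comp f (phi : R -> R) (d : R) p v : differentiable f p ->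
  is_derive (f p) 1 phi d ->
  differentiable (fun q => phi (f q) : R^o) p /\
  'D_v (fun q => phi (f q) : R^o) p = d * 'D_v f p.
Proof.
move=> df [dphi phiE].
have dphi' : differentiable (phi : R^o -> R^o) (f p) by apply/derivable1_diffP.
have dc : differentiable ((phi : R^o -> R^o) \o f) p by exact: differentiable_comp.
split; first exact: dc.
rewrite (deriveE v dc) (deriveE v df) diff_comp//= diff1E//.
by rewrite derive1E phiE /GRing.scale/= mulrC.
Qed.

Lemma elementary_derive f : elementary f ->
  (forall p, differentiable f p) /\ (forall v, elementary ('D_v f)).
Proof.
elim=> {f}.
- move=> c; split=> [p|v]; first exact: differentiable_cst.
  have -> : 'D_v (fun=> c : R^o) = (fun=> 0) :> (P -> R^o).
    by apply/funext => p; rewrite derive_cst.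
  exact: elementary_cst.
- have d p : differentiable (fst : P -> R^o) p.
    by apply: (@linear_differentiable _ P R^o fst) => q; exact: cvg_fst.
  split => // v.
  have -> : 'D_v (fst : P -> R^o) = (fun=> v.1).
    by apply/funext => p; rewrite deriveE// (@diff_lin _ P R^o fst)// => q; exact: cvg_fst.
  exact: elementary_cst.
- have d p : differentiable (snd : P -> R^o) p.
    by apply: (@linear_differentiable _ P R^o snd) => q; exact: cvg_snd.
  split => // v.
  have -> : 'D_v (snd : P -> R^o) = (fun=> v.2).
    by apply/funext => p; rewrite deriveE// (@diff_lin _ P R^o snd)// => q; exact: cvg_snd.
  exact: elementary_cst.
- move=> f h _ [df ef] _ [dh eh]; split=> [p|v].
    exact: (@differentiableD _ P R^o f h).
  have -> : 'D_v (fun p => f p + h p : R^o) = (fun p => 'D_v f p + 'D_v h p).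
    by apply/funext => p; rewrite (@deriveD _ P R^o f h)//; exact: diff_derivable.
  exact: elementaryD.
- move=> f h fel [df ef] hel [dh eh]; split=> [p|v].
    exact: (@differentiableM _ P f h).
  have -> : 'D_v (fun p => f p * h p : R^o) = (fun p => f p * 'D_v h p + h p * 'D_v f p).
    by apply/funext => p; rewrite (@deriveM _ P f h)//; exact: diff_derivable.
  by apply: elementaryD; exact: elementaryM.
- move=> f fel [df ef]; split=> [p|v].
    by have [] := derive_comp 0 (df p) (is_derive_sin (f p)).
  have -> : 'D_v (fun p => sin (f p) : R^o) = (fun p => cos (f p) * 'D_v f p).
    by apply/funext => p; have [] := derive_comp v (df p) (is_derive_sin (f p)).
  by apply: elementaryM => //; exact: elementary_cos.
- move=> f fel [df ef]; split=> [p|v].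
    by have [] := derive_comp 0 (df p) (is_derive_cos (f p)).
  have -> : 'D_v (fun p => cos (f p) : R^o) = (fun p => (-1 * sin (f p)) * 'D_v f p).
    apply/funext => p; have [_ ->] := derive_comp v (df p) (is_derive_cos (f p)).
    by rewrite mulN1r.
  apply: elementaryM => //; apply: elementaryM; first exact: elementary_cst.
  exact: elementary_sin.
- move=> f fel [df ef] f0.
  have dV p : is_derive (f p) 1 (fun x : R => x^-1) (- f p ^- 2).
    have H := @is_deriveV R id (f p) 1 1 (f0 p) (is_derive_id _ _).
    by apply: (is_derive_eq H); rewrite /GRing.scale/= mulr1.
  split=> [p|v]; first by have [] := derive_comp 0 (df p) (dV p).
  have -> : 'D_v (fun p => (f p)^-1 : R^o) =
      (fun p => (-1 * ((f p)^-1 * (f p)^-1)) * 'D_v f p).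
    apply/funext => p; have [_ ->] := derive_comp v (df p) (dV p).
    by rewrite mulN1r -invfM expr2.
  apply: elementaryM => //; apply: elementaryM; first exact: elementary_cst.
  by apply: elementaryM; exact: elementaryV.
Qed.

Lemma elementary_Ck n f : elementary f -> Ck n f.
Proof.
elim: n f => [|n IH] f fel; have [df ef] := elementary_derive fel.
  by split => // p; exact: differentiable_continuous.
split; first by move=> p; exact: differentiable_continuous.
move=> v _; split; first by move=> p; exact: diff_derivable.
exact: IH.
Qed.

Lemma elementaryX f n : elementary f -> elementary (fun p => f p ^+ n).
Proof.
move=> fel; elim: n => [|n IH].
  by under eq_fun do rewrite expr0; exact: elementary_cst.
by under eq_fun do rewrite exprS; exact: elementaryM.
Qed.

Lemma smooth_symbol : smooth (@symbol R).
Proof.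
move=> n; apply: elementary_Ck.
have -> : (fun p : P => @symbol R (cplx p) : R^o) =
    (fun p => profile (p.1 ^+ 2 + p.2 ^+ 2)).
  by apply/funext => p; rewrite symbolE.
have sel : elementary (fun p => p.1 ^+ 2 + p.2 ^+ 2).
  by apply: elementaryD; apply: elementaryX; [exact: elementary_fst|exact: elementary_snd].
rewrite /profile; apply: elementaryM.
  apply: elementaryD.
    by apply: elementaryD; [exact: elementary_cst|exact: elementaryX].
  apply: elementaryM; last exact: elementary_sin.
  by apply: elementaryM => //; exact: elementary_cst.
apply: elementaryV => [|p]; last by rewrite gt_eqF// pden_gt0.
apply: elementaryD; first exact: elementary_cst.
apply: elementaryM.
  apply: elementaryD; last exact: elementaryX.
  by apply: elementaryM; [exact: elementary_cst|exact: elementaryX].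
apply: elementaryD; first exact: elementary_cst.
have -> : (fun p : P => - cos (p.1 ^+ 2 + p.2 ^+ 2) : R^o) =
    (fun p => -1 * cos (p.1 ^+ 2 + p.2 ^+ 2)).
  by apply/funext => p; rewrite mulN1r.
by apply: elementaryM; [exact: elementary_cst|exact: elementary_cos].
Qed.

End smoothness.

Section heat_transform.
Variable R : realType.

Lemma radial_symbol : radial (@symbol R).
Proof. by move=> z w zw; rewrite /symbol zw. Qed.

Lemma heat_in_Linfty (t : R) : 0 < t -> in_Linfty (heat (@symbol R) t).
Proof.
move=> t0; have c0 : 0 < (4 * t)^-1 by rewrite invr_gt0 mulr_gt0.
have [K K0 HK] := symbol_gauss_average_le c0.
have k0 : 0 <= (4 * pi * t)^-1 :> R by rewrite invr_ge0 !mulr_ge0 ?pi_ge0// ltW.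
pose h (x : plane R * plane R) : R :=
  symbol (cplx x.2) * expR (- (normc (cplx x.1 - cplx x.2) ^+ 2 / (4 * t))).
have h0 x : (0 <= (h x)%:E)%E by rewrite lee_fin mulr_ge0 ?symbol_ge0 ?expR_ge0.
have mp11 : measurable_fun [set: plane R * plane R] (fun x => x.1.1) by apply: measurableT_comp.
have mp12 : measurable_fun [set: plane R * plane R] (fun x => x.1.2) by apply: measurableT_comp.
have mp21 : measurable_fun [set: plane R * plane R] (fun x => x.2.1) by apply: measurableT_comp.
have mp22 : measurable_fun [set: plane R * plane R] (fun x => x.2.2) by apply: measurableT_comp.
have mh : measurable_fun setT (fun x => (h x)%:E).
  apply/measurable_EFinP; apply: measurable_funM.
    have ms : measurable_fun setT (fun p : plane R => symbol (cplx p)) by exact: measurable_symbol.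
    exact: (measurableT_comp ms measurable_snd).
  apply: measurableT_comp => //; apply: measurable_funN; apply: measurable_funM => //.
  apply: measurable_funX; apply: (@measurable_normc _ (plane R * plane R)%type _
    (fun x => cplx x.1 - cplx x.2)).
  by split => /=; exact: measurable_funB.
have mu_ : measurable_fun [set: plane R] (heat (@symbol R) t \o @cplx R).
  apply: (@emeasurable_funM _ _ _ _ (fun=> _)); first exact: measurable_cst.
  exact: (@measurable_fun_fubini_tonelli_F _ _ (plane R) (plane R) R (@lebesgue2 R) (fun x => (h x)%:E)).
split => //.
rewrite unlock /=; case: ifP => _; last by rewrite ltry.
apply: (@le_lt_trans _ _ ((4 * pi * t)^-1 * K)%:E); last by rewrite ltry.
apply/ess_supP; apply: nearW => q /=.
have q0 : (0 <= heat (@symbol R) t (cplx q))%E.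
  by apply: mule_ge0; [rewrite lee_fin|apply: integral_ge0 => p _; exact: (h0 (q, p))].
rewrite gee0_abs//; rewrite /heat EFinM; apply: lee_wpmul2l; first by rewrite lee_fin.
apply: le_trans (HK q.1 q.2); rewrite le_eqVlt; apply/orP; left; apply/eqP.
apply: eq_integral => p _; congr (_%:E); congr (_ * expR (- _)).
by rewrite sqr_normc_def !ReImE/= mulrC; congr (_ * _); ring.
Qed.

Lemma symbol_gkern_le : exists C : R, forall w,
  (\int[dA R]_p (symbol (cplx p) * gkern w p)%:E <= C%:E)%E.
Proof.
have c0 : 0 < 2^-1 :> R by [].
have [K K0 HK] := symbol_gauss_average_le c0; exists K => w.
apply: le_trans (HK (complex.Re w) (complex.Im w)); rewrite le_eqVlt; apply/orP; left; apply/eqP.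
apply: eq_integral => p _; congr (_%:E); congr (_ * expR (- _)).
by rewrite sqr_normc_def !ReImE/= mulrC; congr (_ * _); ring.
Qed.

End heat_transform.

(** * Coherent states and unboundedness of the natural-domain operator *)

Section coherent_states.
Variable R : realType.
Implicit Types (a z : R[i]).

Lemma normc_coherent a z :
  normc (coherent a z) = expR (complex.Re (z * a^*) - normc a ^+ 2 / 2).
Proof. by rewrite /coherent normc_cexp !ReImE. Qed.

Lemma entire_coherent a : entire (coherent a).
Proof.
have -> : coherent a = @cexp R \o (fun z => a^* * z + (- (normc a ^+ 2 / 2)%:C)).
  by apply/funext => z; rewrite /coherent /= mulrC.
exact: (@entire_comp R (@cexp R) _ (@entire_cexp R) (@entire_affine R _ _)).
Qed.

Lemma cmeasurable_coherent a : cmeasurable (fun p : plane R => coherent a (cplx p)).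
Proof.
apply: cmeasurable_cexp; apply: cmeasurableD; last exact: cmeasurable_cst.
by apply: cmeasurableM; [exact: cmeasurable_cplx|exact: cmeasurable_cst].
Qed.

Lemma normc_coherent_le a z : normc (coherent a z) <= expR (normc a * normc z).
Proof.
rewrite normc_coherent ler_expR.
have h : complex.Re (z * a^*) <= normc a * normc z.
  apply: le_trans (ler_norm _) _; apply: le_trans (ler_Re_normc _) _.
  by rewrite normcM normcC mulrC.
by have := sqr_ge0 (normc a) => ?; lra.
Qed.

(** The product of a coherent state with a function of polynomial growth is
    square-integrable. *)
Lemma coherent_growth_L2mu (u : R[i] -> R) a :
  measurable_fun setT (fun p : plane R => u (cplx p)) ->
  (forall z, `|u z| <= (1 + normc z ^+ 2) ^+ 4) -> L2mu (fun z => (u z)%:C * coherent a z).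
Proof.
move=> mu_ uz.
apply: (@L2mu_growth _ _ (32 ^+ 4 * expR (2 * normc a ^+ 2))).
  by apply: cmeasurableM; [exact: cmeasurableR|exact: cmeasurable_coherent].
move=> z; rewrite normcM normcR.
have -> : 32 ^+ 4 * expR (2 * normc a ^+ 2) * expR (normc z ^+ 2 / 4) =
    (32 ^+ 4 * expR (normc z ^+ 2 / 8)) * expR (2 * normc a ^+ 2 + normc z ^+ 2 / 8).
  rewrite -[LHS]mulrA -[RHS]mulrA -!expRD; congr (_ * _); congr (@expR R _).
  by field.
apply: ler_pM; [exact: normr_ge0|exact: normc_ge0| |].
  apply: le_trans (uz z) _.
  have -> : 32 ^+ 4 * expR (normc z ^+ 2 / 8) = (32 * expR (normc z ^+ 2 / 32)) ^+ 4 :> R.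
    by rewrite exprMn -expRM_natl; congr (_ * _); congr (@expR R _); field.
  have s0 := sqr_ge0 (normc z).
  rewrite ler_pXn2r ?nnegrE ?addr_ge0// ?mulr_ge0 ?expR_ge0//.
  by have := expR_ge1Dx (normc z ^+ 2 / 32) => ?; lra.
apply: le_trans (normc_coherent_le _ _) _; rewrite ler_expR.
by have := sqr_ge0 (2 * normc a - normc z / 2) => ?; nra.
Qed.

Lemma L2mu_coherent a : L2mu (coherent a).
Proof.
have -> : coherent a = (fun z => (1 : R)%:C * coherent a z).
  by apply/funext => z; rewrite mul1r.
apply: (@coherent_growth_L2mu (fun=> 1)) => // z; rewrite normr1 exprn_ege1//.
by rewrite lerDl sqr_ge0.
Qed.

Lemma bargmann_coherent a : bargmann (coherent a).
Proof. by split; [exact: entire_coherent|exact: L2mu_coherent]. Qed.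

Lemma sqr_normc_coherent_weight a (p : plane R) :
  normc (coherent a (cplx p)) ^+ 2 * gauss_weight p =
  pi^-1 * gauss_bump 1 (complex.Re a) (complex.Im a) p.
Proof.
rewrite normc_coherent gauss_weightE mulrCA -expRM_natl -expRD; congr (_ * expR _).
by rewrite sqr_normc_def !ReImE/=; field.
Qed.

Lemma norm2_coherent_le : exists K : R, forall a, norm2 (coherent a) <= K.
Proof.
have [K K0 HK] := gauss_plane (ltr01 : 0 < 1 :> R).
exists (Num.sqrt (pi^-1 * K)) => a.
have k0 : 0 <= pi^-1 * K by rewrite mulr_ge0// invr_ge0 pi_ge0.
apply: norm2_le; [exact: sqrtr_ge0|exact: L2mu_coherent|].
rewrite sqr_sqrtr// ge0_integral_dmu; last 2 first.
- by apply/measurable_EFinP; apply: measurable_funX; apply: measurable_normc; exact: cmeasurable_coherent.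
- by move=> p; rewrite lee_fin sqr_ge0.
under eq_integral do rewrite -EFinM sqr_normc_coherent_weight EFinM.
rewrite ge0_integralZl_EFin ?invr_ge0 ?pi_ge0//.
- by rewrite HK EFinM.
- by move=> p _; rewrite lee_fin gauss_bump_ge0.
- by apply/measurable_EFinP; exact: measurable_gauss_bump.
Qed.

End coherent_states.

Section unboundedness.
Variable R : realType.

Lemma symbol_le z : @symbol R z <= (1 + normc z ^+ 2) ^+ 2.
Proof. by apply: profile_le; exact: sqr_ge0. Qed.

Lemma normc2_ge1 (z : R[i]) : 1 <= 1 + normc z ^+ 2.
Proof. by rewrite lerDl sqr_ge0. Qed.

Lemma L2mu_symbol_coherent (a : R[i]) : L2mu (fun z => (symbol z)%:C * coherent a z).
Proof.
apply: coherent_growth_L2mu; first exact: measurable_symbol.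
move=> z; rewrite ger0_norm ?symbol_ge0//; apply: le_trans (symbol_le z) _.
by apply: ler_weXn2l; [exact: normc2_ge1|].
Qed.

Lemma L2mu_symbol2_coherent (a : R[i]) :
  L2mu (fun z => (symbol z)%:C * ((symbol z)%:C * coherent a z)).
Proof.
have -> : (fun z => (symbol z)%:C * ((symbol z)%:C * coherent a z)) =
    (fun z => (symbol z ^+ 2)%:C * coherent a z).
  by apply/funext => z; rewrite mulrA -rmorphM expr2.
apply: coherent_growth_L2mu => [|z].
  by apply: measurable_funX; exact: measurable_symbol.
rewrite ger0_norm ?sqr_ge0// (exprM _ 2 2) ler_pXn2r ?nnegrE ?symbol_ge0 ?symbol_le//.
exact: sqr_ge0.
Qed.

(** The peak of the profile at a multiple [N] of [2 * pi] has height
    comparable to [N ^ 2] and width comparable to [N ^ -2]. *)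
Lemma profile_peak (n : nat) (N s : R) : N = 2 * pi * n%:R -> 1 <= N ->
  N <= s <= N + (5 * N ^+ 2)^-1 -> N ^+ 2 / 3 <= profile s.
Proof.
move=> NE N1 /andP[s1 s2].
have N20 : 1 <= N ^+ 2 by rewrite exprn_ege1.
pose t := s - N.
have t0 : 0 <= t by rewrite /t; lra.
have tN : t * (5 * N ^+ 2) <= 1.
  have N5 : 0 < 5 * N ^+ 2 by lra.
  have tle : t <= (5 * N ^+ 2)^-1 by rewrite /t; lra.
  by have := ler_wpM2r (ltW N5) tle; rewrite mulVf// lt0r_neq0.
have per k (x : R) : cos (x + 2 * pi * k%:R) = cos x /\ sin (x + 2 * pi * k%:R) = sin x.
  elim: k => [|k [IH1 IH2]]; first by rewrite mulr0 addr0.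
  have -> : x + 2 * pi * k.+1%:R = (x + 2 * pi * k%:R) + pi *+ 2.
    by rewrite -natr1 -[pi *+ 2]mulr_natl; ring.
  by rewrite cosD2pi sinD2pi.
have sE : s = t + 2 * pi * n%:R by rewrite /t NE; ring.
have cE : cos s = cos t by rewrite sE; have [] := per n t.
have siE : sin s = sin t by rewrite sE; have [] := per n t.
have sN : s = N + t by rewrite /t; ring.
have t1 : t <= 5^-1 by nra.
rewrite /profile ler_pdivlMr ?pden_gt0// /pden cE siE sN.
have ct := one_sub_cos_le t; have ct0 := cos_le1 t.
have st : - t <= sin t.
  by have := norm_sin_le t; rewrite (ger0_norm t0) ler_norml => /andP[].
clearbody t; clear NE sE cE siE sN s1 s2 per s.
have sb : N + t <= 2 * N by lra.
have s20 : 0 <= (N + t) ^+ 2 by exact: sqr_ge0.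
have s2b : (N + t) ^+ 2 <= 4 * N ^+ 2 by nra.
have lam : 2 * (N + t) ^+ 2 + (N + t) ^+ 4 <= 24 * (N ^+ 2) ^+ 2.
  have -> : (N + t) ^+ 4 = ((N + t) ^+ 2) ^+ 2 by rewrite -exprM.
  nra.
have tt : t ^+ 2 * (25 * (N ^+ 2) ^+ 2) <= 1.
  have -> : t ^+ 2 * (25 * (N ^+ 2) ^+ 2) = (t * (5 * N ^+ 2)) ^+ 2 by ring.
  by apply: exprn_ile1 => //; apply: mulr_ge0 => //; lra.
have den : (2 * (N + t) ^+ 2 + (N + t) ^+ 4) * (1 - cos t) <= 1.
  apply: (@le_trans _ _ (24 * (N ^+ 2) ^+ 2 * (t ^+ 2 / 2))).
    apply: ler_pM => //.
    by apply: addr_ge0; [apply: mulr_ge0|exact: exprn_even_ge0].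
  move: tt; move: (t ^+ 2) (N ^+ 2 ^+ 2) (sqr_ge0 t) (sqr_ge0 (N ^+ 2)) => A B A0 B0 AB.
  have AB0 : 0 <= A * B by exact: mulr_ge0.
  by have -> : 24 * B * (A / 2) = 12 * (A * B); [field|lra].
have num : N ^+ 2 <= 1 + (N + t) ^+ 2 + 2 * (N + t) * sin t.
  have : 2 * (N + t) * (- t) <= 2 * (N + t) * sin t.
    by apply: ler_wpM2l => //; lra.
  have : 2 * (N + t) * t <= 1 by nra.
  have : N ^+ 2 <= (N + t) ^+ 2 by nra.
  by move=> ? ? ?; lra.
apply: le_trans num.
move: den; move: (_ * (1 - cos t)) => X HX; nra.
Qed.

(** Near the point [rho] of the circle [|z| ^ 2 = N], with [N = 2 * pi * n], the
    symbol is at least [N ^ 2 / 3] on a rectangle of area comparable to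
    [rho ^ -7], so its square has a Gaussian average at least comparable to
    [rho]. *)
Lemma symbol_sqr_average_ge : exists2 c : R, 0 < c & forall (rho : R) (n : nat),
  1 <= rho -> rho ^+ 2 = 2 * pi * n%:R ->
  ((c * rho)%:E <= \int[dA R]_p (symbol (cplx p) ^+ 2 * gauss_bump 1 rho 0 p)%:E)%E.
Proof.
exists (expR (-2) / 1080) => [|rho n r1 rn].
  by apply: divr_gt0; [exact: expR_gt0|rewrite ltr0n].
set N := rho ^+ 2 in rn.
have N1 : 1 <= N by rewrite /N exprn_ege1.
(* the sides are such that [2 * rho * dl + dl ^ 2 + et ^ 2 <= (5 * N ^ 2)^-1] *)
pose dl : R := (30 * rho ^+ 5)^-1; pose et : R := (4 * rho ^+ 2)^-1.
have r0 : 0 < rho by apply: lt_le_trans r1.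
have dl0 : 0 < dl by rewrite invr_gt0 mulr_gt0// exprn_gt0.
have et0 : 0 < et by rewrite invr_gt0 mulr_gt0// exprn_gt0.
pose I1 : set (measurableTypeR R) := `[rho, (rho + dl)]%classic.
pose I2 : set (measurableTypeR R) := `[0, et]%classic.
have mI1 : measurable I1 by exact: measurable_itv.
have mI2 : measurable I2 by exact: measurable_itv.
have mE : measurable (I1 `*` I2 : set (plane R)) by exact: measurableX.
have msb : measurable_fun setT (fun p : plane R => symbol (cplx p) ^+ 2 * gauss_bump 1 rho 0 p).
  apply: measurable_funM; first by apply: measurable_funX; exact: measurable_symbol.
  exact: measurable_gauss_bump.
pose m : R := N ^+ 4 / 9 * expR (-2).
apply: (@le_trans _ _ (\int[dA R]_p (m%:E * (\1_(I1 `*` I2 : set (plane R)) p)%:E))%E).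
  have m0 : 0 <= m by rewrite mulr_ge0 ?expR_ge0// divr_ge0// exprn_even_ge0.
  rewrite ge0_integralZl_EFin//; last first.
    by apply/measurable_EFinP; exact: measurable_indic.
  have L1 : lebesgue_measure I1 = dl%:E.
    by rewrite lebesgue_measure_itv/= lte_fin ltrDl dl0 -EFinB (addrC rho) addrK.
  have L2 : lebesgue_measure I2 = et%:E.
    by rewrite lebesgue_measure_itv/= lte_fin et0 -EFinB subr0.
  have L12 : dA R (I1 `*` I2) = (dl * et)%:E.
    transitivity (lebesgue_measure I1 * lebesgue_measure I2)%E; last first.
      by rewrite L1 L2.
    exact: product_measure1E.
  rewrite integral_indic// setIT [X in (_ * X)%E]L12 -EFinM lee_fin.
  rewrite /m /N /dl /et le_eqVlt; apply/orP; left; apply/eqP.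
  by field; rewrite gt_eqF.
apply: ge0_le_integral => //.
- by move=> p _; rewrite -EFinM lee_fin mulr_ge0// mulr_ge0 ?expR_ge0// divr_ge0// exprn_even_ge0.
- apply: emeasurable_funM => //.
  by apply/measurable_EFinP; exact: measurable_indic.
- exact/measurable_EFinP.
- move=> p _; rewrite -EFinM lee_fin indicE.
  have [|_] := boolP (p \in _); last by rewrite mulr0 mulr_ge0 ?sqr_ge0 ?gauss_bump_ge0.
  rewrite inE /= /I1 /I2 /= !in_itv/= => -[/andP[p1 p2] /andP[p3 p4]].
  rewrite mulr1 /m; apply: ler_pM.
  + by rewrite divr_ge0// exprn_even_ge0.
  + exact: expR_ge0.
  + have -> : N ^+ 4 / 9 = (N ^+ 2 / 3) ^+ 2 by field.
    rewrite ler_pXn2r ?nnegrE ?symbol_ge0//; last by rewrite divr_ge0// sqr_ge0.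
    rewrite symbolE; apply: (profile_peak rn) => //.
    pose i := (rho ^+ 2)^-1.
    have i0 : 0 < i by rewrite invr_gt0 exprn_gt0.
    have i1 : i <= 1 by rewrite invf_le1 ?exprn_gt0// exprn_ege1.
    have e1 : 2 * rho * dl = i ^+ 2 / 15 by rewrite /dl /i; field; rewrite gt_eqF.
    have e2 : et = i / 4 by rewrite /et /i; field; rewrite gt_eqF.
    have e3 : dl <= i / 30.
      have -> : dl = i / 30 * (rho ^+ 3)^-1 by rewrite /dl /i; field; rewrite gt_eqF.
      apply: ler_piMr; first by rewrite divr_ge0// ltW.
      by rewrite invf_le1 ?exprn_gt0// exprn_ege1.
    have e4 : (5 * N ^+ 2)^-1 = i ^+ 2 / 5 by rewrite /N /i; field; rewrite gt_eqF.
    have x2 : p.1 ^+ 2 <= rho ^+ 2 + 2 * rho * dl + dl ^+ 2 by nra.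
    have y2 : p.2 ^+ 2 <= et ^+ 2 by nra.
    have d2 : dl ^+ 2 <= (i / 30) ^+ 2 by nra.
    have x3 : rho ^+ 2 <= p.1 ^+ 2 by nra.
    have y3 := sqr_ge0 p.2; have i2 := sqr_ge0 i.
    rewrite e4 -/N; apply/andP; split; first by rewrite /N; lra.
    rewrite e1 in x2; rewrite e2 in y2.
    have -> : N = rho ^+ 2 by [].
    by rewrite !exprMn in d2 y2; lra.
  + rewrite /gauss_bump ler_expR lerN2 mul1r subr0.
    have dl1 : dl <= 1.
      by rewrite invf_le1 ?mulr_gt0 ?exprn_gt0//; have := exprn_ege1 5 r1 => ?; lra.
    have et1 : et <= 1.
      by rewrite invf_le1 ?mulr_gt0 ?exprn_gt0//; have := exprn_ege1 2 r1 => ?; lra.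
    have a1 : (p.1 - rho) ^+ 2 <= 1.
      by apply: exprn_ile1; lra.
    have a2 : p.2 ^+ 2 <= 1 by apply: exprn_ile1; lra.
    lra.
Qed.

(** The norms of [g * k_a] are unbounded, which contradicts [U_bounded_norm2_le]:
    [|k_a| ^ 2] times the Gaussian weight is the Gaussian centred at [a], up to
    the factor [pi^-1]. *)
Lemma symbol_U_unbounded : ~ U_bounded (@symbol R).
Proof.
move=> UB; have [k k0 Hk] := U_bounded_norm2_le UB.
have [K HK] := norm2_coherent_le R.
have [c c0 Hc] := symbol_sqr_average_ge.
have K0 : 0 <= K by apply: le_trans (HK 0); exact: norm2_ge0.
have bound (rho : R) (n : nat) : 1 <= rho -> rho ^+ 2 = 2 * pi * n%:R ->
    c * rho <= pi * (k * K) ^+ 2.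
  move=> r1 rn; have := Hc rho n r1 rn.
  have dom : mult_dom (@symbol R) (fun z => (symbol z)%:C * coherent (rho%:C) z).
    by split; [exact: L2mu_symbol_coherent|exact: L2mu_symbol2_coherent].
  have := Hk _ (bargmann_coherent rho%:C) dom.
  set f := (fun z => (symbol z)%:C * coherent _ z) => fk.
  have fL : L2mu f by exact: L2mu_symbol_coherent.
  have fK : norm2 f ^+ 2 <= (k * K) ^+ 2.
    rewrite ler_pXn2r ?nnegrE ?norm2_ge0//; last by rewrite mulr_ge0// ltW.
    by apply: le_trans fk _; rewrite ler_pM2l.
  have piE : (\int[dA R]_p (symbol (cplx p) ^+ 2 * gauss_bump 1 rho 0 p)%:E =
      (pi * norm2 f ^+ 2)%:E)%E.
    rewrite EFinM sqr_norm2// ge0_integral_dmu; last 2 first.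
    - apply/measurable_EFinP; apply: measurable_funX; apply: measurable_normc.
      apply: cmeasurableM; last exact: cmeasurable_coherent.
      by apply: cmeasurableR; exact: measurable_symbol.
    - by move=> p; rewrite lee_fin sqr_ge0.
    rewrite -ge0_integralZl_EFin ?pi_ge0//; last 2 first.
    - by move=> p _; rewrite mule_ge0 ?lee_fin ?sqr_ge0 ?gauss_weight_ge0.
    - apply: emeasurable_funM; apply/measurable_EFinP; last exact: measurable_gauss_weight.
      apply: measurable_funX; apply: measurable_normc.
      apply: cmeasurableM; last exact: cmeasurable_coherent.
      by apply: cmeasurableR; exact: measurable_symbol.
    apply: eq_integral => p _; rewrite -!EFinM; congr (_%:E).
    rewrite /f normcM normcR (ger0_norm (symbol_ge0 _)) [(symbol _ * _) ^+ 2]exprMn.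
    rewrite -[_ * gauss_weight p]mulrA sqr_normc_coherent_weight [RHS]mulrCA; congr (_ * _).
    by rewrite mulrA mulfV ?mul1r// gt_eqF// pi_gt0.
  rewrite piE lee_fin => H; apply: le_trans H _.
  by rewrite ler_wpM2l// pi_ge0.
set B := pi * (k * K) ^+ 2 in bound.
have B0 : 0 <= B by rewrite mulr_ge0 ?pi_ge0 ?sqr_ge0.
pose n := (Num.bound ((B / c) ^+ 2) + 1)%N.
have n1 : 1 <= n%:R :> R by rewrite ler1n /n addn1.
have nB : (B / c) ^+ 2 < n%:R.
  apply: lt_le_trans (archi_boundP (sqr_ge0 _)) _.
  by rewrite ler_nat leq_addr.
have pi1 : 1 <= 2 * pi :> R by have := pi_ge2 R => ?; lra.
pose rho := Num.sqrt (2 * pi * n%:R : R).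
have q0 : n%:R <= 2 * pi * n%:R :> R by rewrite ler_peMl.
have rho2 : rho ^+ 2 = 2 * pi * n%:R by rewrite sqr_sqrtr// (le_trans _ q0).
have rho0 : 0 <= rho by exact: sqrtr_ge0.
have rho1 : 1 <= rho.
  by rewrite -(ler_pXn2r (n := 2)) ?nnegrE// rho2 expr1n (le_trans n1).
have := bound rho n rho1 rho2.
apply/negP; rewrite -ltNge mulrC -ltr_pdivrMr//.
have BcR : (B / c) ^+ 2 < rho ^+ 2 by rewrite rho2; exact: lt_le_trans nB q0.
have Bc0 : 0 <= B / c by apply: divr_ge0 => //; exact: ltW.
by rewrite ltr_pXn2r ?nnegrE in BcR.
Qed.

End unboundedness.

Theorem theorem1p1 (R : realType) :
  exists g : R[i] -> R,
    [/\ smooth g, forall z, 0 <= g z & radial g] /\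
    [/\ forall a : R[i], L2mu (fun z => (g z)%:C * coherent a z),
        forall t : R, 0 < t -> in_Linfty (heat g t),
        toeplitz_form_bounded g /\ (exists T, is_toeplitz_operator g T) &
        ~ U_bounded g].
Proof.
have [C HC] := symbol_gkern_le R.
have ms := @measurable_symbol R.
exists (@symbol R); split; first split.
- exact: smooth_symbol.
- exact: symbol_ge0.
- exact: radial_symbol.
split.
- exact: L2mu_symbol_coherent.
- exact: heat_in_Linfty.
- split; first exact: toeplitz_form_bounded_symbol ms (@symbol_ge0 R) HC.
  exact: toeplitz_operator_exists ms (@symbol_ge0 R) HC.
- exact: symbol_U_unbounded.
Qed.
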